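(* Let $x_0\in{}^*\Omega_c$. For $u\in\mathcal M({}^*\Omega_c)$, the following are equivalent: (1) $u$ is $\mathcal M^\infty$-microlocally regular at $(x_0,\xi_0)$, for each $\xi_0\in{}^*\mathbf S$; (2) $u\in\mathcal M^\infty(V)$ for some slow scale neighbourhood $V$ of $x_0$.
   Context: Internal objects. Let $I=(0,1]$. For a nonempty set $A$ (a subset of $\mathbb R^d$ or $\mathbb C$), ${}^*A:=A^I/\!\sim$, where $(x_\varepsilon)_\varepsilon\sim(y_\varepsilon)_\varepsilon$ iff $x_\varepsilon=y_\varepsilon$ for all sufficiently small $\varepsilon$ (''for small $\varepsilon$''); classes are written $[x_\varepsilon]$, and $a\in A$ is identified with the class of the constant family. Functions and operations are extended $\varepsilon$-wise; a relation such as $\le,<$ holds between $[x_\varepsilon]$ and $[y_\varepsilon]$ iff it holds between $x_\varepsilon$ and $y_\varepsilon$ for small $\varepsilon$ (so the order on ${}^*\mathbb R$ is partial). For nonempty $A_\varepsilon\subseteq\mathbb R^d$, $[A_\varepsilon]:=\{[x_\varepsilon]:x_\varepsilon\in A_\varepsilon\text{ for small }\varepsilon\}$. For a set $X$ of functions $\mathbb R^d\to\mathbb C$, ${}^*X$ is the set of maps $[f_\varepsilon]:{}^*\mathbb R^d\to{}^*\mathbb C$, $[x_\varepsilon]\mapsto[f_\varepsilon(x_\varepsilon)]$, with $f_\varepsilon\in X$ for small $\varepsilon$; derivatives $\partial^\alpha$, integrals and the Fourier transform $\widehat{\ \cdot\ }$ are taken $\varepsilon$-wise. Let $\rho:=[\varepsilon]\in{}^*\mathbb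 R$. An element $x$ of ${}^*\mathbb R^d$ or ${}^*\mathbb C$ is moderate if $|x|\le\rho^{-N}$ for some $N\in\mathbb N$, and negligible ($x\approxeq0$) if $|x|\le\rho^n$ for each $n\in\mathbb N$; ${}^*\mathbb C_{\mathcal M}$ is the set of moderate elements of ${}^*\mathbb C$. ${}^*\mathbb R^d_{fs}:=\{x\in{}^*\mathbb R^d:(\exists a\in\mathbb R_{>0})\,|x|\ge\rho^{-a}\}$. Write $x\approx_{\mathrm{fast}}y$ if $|x-y|\le\rho^a$ for some $a\in\mathbb R_{>0}$, and $x\approx_{\mathrm{slow}}0$ if $\rho^a\le|x|\le a$ for all $a\in\mathbb R_{>0}$. A slow scale neighbourhood of $x_0\in{}^*\mathbb R^d$ is any subset of ${}^*\mathbb R^d$ containing $\{x\in{}^*\mathbb R^d:|x-x_0|\le r\}$ for some $r\in{}^*\mathbb R_{>0}$ with $r\approx_{\mathrm{slow}}0$. $\Omega\subseteq\mathbb R^d$ is open, and ${}^*\Omega_c:=\bigcup_K{}^*K$ over nonempty compact $K\subset\Omega$. For $A\subseteq{}^*\mathbb R^d$, $\mathcal M(A):=\{u\in{}^*(\mathcal C^\infty(\mathbb R^d)):\partial^\alpha u(x)\in{}^*\mathbb C_{\mathcal M}\ \forall\alpha\in\mathbb N^d,\forall x\in A\}$ and $\mathcal M^\infty(A):=\{u\in{}^*(\mathcal C^\infty(\mathbb R^d)):(\forall x\in A)(\exists N\in\mathbb N)(\forall\alpha\in\mathbb N^d)\,|\partial^\alpha u(x)|\le\rho^{-N}\}$.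 Let $\mathcal K(\mathbb R^d)$ be the set of nonempty compact subsets of $\mathbb R^d$ and ${}^*(\mathcal K(\mathbb R^d)):=\{[K_\varepsilon]:K_\varepsilon\in\mathcal K(\mathbb R^d)\text{ for small }\varepsilon\}$. $u$ is compactly supported in $A$ if there is $K\in{}^*(\mathcal K(\mathbb R^d))$, $K\subseteq A$, such that $u(x)=0$ for every $x\in{}^*\mathbb R^d$ with $|x-a|>0$ for all $a\in K$. $\mathcal M_c(A)$ is the set of $u\in\mathcal M({}^*\mathbb R^d)$ compactly supported in $A$. $\mathbf S:=\{x\in\mathbb R^d:|x|=1\}$. $u\in\mathcal M({}^*\Omega_c)$ is $\mathcal M^\infty$-microlocally regular at $(x_0,\xi_0)\in{}^*\Omega_c\times{}^*\mathbf S$ if there is $v\in\mathcal M_c({}^*\Omega_c)$ with $u(x)=v(x)$ for all $x\approx_{\mathrm{fast}}x_0$ and $\widehat v(\xi)\approxeq0$ for all $\xi\in{}^*\mathbb R^d_{fs}$ with $\frac{\xi}{|\xi|}\approx_{\mathrm{fast}}\xi_0$. *)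

(* Defs.v *)
From HB Require Import structures.
From mathcomp Require Import all_boot all_order all_algebra.
From mathcomp Require Import generic_quotient.
From mathcomp Require Import all_classical all_reals all_analysis.
From mathcomp Require Import complex.
Set Implicit Arguments.
Unset Strict Implicit.
Unset Printing Implicit Defensive.
Import Order.TTheory GRing.Theory Num.Theory.
Import numFieldNormedType.Exports.
Local Open Scope classical_set_scope.
Local Open Scope ring_scope.
Local Open Scope quotient_scope.

Definition eps (R : realType) : Type := {e : R | 0 < e <= 1}.

(* "for small eps", as a filter so that the [near] tactics apply *)
Definition small (R : realType) : set_system (eps R) :=
  [set P | exists2 eta : R, 0 < eta & forall e : eps R, val e <= eta -> P e].
Arguments small : clear implicits.

#[global] Instance small_filter (R : realType) : ProperFilter (small R).
Proof.
apply: Build_ProperFilter_ex.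
  move=> P [eta eta0 hP].
  have h : 0 < Num.min eta 1 <= 1 by rewrite lt_min eta0 ltr01 ge_min lexx orbT.
  by exists (Sub (Num.min eta 1) h : eps R); apply: hP; rewrite SubK ge_min lexx.
split.
- by exists 1.
- move=> P Q [a a0 hP] [b b0 hQ]; exists (Num.min a b).
    by rewrite lt_min a0.
  by move=> e; rewrite le_min => /andP[ea eb]; split; [apply: hP|apply: hQ].
- by move=> P Q PQ [a a0 hP]; exists a => // e ea; apply/PQ/hP.
Qed.

Section Star.
Variables (R : realType) (T : Type).

Definition small_eq (x y : {classic eps R -> T}) : bool :=
  `[< \forall e \near small R, x e = y e >].

Lemma small_eq_refl : reflexive small_eq.
Proof. by move=> x; apply/asboolP; apply: nearW. Qed.

Lemma small_eq_sym : symmetric small_eq.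
Proof.
by move=> x y; apply/idP/idP => /asboolP h; apply/asboolP; apply: filterS h.
Qed.

Lemma small_eq_trans : transitive small_eq.
Proof.
move=> y x z /asboolP xy /asboolP yz; apply/asboolP.
by apply: filterS2 xy yz => e -> ->.
Qed.

Canonical small_eq_equiv :=
  EquivRel small_eq small_eq_refl small_eq_sym small_eq_trans.

Definition star : Type := {eq_quot small_eq}.
HB.instance Definition _ := Choice.on star.
HB.instance Definition _ := EqQuotient.on star.

Definition cls (x : eps R -> T) : star := \pi_star x.
Definition rep (x : star) : eps R -> T := repr x.
Definition cst_star (a : T) : star := cls (fun=> a).

Lemma repK : cancel rep cls.
Proof. by move=> x; rewrite /cls /rep reprK. Qed.

Lemma rep_cls (x : eps R -> T) : \forall e \near small R, rep (cls x) e = x e.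
Proof.
have /eqmodP /asboolP : repr (cls x) = x %[mod star] by rewrite reprK.
by [].
Qed.

Lemma clsP (x y : eps R -> T) :
  cls x = cls y <-> \forall e \near small R, x e = y e.
Proof.
split => [|h]; first by move/eqmodP/asboolP.
by apply/eqmodP/asboolP.
Qed.

(* The internal set [A_eps]. *)
Definition star_set (A : eps R -> set T) : set star :=
  [set x | \forall e \near small R, A e (rep x e)].

(* *A, for A a subset of T. *)
Definition star_of (A : set T) : set star := star_set (fun=> A).

End Star.

Section StarMaps.
Variables (R : realType) (T U V : Type).

Definition star_map (f : T -> U) (x : star R T) : star R U :=
  cls (fun e => f (rep x e)).

Definition star_map2 (f : T -> U -> V) (x : star R T) (y : star R U) : star R V :=
  cls (fun e => f (rep x e) (rep y e)).

Definition star_rel (r : T -> U -> Prop) (x : star R T) (y : star R U) : Prop :=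
  \forall e \near small R, r (rep x e) (rep y e).

End StarMaps.

Section Application.
Variables (R : realType) (T U : Type).

(* A class [f_eps] of nets of functions acts as the map
   [x_eps] |-> [f_eps (x_eps)]; by sapp_inj below, classes of nets of functions
   and the maps that they induce are the same thing. *)
Definition sapp (u : star R (T -> U)) (x : star R T) : star R U :=
  star_map2 (fun f t => f t) u x.

Lemma sapp_inj (u v : star R (T -> U)) : sapp u =1 sapp v -> u = v.
Proof.
move=> uv; rewrite -[u]repK -[v]repK; apply/clsP.
have [[t0 _]|T0] := pselect (exists t : T, True); last first.
  by apply: nearW => e; apply/funext => t; case: T0; exists t.
have hx (e : eps R) : exists t : T,
    rep u e t = rep v e t -> rep u e = rep v e.
  have [uve|/existsNP[t]] := pselect (forall t, rep u e t = rep v e t).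
    by exists t0 => _; apply/funext.
  by exists t.
have [x hxe] := choice hx.
have /clsP h := uv (cls x).
apply: filterS2 h (rep_cls x) => e h xe.
by apply: hxe; rewrite -xe.
Qed.

End Application.

Section Orders.
Variable R : realType.
Implicit Types x y : star R R.

Definition sle x y : Prop := star_rel (fun a b : R => a <= b) x y.
Definition slt x y : Prop := star_rel (fun a b : R => a < b) x y.

Definition rho : star R R := cls (fun e : eps R => val e).
Definition rho_pow (a : R) : star R R := star_map (fun t : R => t `^ a) rho.

Definition sabs : star R R -> star R R := star_map (fun t : R => `|t|).

Definition slow_infinitesimal x : Prop :=
  forall a : R, 0 < a ->
    sle (rho_pow a) (sabs x) /\ sle (sabs x) (cst_star R a).

Definition cnorm : star R R[i] -> star R R := star_map (@ComplexField.Normc.normc R).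

Definition moderate_star (z : star R R[i]) : Prop :=
  exists N : nat, sle (cnorm z) (rho_pow (- N%:R)).

Definition negligible_star (z : star R R[i]) : Prop :=
  forall n : nat, sle (cnorm z) (rho_pow n%:R).

End Orders.

Section Euclidean.
Variables (R : realType) (d : nat).
Implicit Types (x y : 'rV[R]_d) (f : 'rV[R]_d -> R[i]).

Definition dot x y : R := \sum_(i < d) x ord0 i * y ord0 i.

(* The library's norm on 'rV_d is the sup norm. *)
Definition enorm x : R := Num.sqrt (dot x x).

Definition partial (i : 'I_d) f : 'rV[R]_d -> R[i] :=
  fun x => (('D_(delta_mx ord0 i) (fun y => complex.Re (f y)) x)
        +i* ('D_(delta_mx ord0 i) (fun y => complex.Im (f y)) x))%C.

Definition partials (s : seq 'I_d) f : 'rV[R]_d -> R[i] := foldr partial f s.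

Definition Cinfty : set ('rV[R]_d -> R[i]) :=
  [set f | forall s : seq 'I_d,
    [/\ continuous (fun x => complex.Re (partials s f x)),
        continuous (fun x => complex.Im (partials s f x)) &
        forall (i : 'I_d) (x : 'rV[R]_d),
          derivable (fun y => complex.Re (partials s f y)) x (delta_mx ord0 i) /\
          derivable (fun y => complex.Im (partials s f y)) x (delta_mx ord0 i)]].

Definition deriv_mi (alpha : 'I_d -> nat) f : 'rV[R]_d -> R[i] :=
  partials (flatten [seq nseq (alpha i) i | i <- enum 'I_d]) f.

End Euclidean.

(* The integral over R^n as an iterated integral. It is only ever used on
   compactly supported continuous functions, for which, by Fubini, it is the
   integral with respect to the n-dimensional Lebesgue measure. *)
Fixpoint iintegral (R : realType) (n : nat) : ('rV[R]_n -> R) -> R :=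
  match n with
  | 0 => fun g => g 0
  | m.+1 => fun g =>
      \int[@lebesgue_measure R]_t
        iintegral (fun y : 'rV[R]_m => g (row_mx (const_mx t : 'rV[R]_1) y))
  end.

(* The integral of v(x) exp(-i x.xi), without normalizing constant. *)
Definition fourier (R : realType) (d : nat) (v : 'rV[R]_d -> R[i])
    (xi : 'rV[R]_d) : R[i] :=
  let g (x : 'rV[R]_d) : R[i] := v x * (cos (dot x xi) -i* sin (dot x xi))%C in
  (iintegral (fun x => complex.Re (g x)) +i* iintegral (fun x => complex.Im (g x)))%C.

Section Microlocal.
Variables (R : realType) (d : nat).
Local Notation Rd := 'rV[R]_d.
Local Notation sRd := (star R 'rV[R]_d).
Local Notation sFun := (star R ('rV[R]_d -> R[i])).

Definition snorm : sRd -> star R R := star_map (@enorm R d).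
Definition sdist (x y : sRd) : star R R := star_map2 (fun a b : Rd => enorm (a - b)) x y.

Definition fast_scale : set sRd :=
  [set x | exists2 a : R, 0 < a & sle (rho_pow (- a)) (snorm x)].

Definition fast_close (x y : sRd) : Prop :=
  exists2 a : R, 0 < a & sle (sdist x y) (rho_pow a).

Definition slow_scale_nbhd (x0 : sRd) (V : set sRd) : Prop :=
  exists r : star R R, [/\ slt (cst_star R (0 : R)) r, slow_infinitesimal r &
    [set x | sle (sdist x x0) r] `<=` V].

(* The union of the *K over the nonempty compact K included in Omega. *)
Definition compact_points (Omega : set Rd) : set sRd :=
  [set x | exists K : set Rd,
    [/\ compact K, K !=set0, K `<=` Omega & star_of K x]].

Definition sderiv (alpha : 'I_d -> nat) : sFun -> sFun := star_map (deriv_mi alpha).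
Definition sfourier : sFun -> sFun := star_map (@fourier R d).

Definition sCinfty : set sFun := star_of (@Cinfty R d).

Definition Mod (A : set sRd) : set sFun :=
  [set u | sCinfty u /\
    forall (alpha : 'I_d -> nat) (x : sRd), A x ->
      moderate_star (sapp (sderiv alpha u) x)].

Definition ModInfty (A : set sRd) : set sFun :=
  [set u | sCinfty u /\
    forall x : sRd, A x -> exists N : nat, forall alpha : 'I_d -> nat,
      sle (cnorm (sapp (sderiv alpha u) x)) (rho_pow (- N%:R))].

Definition internal_compact (S : set sRd) : Prop :=
  exists2 K : eps R -> set Rd,
    (\forall e \near small R, compact (K e) /\ K e !=set0) & S = star_set K.

Definition compactly_supported_in (A : set sRd) (u : sFun) : Prop :=
  exists S : set sRd, [/\ internal_compact S, S `<=` A &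
    forall x : sRd, (forall a : sRd, S a -> slt (cst_star R (0 : R)) (sdist x a)) ->
      sapp u x = cst_star R (0 : R[i])].

Definition ModC (A : set sRd) : set sFun :=
  [set u | Mod setT u /\ compactly_supported_in A u].

Definition ssphere : set sRd := star_of [set x : Rd | enorm x = 1].

Definition direction : sRd -> sRd := star_map (fun xi : Rd => (enorm xi)^-1 *: xi).

Definition microregular (Omega : set Rd) (u : sFun) (x0 xi0 : sRd) : Prop :=
  exists v : sFun, [/\ ModC (compact_points Omega) v,
    forall x : sRd, fast_close x x0 -> sapp u x = sapp v x &
    forall xi : sRd, fast_scale xi -> fast_close (direction xi) xi0 ->
      negligible_star (sapp (sfourier v) xi)].

End Microlocal.

(* Main.v *)
(* (1) => (2): the direction [xi / |xi|] of a generalized frequency [xi] is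
   itself an admissible [xi0], so every [xi] comes with its own [v]. Put
   [Phi := \prod_i ((1 + cos ((y_i - c_i) / s)) / 2) ^ K] with [c] fast close to
   [x0], [s = rho^(-q)] and [K ~ rho^(-5q)]. It is negligible away from the fast
   neighbourhood of [x0], so that in [Phi v] one localization [v] may be exchanged
   for another; and it is a trigonometric polynomial with frequencies of order
   [rho^(-4q)], so that multiplication by [Phi] only averages the transform of
   [v] over nearby frequencies. Hence the transform of [Phi \partial^alpha v] is
   negligible for [|xi| >= rho^(-5q)]. A Fejér sum over a lattice of frequencies
   recovers [\partial^alpha u(c)] from the remaining bounded band, which gives
   [|\partial^alpha u(c)| <= rho^(-N - C q |alpha|)] with [N] and [C] independent
   of [q] and [alpha]. As [q] is arbitrary, overspill yields a single moderate
   bound on a slow scale ball.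

   (2) => (1): by saturation [N] is uniform on the ball of slow scale radius [r].
   Multiplying by a smooth cutoff of width [r] costs only powers of [1/r], which
   are smaller than every [rho^(-a)], and [|xi_i|^m |\hat v(xi)| <= C sup
   |\partial_i^m v|] is then bounded by a power of [rho] independent of [m]. *)
Require Import Defs.
From HB Require Import structures.
From mathcomp Require Import all_boot all_order all_algebra.
From mathcomp Require Import all_classical all_reals all_analysis.
From mathcomp Require Import complex.
From mathcomp Require Import ring lra zify.
Set Implicit Arguments.
Unset Strict Implicit.
Unset Printing Implicit Defensive.
Import Order.TTheory GRing.Theory Num.Theory.
Import numFieldNormedType.Exports.
Local Open Scope classical_set_scope.
Local Open Scope ring_scope.

(** The exponents fit as follows. At distance [rho^q] from [c] the factor [Phi] is at most [exp (- C
    * K * (rho^q / s)^2) = exp (- C * rho^(-q))], while its frequencies reach only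
    [d * K / s ~ rho^(-4q)]. Moving a frequency of size [rho^(-5q)] by that much turns its direction
    by about [rho^q], which is still fast close, so one [v] serves the whole average. The large
    period [2 * pi * s] keeps the other peaks of [Phi] off the bounded supports. A cutoff of compact
    support would have frequency tails, about which a single direction says nothing. The [v] of
    different directions share no bound. Hence estimates are stated for one fixed [v], proved along
    each net of frequencies by means of the auxiliary [v'] of that net, and made uniform by picking
    a worst frequency for each [eps]. [N] does not depend on [alpha] because the main term uses only
    the sup bound of [v], each derivative costing one factor [|xi|]. Bounds on derivatives of [v]
    enter only into errors that free exponents absorb. Finite lattice sums stand in for Fourier
    inversion: a negligible value then has to beat only polynomially many terms. *)

(** * Integrals over the line of continuous functions with bounded support *)

Section OneDim.
Variable R : realType.
Notation mu := (@lebesgue_measure R).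
Implicit Types (J : R -> R).

Lemma lip1_continuous C J : (forall t h, `|J (t + h) - J t| <= C * `|h|) ->
  continuous J.
Proof.
move=> JC x; apply/cvgrPdist_le => /= e e0.
have C0 : 0 < `|C| + 1 by rewrite ltr_pwDr.
near=> t.
rewrite distrC -[t in J t](subrKC x t).
apply: le_trans (JC _ _) _.
have h : `|t - x| <= e / (`|C| + 1).
  near: t; apply: (@cvgr_distC_le _ _ _ _ _ id x); first exact: cvg_id.
  by rewrite divr_gt0.
apply: (@le_trans _ _ ((`|C|+1) * `|t - x|)).
  by apply: ler_wpM2r => //; rewrite (le_trans (ler_norm _))// lerDl.
by rewrite -ler_pdivlMl// mulrC.
Unshelve. all: by end_near. Qed.

Lemma box_integrable L J : continuous J -> (forall t, L < `|t| -> J t = 0) ->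
  mu.-integrable setT (EFin \o J).
Proof.
move=> cJ J0.
have -> : EFin \o J = (EFin \o J) \_ `[-L, L].
  apply/funext => t; rewrite patchE; case: ifPn => // /negP tL.
  rewrite /= J0// ltNge; apply/negP => h; apply: tL.
  by rewrite inE /= in_itv/= -ler_norml.
apply/integrable_restrict => //; rewrite setTI.
apply: continuous_compact_integrable; first exact: segment_compact.
exact/continuous_subspaceT.
Qed.

Lemma box_Rintegral L J : continuous J -> (forall t, L < `|t| -> J t = 0) ->
  \int[mu]_t J t = \int[mu]_(t in `[-L, L]) J t.
Proof.
move=> cJ J0; rewrite [RHS]Rintegral_mkcond; apply: eq_Rintegral => t _.
rewrite patchE; case: ifPn => // /negP tL.
rewrite /= J0// ltNge; apply/negP => h; apply: tL.
by rewrite inE /= in_itv/= -ler_norml.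
Qed.

Lemma box_Rintegral_bound L J M : 0 <= L -> continuous J ->
  (forall t, L < `|t| -> J t = 0) -> (forall t, `|J t| <= M) ->
  `|\int[mu]_t J t| <= 2 * L * M.
Proof.
move=> L0 cJ J0 JM; rewrite (box_Rintegral cJ J0).
have iJ : mu.-integrable `[-L, L] (EFin \o J).
  apply: continuous_compact_integrable; first exact: segment_compact.
  exact/continuous_subspaceT.
apply: le_trans (le_normr_Rintegral _ iJ) _ => //.
apply: (@le_trans _ _ (\int[mu]_(t in `[-L, L]) M)).
  apply: le_Rintegral => //.
  - exact: integrable_norm.
  - apply: continuous_compact_integrable; first exact: segment_compact.
    by move=> ?; exact: cvg_cst.
rewrite Rintegral_cst//= lebesgue_measure_itv/= lte_fin.
case: ltP => h /=; first by rewrite opprK mulrC; lra.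
have -> : L = 0 by lra.
by rewrite !mulr0 mul0r.
Qed.

Lemma is_derive_shift1 (h x : R) : is_derive x (1:R) (fun t : R => t + h) 1.
Proof. by rewrite -[X in is_derive _ _ _ X]addr0; apply: is_deriveD. Qed.

Lemma box_Rintegral_shift L J h : continuous J ->
  (forall t, L < `|t| -> J t = 0) ->
  \int[mu]_t J (t + h) = \int[mu]_t J t.
Proof.
move=> cJ J0.
(* Both [J] and its translate vanish outside the intervals built from [M]; the term [1] keeps these
   nondegenerate even if [L] and [h] are zero. *)
pose M := `|L| + `|h| + 1.
have cS : continuous (fun t : R => t + h).
  by move=> t; apply: continuousD; [exact: cvg_id|exact: cvg_cst].
have cJh : continuous (fun t => J (t + h)).
  by move=> t; apply: (@continuous_comp _ _ _ (fun t => t + h) J); [exact: cS|exact: cJ].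
have Lh := ler_norm L. have hh := ler_norm h. have hn := ler_norm (-h).
rewrite normrN in hn. have hh0 := normr_ge0 h. have LL0 := normr_ge0 L.
have Jh0 t : M < `|t| -> J (t + h) = 0.
  move=> tM; apply: J0; have := lerB_normD t h; rewrite /M in tM; lra.
have JM t : M + `|h| < `|t| -> J t = 0 by move=> tM; apply: J0; rewrite /M in tM; lra.
rewrite (box_Rintegral cJh Jh0).
have -> : \int[mu]_t J t = \int[mu]_(t in `[-M + h, M + h]) J t.
  rewrite [RHS]Rintegral_mkcond; apply: eq_Rintegral => t _.
  rewrite patchE; case: ifPn => // /negP tL.
  apply: J0; rewrite ltNge; apply/negP; rewrite ler_norml => /andP[h1 h2]; apply: tL.
  by rewrite inE /= in_itv/=; apply/andP; split; rewrite /M; lra.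
rewrite /Rintegral; congr fine.
have dF : derive1 (fun t : R => t + h) = cst 1.
  by apply/funext => t; rewrite derive1E; have [_ ->] := is_derive_shift1 h t.
rewrite (@integration_by_substitution_increasing _ (fun t : R => t + h) J).
- by apply: eq_integral => t _; rewrite dF /= mulr1.
- by rewrite /M; lra.
- by move=> x y _ _; rewrite ltrD2r.
- by rewrite dF => x _; exact: cvg_cst.
- by rewrite dF; exact: is_cvg_cst.
- by rewrite dF; exact: is_cvg_cst.
- split => /=.
  + by move=> x _; have [] := is_derive_shift1 h x.
  + by apply: cvg_at_right_filter; exact: cS.
  + by apply: cvg_at_left_filter; exact: cS.
- exact/continuous_subspaceT.
Qed.

End OneDim.

(** * The iterated integral of compactly supported Lipschitz functions *)

Section Nice.
Variable R : realType.

Definition blip_with n (C : R) (g : 'rV[R]_n -> R) :=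
  (forall x, `|g x| <= C) /\
  (forall x i h, `|g (x + h *: delta_mx ord0 i) - g x| <= C * `|h|).
Definition blip n (g : 'rV[R]_n -> R) := exists C, blip_with C g.
Definition boxed n (T : nmodType) (L : R) (g : 'rV[R]_n -> T) :=
  forall (x : 'rV[R]_n) i, L < `|x ord0 i| -> g x = 0.
(** The class on which the iterated integral is handled without measure theory in several variables.
    A Lipschitz bound along coordinate lines passes to slices and to their integrals, so that each
    stage of the induction on the dimension integrates a continuous function of one variable. *)
Definition nice n (g : 'rV[R]_n -> R) := blip g /\ exists L, boxed L g.

Lemma blip_with_ge0 n C (g : 'rV[R]_n -> R) : blip_with C g -> 0 <= C.
Proof. by case=> /(_ 0) h _; exact: le_trans h. Qed.

Lemma boxedW n (T : nmodType) L L' (g : 'rV[R]_n -> T) : L <= L' -> boxed L g -> boxed L' g.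
Proof. by move=> LL b x i /(le_lt_trans LL); exact: b. Qed.

Lemma nice_with n (g : 'rV[R]_n -> R) : nice g ->
  exists C L, [/\ 0 <= C, 0 <= L, blip_with C g & boxed L g].
Proof.
move=> [[C gC] [L gL]]; exists C, `|L|; split => //.
- exact: (blip_with_ge0 gC).
- exact: boxedW (ler_norm L) gL.
Qed.

Lemma blipD n (f g : 'rV[R]_n -> R) : blip f -> blip g -> blip (fun x => f x + g x).
Proof.
move=> [C [f1 f2]] [D [g1 g2]]; exists (C + D); split => [x|x i h].
  by apply: le_trans (ler_normD _ _) _; apply: lerD.
rewrite opprD addrACA mulrDl.
by apply: le_trans (ler_normD _ _) _; apply: lerD.
Qed.

Lemma blip_cst n (c : R) : blip (fun _ : 'rV[R]_n => c).
Proof. by exists `|c|; split => // x i h; rewrite subrr normr0 mulr_ge0. Qed.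

Lemma blipM n (f g : 'rV[R]_n -> R) : blip f -> blip g -> blip (fun x => f x * g x).
Proof.
move=> [C fC] [D gD].
have C0 := blip_with_ge0 fC; have D0 := blip_with_ge0 gD.
move: fC gD => [f1 f2] [g1 g2]; exists (C * D + C * D); split => [x|x i h].
  apply: (@le_trans _ _ (C * D)); last by rewrite lerDl mulr_ge0.
  by rewrite normrM ler_pM.
set y := x + _; have -> : f y * g y - f x * g x = f y * (g y - g x) + (f y - f x) * g x by ring.
apply: le_trans (ler_normD _ _) _; rewrite [leRHS]mulrDl !normrM; apply: lerD.
  by rewrite -mulrA; apply: ler_pM => //; exact: g2.
by rewrite -mulrA [D * _]mulrC mulrA; apply: ler_pM => //; exact: f2.
Qed.

Lemma blip_shift n (f : 'rV[R]_n -> R) a : blip f -> blip (fun x => f (x + a)).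
Proof. by move=> [C [h1 h2]]; exists C; split => // x i h; rewrite addrAC; exact: h2. Qed.

Lemma niceD n (f g : 'rV[R]_n -> R) : nice f -> nice g -> nice (fun x => f x + g x).
Proof.
move=> [bf [L Lf]] [bg [M Mg]]; split; first exact: blipD.
exists (Num.max L M) => x i; rewrite gt_max => /andP[xL xM].
by rewrite (Lf _ _ xL) (Mg _ _ xM) addr0.
Qed.

Lemma nice_mul n (f g : 'rV[R]_n -> R) : nice f -> blip g -> nice (fun x => f x * g x).
Proof.
move=> [bf [L Lf]] bg; split; first exact: blipM.
by exists L => x i xL; rewrite (Lf _ _ xL) mul0r.
Qed.

Lemma nice_mull n (f g : 'rV[R]_n -> R) : nice f -> blip g -> nice (fun x => g x * f x).
Proof.
move=> nf bg; rewrite (_ : (fun x => _) = (fun x => f x * g x)); first exact: nice_mul.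
by apply/funext => x; rewrite mulrC.
Qed.

Lemma niceZ n (g : 'rV[R]_n -> R) c : nice g -> nice (fun x => c * g x).
Proof. by move=> ng; apply: (nice_mull ng); exact: blip_cst. Qed.

Lemma niceN n (g : 'rV[R]_n -> R) : nice g -> nice (fun x => - g x).
Proof.
move=> /(@niceZ _ _ (-1)); congr nice; apply/funext => x; exact: mulN1r.
Qed.

Lemma niceB n (f g : 'rV[R]_n -> R) : nice f -> nice g -> nice (fun x => f x - g x).
Proof. by move=> nf ng; apply: niceD => //; exact: niceN. Qed.

Lemma nice_shift n (g : 'rV[R]_n -> R) a : nice g -> nice (fun x => g (x + a)).
Proof.
move=> [bg [L Lg]]; split; first exact: blip_shift.
exists (L + \sum_i `|a ord0 i|) => x i xL; apply: (Lg _ i); rewrite mxE.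
have : `|a ord0 i| <= \sum_i `|a ord0 i|.
  by rewrite (bigD1 i)//= lerDl sumr_ge0.
have := lerB_normD (x ord0 i) (a ord0 i); move: xL; lra.
Qed.

(* The coordinates of ['rV_m.+1] are split off exactly as in [iintegral]. *)
Definition rv_cons m (t : R) (y : 'rV[R]_m) : 'rV[R]_m.+1 :=
  row_mx (const_mx t : 'rV[R]_1) y.

Lemma rv_cons0 m t (y : 'rV[R]_m) : rv_cons t y ord0 ord0 = t.
Proof.
rewrite /rv_cons; have -> : ord0 = lshift m (ord0 : 'I_1) :> 'I_(1 + m) by apply/val_inj.
by rewrite (@row_mxEl _ 1 1 m) mxE.
Qed.

Lemma rv_consS m t (y : 'rV[R]_m) i : rv_cons t y ord0 (lift ord0 i) = y ord0 i.
Proof.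
rewrite /rv_cons; have -> : lift ord0 i = rshift 1 i :> 'I_(1 + m) by apply/val_inj.
by rewrite (@row_mxEr _ 1 1 m).
Qed.

Lemma rv_eq m (x y : 'rV[R]_m.+1) : x ord0 ord0 = y ord0 ord0 ->
  (forall i, x ord0 (lift ord0 i) = y ord0 (lift ord0 i)) -> x = y.
Proof.
move=> h0 hS; apply/rowP => i.
by case: (unliftP ord0 i) => [j ->|->]; rewrite ?hS ?h0.
Qed.

Lemma shiftE n (x : 'rV[R]_n) h i j :
  (x + h *: delta_mx ord0 i) ord0 j = x ord0 j + h * (j == i)%:R.
Proof. by rewrite mxE [X in _ + X]mxE [X in _ * X]mxE eqxx. Qed.

Lemma rv_cons_shift0 m t (y : 'rV[R]_m) h :
  rv_cons t y + h *: delta_mx ord0 ord0 = rv_cons (t + h) y.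
Proof.
apply: rv_eq => [|i]; first by rewrite shiftE !rv_cons0 eqxx mulr1.
by rewrite shiftE !rv_consS /= mulr0 addr0.
Qed.

Lemma rv_cons_shiftS m t (y : 'rV[R]_m) h i :
  rv_cons t y + h *: delta_mx ord0 (lift ord0 i) = rv_cons t (y + h *: delta_mx ord0 i).
Proof.
apply: rv_eq => [|j]; first by rewrite shiftE !rv_cons0 /= mulr0 addr0.
by rewrite shiftE !rv_consS shiftE (inj_eq (@lift_inj _ ord0)).
Qed.

Lemma rv_consE m (x : 'rV[R]_m.+1) :
  x = rv_cons (x ord0 ord0) (\row_j x ord0 (lift ord0 j)).
Proof. by apply: rv_eq => [|i]; rewrite ?rv_cons0// rv_consS mxE. Qed.

Definition slice m (g : 'rV[R]_m.+1 -> R) t (y : 'rV[R]_m) := g (rv_cons t y).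

Lemma blip_with_slice m C (g : 'rV[R]_m.+1 -> R) t : blip_with C g -> blip_with C (slice g t).
Proof.
by move=> [h1 h2]; split => [y|y i h]; rewrite /slice ?h1// -rv_cons_shiftS; exact: h2.
Qed.

Lemma boxed_slice m L (g : 'rV[R]_m.+1 -> R) t : boxed L g -> boxed L (slice g t).
Proof. by move=> gL y i yL; apply: (gL _ (lift ord0 i)); rewrite rv_consS. Qed.

Lemma boxed_slice0 m L (g : 'rV[R]_m.+1 -> R) t y : boxed L g -> L < `|t| -> slice g t y = 0.
Proof. by move=> gL tL; apply: (gL _ ord0); rewrite rv_cons0. Qed.

Lemma nice_slice m (g : 'rV[R]_m.+1 -> R) t : nice g -> nice (slice g t).
Proof.
move=> [[C gC] [L gL]]; split; [exists C|exists L]; [exact: blip_with_slice|exact: boxed_slice].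
Qed.

Lemma iintegralS m (g : 'rV[R]_m.+1 -> R) :
  iintegral g = \int[@lebesgue_measure R]_t iintegral (slice g t).
Proof. by []. Qed.

(** The three properties go through the induction together: continuity of the integral of the slices
    in dimension [n.+1] needs both linearity and the size bound in dimension [n]. *)
Definition iint_spec n := [/\
  (forall f g : 'rV[R]_n -> R, nice f -> nice g ->
     iintegral (fun x => f x + g x) = iintegral f + iintegral g),
  (forall (c : R) (g : 'rV[R]_n -> R), nice g -> iintegral (fun x => c * g x) = c * iintegral g) &
  (forall L M (g : 'rV[R]_n -> R), nice g -> 0 <= L -> boxed L g -> (forall x, `|g x| <= M) ->
     `|iintegral g| <= (2 * L) ^+ n * M)].

Section Step.
Variables (m : nat) (H : iint_spec m).

Lemma iint_specB f g : nice f -> nice g ->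
  iintegral (fun x : 'rV[R]_m => f x - g x) = iintegral f - iintegral g.
Proof.
have [HD HZ _] := H => nf ng; rewrite (HD _ (fun x => - g x))//; last exact: niceN.
congr (_ + _); rewrite -mulN1r -HZ//; congr iintegral.
by apply/funext => x; rewrite mulN1r.
Qed.

(** The difference of two slices is again a boxed function, of size at most [C * |h|], to which the
    size bound of dimension [m] applies. *)
Lemma slice_lip C L (g : 'rV[R]_m.+1 -> R) t h : 0 <= L -> blip_with C g -> boxed L g ->
  `|iintegral (slice g (t + h)) - iintegral (slice g t)| <= (2 * L) ^+ m * C * `|h|.
Proof.
move=> L0 gC gL; have ng : nice g by split; [exists C|exists L].
rewrite -iint_specB; try exact: nice_slice.
have [_ _ HM] := H; rewrite -mulrA; apply: HM => //.
- by apply: niceB; exact: nice_slice.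
- by move=> y i yL; rewrite (boxed_slice _ gL yL) (boxed_slice _ gL yL) subrr.
- by move=> y; rewrite /slice -rv_cons_shift0; exact: gC.2.
Qed.

Lemma slice_continuous (g : 'rV[R]_m.+1 -> R) : nice g ->
  continuous (fun t => iintegral (slice g t)).
Proof.
move=> /nice_with[C [L [C0 L0 gC gL]]].
by apply: (@lip1_continuous _ ((2 * L) ^+ m * C)) => t h; exact: slice_lip.
Qed.

Lemma slice_box L (g : 'rV[R]_m.+1 -> R) t : boxed L g -> nice g -> L < `|t| ->
  iintegral (slice g t) = 0.
Proof.
move=> gL ng tL; have [_ HZ _] := H.
have -> : slice g t = (fun x => 0 * slice g t x).
  by apply/funext => y; rewrite mul0r (boxed_slice0 _ gL tL).
by rewrite HZ ?mul0r//; exact: nice_slice.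
Qed.

Lemma slice_integrable (g : 'rV[R]_m.+1 -> R) : nice g ->
  (@lebesgue_measure R).-integrable setT (EFin \o (fun t => iintegral (slice g t))).
Proof.
move=> ng; have [C [L [C0 L0 gC gL]]] := nice_with ng.
by apply: (@box_integrable _ L); [exact: slice_continuous|move=> t; exact: slice_box].
Qed.

Lemma iint_specS : iint_spec m.+1.
Proof.
have [HD HZ HM] := H; split => [f g nf ng|c g ng|L M g ng L0 gL gM].
- rewrite !iintegralS -RintegralD//; try exact: slice_integrable.
  by apply: eq_Rintegral => t _; rewrite -HD//; exact: nice_slice.
- rewrite !iintegralS -RintegralZl//; try exact: slice_integrable.
  by apply: eq_Rintegral => t _; rewrite -HZ//; exact: nice_slice.
- rewrite iintegralS exprS -mulrA; apply: box_Rintegral_bound => //.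
  + exact: slice_continuous.
  + by move=> t; exact: slice_box.
  + move=> t; apply: HM => //; [exact: nice_slice|exact: boxed_slice|].
    by move=> y; exact: gM.
Qed.
End Step.

Lemma iint_specP n : iint_spec n.
Proof.
elim: n => [|m]; last exact: iint_specS.
by split => //= L M g _ _ _ gM; rewrite expr0 mul1r.
Qed.

Lemma iintegralD n (f g : 'rV[R]_n -> R) : nice f -> nice g ->
  iintegral (fun x => f x + g x) = iintegral f + iintegral g.
Proof. by have [+ _ _] := iint_specP n; exact. Qed.

Lemma iintegralZ n c (g : 'rV[R]_n -> R) : nice g ->
  iintegral (fun x => c * g x) = c * iintegral g.
Proof. by have [_ + _] := iint_specP n; exact. Qed.

Lemma iintegralB n (f g : 'rV[R]_n -> R) : nice f -> nice g ->
  iintegral (fun x => f x - g x) = iintegral f - iintegral g.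
Proof. exact: iint_specB (iint_specP n) _ _. Qed.

Lemma iintegral_bound n L M (g : 'rV[R]_n -> R) : nice g -> 0 <= L -> boxed L g ->
  (forall x, `|g x| <= M) -> `|iintegral g| <= (2 * L) ^+ n * M.
Proof. by have [_ _ +] := iint_specP n; exact. Qed.

Lemma iintegral_shift n (g : 'rV[R]_n -> R) i h : nice g ->
  iintegral (fun x => g (x + h *: delta_mx ord0 i)) = iintegral g.
Proof.
elim: n g i => [g []//|m IH g i ng].
rewrite !iintegralS; case: (unliftP ord0 i) => [j ->|->].
  apply: eq_Rintegral => t _; rewrite -(IH (slice g t) j)//; last exact: nice_slice.
  by congr iintegral; apply/funext => y; rewrite /slice rv_cons_shiftS.
have [C [L [C0 L0 gC gL]]] := nice_with ng.
rewrite -[RHS](box_Rintegral_shift (L := L) h).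
- apply: eq_Rintegral => t _; congr iintegral.
  by apply/funext => y; rewrite /slice rv_cons_shift0.
- exact: (slice_continuous (iint_specP m)).
- by move=> t; apply: (slice_box (iint_specP m)).
Qed.

End Nice.

(** * The Fourier transform *)

Section LineDerivative.
Variables (R : realType) (n : nat).
Implicit Types (g : 'rV[R]_n -> R) (x : 'rV[R]_n).

Lemma is_derive_line g x (v : 'rV[R]_n) (t : R) : derivable g (x + t *: v) v ->
  is_derive t (1 : R) (fun s : R => g (x + s *: v)) ('D_v g (x + t *: v)).
Proof.
move=> dg.
have E : (fun h : R => h^-1 *: (g (x + (h *: (1 : R) + t) *: v) - g (x + t *: v)))
   = (fun h : R => h^-1 *: (g (h *: v + (x + t *: v)) - g (x + t *: v))).
  apply/funext => h; congr (_ *: (g _ - _)).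
  by rewrite scalerDl [h *: 1]mulr1 addrCA.
by split; [rewrite /derivable /=; have := dg; rewrite /derivable /= -E|rewrite /derive /= -E].
Qed.

Lemma MVT_line g x (v : 'rV[R]_n) (h : R) : (forall y, derivable g y v) ->
  exists2 t : R, `|t| <= `|h| & g (x + h *: v) - g x = h * 'D_v g (x + t *: v).
Proof.
move=> dg.
pose f s := g (x + s *: v); pose df s := 'D_v g (x + s *: v).
have fdf s : is_derive s (1 : R) f (df s) by exact: is_derive_line.
have cf : continuous f.
  by move=> s; apply/differentiable_continuous/derivable1_diffP; have [] := fdf s.
have f0 : f 0 = g x by rewrite /f scale0r addr0.
have [h0|h0|->] := ltgtP h 0.
- have [c /andP[]] := MVT h0 (fun s _ => fdf s) (continuous_subspaceT cf).
  rewrite !bnd_simp => c1 c2 fE; exists c; first by rewrite !ltr0_norm// lerN2 ltW.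
  by rewrite -f0 -/(f h) -[LHS]opprB fE sub0r mulrN opprK mulrC.
- have [c /andP[]] := MVT h0 (fun s _ => fdf s) (continuous_subspaceT cf).
  rewrite !bnd_simp => c1 c2 fE; exists c; first by rewrite !gtr0_norm// ltW.
  by rewrite -f0 -/(f h) fE subr0 mulrC.
- by exists 0 => //; rewrite scale0r addr0 subrr mul0r.
Qed.
End LineDerivative.

Section CosSin.
Variable R : realType.
Implicit Types a b t : R.

Lemma MVT_R (f df : R -> R) a b : (forall x, is_derive x (1 : R) f (df x)) ->
  exists2 c, `|c - a| <= `|b - a| & f b - f a = df c * (b - a).
Proof.
move=> fdf.
have cf : continuous f.
  by move=> s; apply/differentiable_continuous/derivable1_diffP; have [] := fdf s.
have [h0|h0|->] := ltgtP a b.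
- have [c /andP[]] := MVT h0 (fun s _ => fdf s) (continuous_subspaceT cf).
  rewrite !bnd_simp => c1 c2 ->; exists c => //; rewrite !gtr0_norm ?subr_gt0//.
  by rewrite lerD2r ltW.
- have [c /andP[]] := MVT h0 (fun s _ => fdf s) (continuous_subspaceT cf).
  rewrite !bnd_simp => c1 c2 fE; exists c.
    by rewrite !ltr0_norm ?subr_lt0// lerN2 lerD2r ltW.
  by rewrite -[LHS]opprB fE -mulrN opprB.
- by exists b; rewrite ?subrr ?mulr0.
Qed.

Lemma cos_lip a b : `|cos a - cos b| <= `|a - b|.
Proof.
have [c _ ->] := MVT_R b a (@is_derive_cos R).
by rewrite normrM normrN ler_piMl// sin_max.
Qed.

Lemma sin_lip a b : `|sin a - sin b| <= `|a - b|.
Proof.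
have [c _ ->] := MVT_R b a (@is_derive_sin R).
by rewrite normrM ler_piMl// cos_max.
Qed.

Lemma cos_taylor1 t : `|cos t - 1| <= t ^+ 2.
Proof.
have [c] := MVT_R 0 t (@is_derive_cos R).
rewrite !subr0 cos0 => ct ->; rewrite normrM normrN.
have := sin_lip c 0; rewrite sin0 !subr0 => h.
rewrite -(@real_normK _ t) ?num_real// expr2.
by rewrite ler_pM// (le_trans h).
Qed.

Lemma sin_taylor1 t : `|sin t - t| <= t ^+ 2.
Proof.
have [c] := MVT_R 0 t (@is_derive_sin R).
rewrite !subr0 sin0 subr0 => ct ->.
have -> : cos c * t - t = (cos c - cos 0) * t by rewrite cos0; ring.
have := cos_lip c 0; rewrite subr0 => h.
rewrite -(@real_normK _ t) ?num_real// expr2 !normrM.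
by rewrite ler_pM// (le_trans h).
Qed.

End CosSin.

Section Complex.
Variable R : realType.
Local Notation C := R[i].
Local Notation nc := (@ComplexField.Normc.normc R).
Import ComplexField.Normc.

Lemma ReD (x y : C) : complex.Re (x + y) = complex.Re x + complex.Re y.
Proof. by case: x y => [a b] []. Qed.
Lemma ImD (x y : C) : complex.Im (x + y) = complex.Im x + complex.Im y.
Proof. by case: x y => [a b] []. Qed.
Lemma ReM (x y : C) : complex.Re (x * y) = complex.Re x * complex.Re y - complex.Im x * complex.Im y.
Proof. by case: x y => [a b] []. Qed.
Lemma ImM (x y : C) : complex.Im (x * y) = complex.Re x * complex.Im y + complex.Im x * complex.Re y.
Proof. by case: x y => [a b] []. Qed.
Lemma ReN (x : C) : complex.Re (- x) = - complex.Re x. Proof. by case: x. Qed.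
Lemma ImN (x : C) : complex.Im (- x) = - complex.Im x. Proof. by case: x. Qed.

Lemma complex_eq (x y : C) : complex.Re x = complex.Re y -> complex.Im x = complex.Im y -> x = y.
Proof. by case: x y => [a b] [c d] /= -> ->. Qed.

Lemma nc_ge0 (x : C) : 0 <= nc x. Proof. by case: x => a b; exact: sqrtr_ge0. Qed.

Lemma Re_le_nc (x : C) : `|complex.Re x| <= nc x.
Proof.
case: x => a b /=; rewrite -sqrtr_sqr ler_wsqrtr// lerDl sqr_ge0 //.
Qed.

Lemma Im_le_nc (x : C) : `|complex.Im x| <= nc x.
Proof. by case: x => a b /=; rewrite -sqrtr_sqr ler_wsqrtr// lerDr sqr_ge0. Qed.

Lemma nc_real (a : R) : nc a%:C%C = `|a|.
Proof. by rewrite /= expr0n/= addr0 sqrtr_sqr. Qed.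

Lemma nc_i : nc 'i%C = 1.
Proof. by rewrite /= expr0n/= add0r expr1n sqrtr1. Qed.

Lemma nc0 : nc 0 = 0.
Proof. by rewrite (nc_real 0) normr0. Qed.

Lemma nc_le_ReIm (x : C) : nc x <= `|complex.Re x| + `|complex.Im x|.
Proof.
have -> : x = (complex.Re x)%:C%C + 'i%C * (complex.Im x)%:C%C by exact: complexE.
apply: le_trans (le_normcD _ _) _; rewrite normcM nc_i mul1r !nc_real.
case: x => a b /=.
by rewrite !(mul0r, mulr0, add0r, addr0, mul1r, subr0, oppr0).
Qed.

(** This takes the place of a limit of difference quotients: estimates for all small steps force an
    identity. *)
Lemma nc_ge_eq0 (x : C) D : (forall h : R, 0 < h -> h <= 1 -> nc x <= D * h) -> x = 0.
Proof.
move=> H; apply: eq0_normc; apply/eqP; rewrite eq_le nc_ge0 andbT.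
apply/ler_addgt0Pr => e e0; rewrite add0r.
have D1 : 0 < `|D| + 1 by rewrite ltr_pwDr.
have m0 : 0 < Num.min 1 (e / (`|D| + 1)) by rewrite lt_min ltr01 divr_gt0.
apply: le_trans (H _ m0 _) _; first by rewrite ge_min lexx.
apply: (@le_trans _ _ ((`|D| + 1) * Num.min 1 (e / (`|D| + 1)))).
  by apply: ler_wpM2r; [exact: ltW|rewrite (le_trans (ler_norm _))// lerDl].
by rewrite -ler_pdivlMl// mulrC ge_min lexx orbT.
Qed.

Definition expi (t : R) : C := (cos t +i* sin t)%C.

Lemma expiD a b : expi (a + b) = expi a * expi b.
Proof. by apply: complex_eq; rewrite ?ReM ?ImM /= ?cosD// sinD addrC. Qed.

Lemma expi0 : expi 0 = 1. Proof. by rewrite /expi cos0 sin0. Qed.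

Lemma nc_expi t : nc (expi t) = 1.
Proof. by rewrite /= cos2Dsin2 sqrtr1. Qed.

Lemma expi_taylor1 t : nc (expi t - 1 - 'i%C * t%:C%C) <= 2 * t ^+ 2.
Proof.
apply: le_trans (nc_le_ReIm _) _; rewrite mulr2n mulrDl mul1r.
apply: lerD; rewrite !(ReD, ImD, ReN, ImN, ReM, ImM) /=.
- have -> : cos t - 1 - (0 * t - 1 * 0) = cos t - 1 by ring.
  exact: cos_taylor1.
- have -> : sin t - 0 - (0 * 0 + 1 * t) = sin t - t by ring.
  exact: sin_taylor1.
Qed.

Variable n : nat.
Implicit Types (f g h : 'rV[R]_n -> C) (x xi : 'rV[R]_n).

Definition cblip h := blip (fun x => complex.Re (h x)) /\ blip (fun x => complex.Im (h x)).
Definition cnice f := nice (fun x => complex.Re (f x)) /\ nice (fun x => complex.Im (f x)).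
Definition cint f : C := (iintegral (fun x => complex.Re (f x)) +i* iintegral (fun x => complex.Im (f x)))%C.

Lemma cnice_mul f h : cnice f -> cblip h -> cnice (fun x => f x * h x).
Proof.
move=> [f1 f2] [h1 h2]; split.
  have -> : (fun x => complex.Re (f x * h x)) = (fun x => complex.Re (f x) * complex.Re (h x) - complex.Im (f x) * complex.Im (h x)).
    by apply/funext => x; rewrite ReM.
  by apply: niceB; apply: nice_mul.
have -> : (fun x => complex.Im (f x * h x)) = (fun x => complex.Re (f x) * complex.Im (h x) + complex.Im (f x) * complex.Re (h x)).
  by apply/funext => x; rewrite ImM.
by apply: niceD; apply: nice_mul.
Qed.

Lemma cblip_cst c : cblip (fun=> c).
Proof. by split; apply: blip_cst. Qed.

Lemma cblip_real (k : 'rV[R]_n -> R) : blip k -> cblip (fun x => (k x)%:C%C).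
Proof. by move=> bk; split => //=; exact: blip_cst. Qed.

Lemma cniceZ c f : cnice f -> cnice (fun x => c * f x).
Proof.
move=> nf; have -> : (fun x => c * f x) = (fun x => f x * c) by apply/funext => x; rewrite mulrC.
exact/cnice_mul/cblip_cst.
Qed.

Lemma cniceD f g : cnice f -> cnice g -> cnice (fun x => f x + g x).
Proof.
move=> [f1 f2] [g1 g2]; split.
  by have := niceD f1 g1; congr nice; apply/funext => x; rewrite ReD.
by have := niceD f2 g2; congr nice; apply/funext => x; rewrite ImD.
Qed.

Lemma cniceB f g : cnice f -> cnice g -> cnice (fun x => f x - g x).
Proof.
move=> nf /(@cniceZ (-1)) ng; have := cniceD nf ng; congr cnice.
by apply/funext => x; rewrite mulN1r.
Qed.

Lemma cnice_shift f a : cnice f -> cnice (fun x => f (x + a)).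
Proof. by move=> [f1 f2]; split; [apply: (nice_shift a f1)|apply: (nice_shift a f2)]. Qed.

Lemma cintD f g : cnice f -> cnice g -> cint (fun x => f x + g x) = cint f + cint g.
Proof.
move=> [f1 f2] [g1 g2]; apply: complex_eq; rewrite ?ReD ?ImD /= -iintegralD//;
  by congr iintegral; apply/funext => x; rewrite ?ReD ?ImD.
Qed.

Lemma cintZ c f : cnice f -> cint (fun x => c * f x) = c * cint f.
Proof.
move=> [f1 f2]; apply: complex_eq; rewrite ?ReM ?ImM /= -!iintegralZ//.
  rewrite -iintegralB; try exact: niceZ.
  by congr iintegral; apply/funext => x; rewrite ReM.
rewrite -iintegralD; try exact: niceZ.
by congr iintegral; apply/funext => x; rewrite ImM.
Qed.

Lemma cint_bound L M f : cnice f -> 0 <= L -> boxed L f -> (forall x, nc (f x) <= M) ->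
  nc (cint f) <= 2 * ((2 * L) ^+ n * M).
Proof.
move=> [f1 f2] L0 bf fM; apply: le_trans (nc_le_ReIm _) _.
rewrite mulr2n mulrDl mul1r /=; apply: lerD; apply: iintegral_bound => //.
- by move=> x i /bf ->.
- by move=> x; apply: le_trans (Re_le_nc _) _.
- by move=> x i /bf ->.
- by move=> x; apply: le_trans (Im_le_nc _) _.
Qed.

Lemma cint_shift f i t : cnice f -> cint (fun x => f (x + t *: delta_mx ord0 i)) = cint f.
Proof.
move=> [f1 f2]; apply: complex_eq => /=.
  exact: (iintegral_shift i t f1).
exact: (iintegral_shift i t f2).
Qed.

Lemma fourierE f xi : fourier f xi = cint (fun x => f x * expi (- dot x xi)).
Proof.
rewrite /fourier /cint /expi; congr Complex; congr iintegral; apply/funext => x;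
  by rewrite cosN sinN.
Qed.

Lemma dot_shift x xi i t : dot (x + t *: delta_mx ord0 i) xi = dot x xi + t * xi ord0 i.
Proof.
rewrite /dot (eq_bigr (fun j => x ord0 j * xi ord0 j + t * (j == i)%:R * xi ord0 j)).
  rewrite big_split /=; congr (_ + _); rewrite (bigD1 i)//= eqxx mulr1 big1 ?addr0//.
  by move=> j /negbTE ->; rewrite mulr0 mul0r.
by move=> j _; rewrite shiftE mulrDl.
Qed.

Lemma cblip_expi (p : 'rV[R]_n -> R) (a : 'I_n -> R) :
  (forall x i t, p (x + t *: delta_mx ord0 i) = p x + t * a i) -> cblip (fun x => expi (p x)).
Proof.
move=> pa; have aS i : `|a i| <= \sum_j `|a j| by rewrite (bigD1 i)//= lerDl sumr_ge0.
have S0 : 0 <= \sum_j `|a j| by apply: sumr_ge0.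
split; exists (1 + \sum_i `|a i|); split => [x|x i t] /=.
- by apply: le_trans (cos_max _) _; rewrite lerDl.
- rewrite pa; apply: le_trans (cos_lip _ _) _; rewrite addrC addKr normrM mulrC.
  by rewrite ler_wpM2r//; apply: le_trans (aS i) _; rewrite lerDr.
- by apply: le_trans (sin_max _) _; rewrite lerDl.
- rewrite pa; apply: le_trans (sin_lip _ _) _; rewrite addrC addKr normrM mulrC.
  by rewrite ler_wpM2r//; apply: le_trans (aS i) _; rewrite lerDr.
Qed.

Lemma cblip_character xi : cblip (fun x => expi (- dot x xi)).
Proof.
apply: (@cblip_expi _ (fun i => - xi ord0 i)) => x i t.
by rewrite dot_shift opprD mulrN.
Qed.

Lemma cnice_character f xi : cnice f -> cnice (fun x => f x * expi (- dot x xi)).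
Proof. by move=> nf; apply: cnice_mul => //; exact: cblip_character. Qed.

Lemma fourierD f g xi : cnice f -> cnice g ->
  fourier (fun x => f x + g x) xi = fourier f xi + fourier g xi.
Proof.
move=> nf ng; rewrite !fourierE -cintD; try exact: cnice_character.
by congr cint; apply/funext => x; rewrite mulrDl.
Qed.

Lemma fourierZ c f xi : cnice f -> fourier (fun x => c * f x) xi = c * fourier f xi.
Proof.
move=> nf; rewrite !fourierE -cintZ; last exact: cnice_character.
by congr cint; apply/funext => x; rewrite mulrA.
Qed.

Lemma fourierB f g xi : cnice f -> cnice g ->
  fourier (fun x => f x - g x) xi = fourier f xi - fourier g xi.
Proof.
move=> nf ng; rewrite -[X in _ + X]mulN1r -fourierZ// -fourierD//; last exact: cniceZ.
by congr fourier; apply/funext => x; rewrite mulN1r.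
Qed.

Lemma fourier_bound L M f xi : cnice f -> 0 <= L -> boxed L f -> (forall x, nc (f x) <= M) ->
  nc (fourier f xi) <= 2 * ((2 * L) ^+ n * M).
Proof.
move=> nf L0 bf fM; rewrite fourierE; apply: cint_bound => //.
- exact: cnice_character.
- by move=> x i /bf ->; rewrite mul0r.
- by move=> x; rewrite normcM nc_expi mulr1.
Qed.

Lemma fourier_shift f i t xi : cnice f ->
  fourier (fun x => f (x + t *: delta_mx ord0 i)) xi = expi (t * xi ord0 i) * fourier f xi.
Proof.
move=> nf; have ng := cnice_character xi nf.
rewrite !fourierE -(cint_shift i t ng) -cintZ; last exact: (cnice_shift _ ng).
congr cint; apply/funext => x; rewrite mulrCA; congr (_ * _).
by rewrite -expiD dot_shift; congr expi; ring.
Qed.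

Lemma fourier_modulation f b eta xi : cnice f ->
  fourier (fun x => expi (dot x eta + b) * f x) xi = expi b * fourier f (xi - eta).
Proof.
move=> nf; rewrite !fourierE -cintZ; last exact: cnice_character.
congr cint; apply/funext => x; rewrite mulrAC mulrC -!expiD mulrCA; congr (_ * _).
rewrite -expiD; congr expi.
have -> : dot x (xi - eta) = dot x xi - dot x eta.
  by rewrite /dot -sumrB; apply: eq_bigr => i _; rewrite !mxE mulrBr.
ring.
Qed.

(* The derivative is the uniform limit of the difference quotients, whose
   transforms are known by translation invariance; this replaces an integration
   by parts, which the iterated integral makes awkward. *)
Lemma fourier_deriv f df i D xi : cnice f -> cnice df ->
  (exists L, boxed L f /\ boxed L df) ->
  (forall x t, nc (f (x + t *: delta_mx ord0 i) - f x - t%:C%C * df x) <= D * t ^+ 2) ->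
  fourier df xi = 'i%C * (xi ord0 i)%:C%C * fourier f xi.
Proof.
move=> nf ndf [L [bf bdf]] HD.
have D0 : 0 <= D by have := HD 0 1; rewrite expr1n mulr1; apply: le_trans; exact: nc_ge0.
apply/eqP; rewrite -subr_eq0; apply/eqP.
set z := xi ord0 i; set F := fourier f xi; set G := fourier df xi.
(* The first summand bounds the transform of the Taylor remainder, whose support grows by at most
   [1] because [t <= 1]; the second comes from the Taylor remainder of [expi (t * z)]. Both are of
   order [t ^+ 2] before the division by [t]. *)
apply: (@nc_ge_eq0 _ (2 * ((2 * (`|L| + 1)) ^+ n * D) + 2 * z ^+ 2 * nc F)) => t t0 t1.
have H1 : nc (expi (t * z) * F - F - t%:C%C * G) <= 2 * ((2 * (`|L| + 1)) ^+ n * (D * t ^+ 2)).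
  have := (@fourier_bound (`|L| + 1) (D * t ^+ 2)
            (fun x => f (x + t *: delta_mx ord0 i) - f x - t%:C%C * df x) xi).
  rewrite fourierB ?fourierB ?fourierZ ?fourier_shift//; first apply.
  - apply: cniceB; last exact: cniceZ.
    by apply: cniceB => //; exact: cnice_shift.
  - by rewrite addr_ge0.
  - move=> x j xL; have LL := ler_norm L.
    have xL' : L < `|x ord0 j| by lra.
    rewrite (bf _ _ xL') (bdf _ _ xL') mulr0 !subr0.
    apply: (bf _ j); rewrite shiftE.
    have : `|t * (j == i)%:R| <= 1.
      by case: (j == i); rewrite ?mulr0 ?normr0// mulr1 gtr0_norm.
    have := lerB_normD (x ord0 j) (t * (j == i)%:R); lra.
  - by move=> x; exact: HD.
  - exact: cnice_shift.
  - by apply: cniceB => //; exact: cnice_shift.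
  - exact: cniceZ.
have H2 := expi_taylor1 (t * z).
have tE : t * nc (G - 'i%C * z%:C%C * F) = nc (t%:C%C * (G - 'i%C * z%:C%C * F)).
  by rewrite normcM nc_real gtr0_norm.
rewrite -(ler_pM2l t0) tE.
have -> : t%:C%C * (G - 'i%C * z%:C%C * F) =
   (expi (t * z) - 1 - 'i%C * (t * z)%:C%C) * F - (expi (t * z) * F - F - t%:C%C * G).
  by rewrite rmorphM /=; ring.
apply: le_trans (le_normcD _ _) _; rewrite normcN normcM.
have : nc (expi (t * z) - 1 - 'i%C * (t * z)%:C%C) * nc F <= 2 * (t * z) ^+ 2 * nc F.
  by rewrite ler_wpM2r// nc_ge0.
move=> H3; apply: le_trans (lerD H3 H1) _.
by rewrite le_eqVlt; apply/orP; left; apply/eqP; ring.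
Qed.

End Complex.

(** * Partial derivatives *)

Section Schwarz.
Variables (R : realType) (n : nat).
Implicit Types (g : 'rV[R]_n -> R) (x : 'rV[R]_n).
Local Notation e i := (delta_mx (ord0 : 'I_1) i : 'rV[R]_n).

(** The mean value theorem is used twice: along [e i] for the increment of [g] in direction [e j],
    then along [e j] for the derivative so obtained. *)
Lemma second_difference g x i j (h : R) :
  (forall y, derivable g y (e i)) ->
  (forall y, derivable ('D_(e i) g) y (e j)) ->
  exists s t, [/\ `|s| <= `|h|, `|t| <= `|h| &
   g (x + h *: e j + h *: e i) - g (x + h *: e i) - (g (x + h *: e j) - g x)
   = h * h * 'D_(e j) ('D_(e i) g) (x + s *: e i + t *: e j)].
Proof.
move=> dg ddg.
pose f s := g (x + h *: e j + s *: e i) - g (x + s *: e i).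
pose df s := 'D_(e i) g (x + h *: e j + s *: e i) - 'D_(e i) g (x + s *: e i).
have fdf s : is_derive s (1 : R) f (df s).
  by apply: is_deriveB; apply: is_derive_line; exact: dg.
have [s] := MVT_R 0 h fdf; rewrite !subr0 => sh fE.
have [t th gE] := MVT_line (x + s *: e i) h ddg.
exists s, t; split => //.
have -> : g (x + h *: e j) - g x = f 0 by rewrite /f !scale0r !addr0.
rewrite -/(f h) fE /df mulrC [x + h *: _ + _]addrAC gE mulrA //.
Qed.

Lemma ball_shift2 x s t k l (h d : R) : 0 < h -> `|s| <= h -> `|t| <= h -> 3 * h <= d ->
  ball x d (x + s *: e k + t *: e l).
Proof.
move=> h0 sh th hd; split; first by move: h0 hd; lra.
move=> a b; rewrite (ord1 a) /ball /= !shiftE.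
have -> : x ord0 b - (x ord0 b + s * (b == k)%:R + t * (b == l)%:R) =
   - (s * (b == k)%:R + t * (b == l)%:R) by ring.
rewrite normrN; apply: le_lt_trans (ler_normD _ _) _.
have H (r : R) (q : bool) : `|r * q%:R| <= `|r|.
  by case: q; rewrite ?mulr1// mulr0 normr0.
have := H s (b == k); have := H t (b == l).
move: h0 sh th hd; lra.
Qed.

Lemma continuous_eq_near (p q : 'rV[R]_n -> R) x i j : continuous p -> continuous q ->
  (forall h : R, 0 < h -> exists s1 t1 s2 t2,
     [/\ `|s1| <= h, `|t1| <= h, `|s2| <= h, `|t2| <= h &
     p (x + s1 *: e i + t1 *: e j) = q (x + s2 *: e j + t2 *: e i)]) -> p x = q x.
Proof.
move=> cp cq H; apply/eqP; rewrite -subr_eq0 -normr_le0; apply/ler_addgt0Pr => eps eps0.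
rewrite add0r; have e2 : 0 < eps / 2 by rewrite divr_gt0.
have /cvgrPdist_le/(_ _ e2)/nbhs_ballP[d1 /= d10 B1] := cp x.
have /cvgrPdist_le/(_ _ e2)/nbhs_ballP[d2 /= d20 B2] := cq x.
pose h := Num.min d1 d2 / 3.
have h0 : 0 < h by rewrite divr_gt0// lt_min d10.
have hd1 : 3 * h <= d1 by rewrite /h mulrC divfK// ge_min lexx.
have hd2 : 3 * h <= d2 by rewrite /h mulrC divfK// ge_min lexx orbT.
have [s1 [t1 [s2 [t2 [s1h t1h s2h t2h E]]]]] := H h h0.
have := B1 _ (ball_shift2 x i j h0 s1h t1h hd1); rewrite /= => H1.
have := B2 _ (ball_shift2 x j i h0 s2h t2h hd2); rewrite /= -E => H2.
set c := p (x + _ + _) in H1 H2; have -> : p x - q x = (p x - c) - (q x - c) by rewrite opprB addrA subrK.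
by apply: le_trans (ler_normB _ _) _; rewrite [leRHS]splitr; apply: lerD.
Qed.

(** The second difference is symmetric in [i] and [j]. Divided by [h * h], it is a value of each of
    the two mixed derivatives at points within order [h] of [x], and continuity carries the equality
    to [x]. *)
Lemma schwarz g i j :
  (forall y, derivable g y (e i)) -> (forall y, derivable g y (e j)) ->
  (forall y, derivable ('D_(e i) g) y (e j)) -> (forall y, derivable ('D_(e j) g) y (e i)) ->
  continuous ('D_(e j) ('D_(e i) g)) -> continuous ('D_(e i) ('D_(e j) g)) ->
  'D_(e j) ('D_(e i) g) = 'D_(e i) ('D_(e j) g).
Proof.
move=> di dj dij dji cij cji; apply/funext => x.
apply: (continuous_eq_near (i := i) (j := j) cij cji) => h h0.
have [s1 [t1 [s1h t1h E1]]] := second_difference x h di dij.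
have [s2 [t2 [s2h t2h E2]]] := second_difference x h dj dji.
rewrite (gtr0_norm h0) in s1h t1h s2h t2h.
exists s1, t1, s2, t2; split; [exact: s1h|exact: t1h|exact: s2h|exact: t2h|].
move: E1 E2; rewrite [x + h *: e j + h *: e i]addrAC.
set p := 'D_(e j) _ _; set q := 'D_(e i) _ _.
generalize p, q, (g (x + h *: e i + h *: e j)), (g (x + h *: e i)), (g (x + h *: e j)), (g x).
move=> P Q a b c d E1 E2; have hh : h * h != 0 by rewrite mulf_neq0// gt_eqF.
by apply: (mulfI hh); rewrite -E1 -E2; ring.
Qed.
End Schwarz.

Section Smooth.
Variables (R : realType) (n : nat).
Local Notation C := R[i].
Local Notation nc := (@ComplexField.Normc.normc R).
Local Notation e i := (delta_mx (ord0 : 'I_1) i : 'rV[R]_n).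
Implicit Types (f g : 'rV[R]_n -> C) (x xi : 'rV[R]_n) (s t : seq 'I_n).

Lemma partials_cat s t f : partials (s ++ t) f = partials s (partials t f).
Proof. by rewrite /partials foldr_cat. Qed.

Lemma Cinfty_partials s f : Cinfty f -> Cinfty (partials s f).
Proof. by move=> cf t; rewrite -partials_cat; exact: cf. Qed.

Lemma partialC i j f : Cinfty f -> partial i (partial j f) = partial j (partial i f).
Proof.
move=> cf.
have [_ _ d0] := cf [::]; have [_ _ di] := cf [:: i]; have [_ _ dj] := cf [:: j].
have [cijr ciji _] := cf [:: i; j]; have [cjir cjii _] := cf [:: j; i].
have HR := @schwarz R n (fun x => complex.Re (f x)) j i (fun y => (d0 j y).1)
  (fun y => (d0 i y).1) (fun y => (dj i y).1) (fun y => (di j y).1) cijr cjir.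
have HI := @schwarz R n (fun x => complex.Im (f x)) j i (fun y => (d0 j y).2)
  (fun y => (d0 i y).2) (fun y => (dj i y).2) (fun y => (di j y).2) ciji cjii.
by apply/funext => x; apply: complex_eq;
  [exact: (congr1 (fun k => k x) HR)|exact: (congr1 (fun k => k x) HI)].
Qed.

Lemma partials_move i s f : Cinfty f -> partials s (partial i f) = partial i (partials s f).
Proof.
move=> cf; elim: s => [//|j s IH].
rewrite -[LHS]/(partial j (partials s (partial i f))) IH.
exact: partialC (Cinfty_partials s cf).
Qed.

Lemma partials_perm s t f : Cinfty f -> perm_eq s t -> partials s f = partials t f.
Proof.
move=> cf; elim: s t => [t|i s IH t st].
  by rewrite perm_sym => /perm_nilP ->.
have : i \in t by rewrite -(perm_mem st) mem_head.
move=> /splitPr E; case: E st => t1 t2 st.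
have {}st : perm_eq s (t1 ++ t2).
  by rewrite -(perm_cons i) (perm_trans st)// -cat1s perm_catCA.
rewrite -[LHS]/(partial i (partials s f)) (IH _ st) !partials_cat.
rewrite -[partials (i :: t2) f]/(partial i (partials t2 f)).
by rewrite (partials_move i t1 (Cinfty_partials t2 cf)).
Qed.

Lemma count_enum_nseq (al : 'I_n -> nat) i :
  count_mem i (flatten [seq nseq (al j) j | j <- enum 'I_n]) = al i.
Proof.
rewrite count_flatten -map_comp sumnE big_map.
rewrite (eq_bigr (fun j => if j == i then al i else 0%N)) => [|j _ /=]; last first.
  by rewrite count_nseq /=; case: eqP => [->|_]; rewrite ?mul1n ?mul0n.
by rewrite big_enum /= -big_mkcond big_pred1_eq.
Qed.

(** Moderateness is phrased with multi-indices, whereas the computations differentiate along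
    sequences; this is the bridge between the two. *)
Lemma partialsE s f : Cinfty f -> partials s f = deriv_mi (fun i => count_mem i s) f.
Proof.
move=> cf; apply: partials_perm => //.
by apply/allP => i _ /=; rewrite (count_enum_nseq (fun j => count_mem j s)).
Qed.

Lemma eq_near_lim (T : Type) (U : topologicalType) (F : set_system T) (FF : Filter F) (f g : T -> U) :
  (\forall x \near F, f x = g x) -> f @ F = g @ F.
Proof.
move=> fg; apply/funext => A; apply/propext; split => H.
  by apply: filterS2 fg H => x /= <-.
by apply: filterS2 fg H => x /= ->.
Qed.

(** Openness along coordinate lines is exactly what the locality of a partial derivative asks for,
    and it is quick to check for the sets defined by coordinates or by [n1]. *)
Definition coord_open (U : set 'rV[R]_n) :=
  forall x, U x -> forall i, \forall h \near (0 : R), U (x + h *: e i).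

Lemma partial_local (U : set 'rV[R]_n) i f g : coord_open U ->
  (forall x, U x -> f x = g x) -> forall x, U x -> partial i f x = partial i g x.
Proof.
move=> oU fg x Ux; apply: complex_eq; rewrite /= /derive; congr (lim _);
  apply: eq_near_lim; apply: (@nbhs_dnbhs R 0); have := oU x Ux i;
  by apply: filterS => h Uh /=; rewrite (fg _ Ux) [h *: _ + x]addrC (fg _ Uh).
Qed.

Lemma partials_local (U : set 'rV[R]_n) s f g : coord_open U ->
  (forall x, U x -> f x = g x) -> forall x, U x -> partials s f x = partials s g x.
Proof. by move=> oU fg; elim: s => //= i s IH; exact: partial_local. Qed.

Lemma near0_norm (r : R) : 0 < r -> \forall h \near (0 : R), `|h| < r.
Proof.
move=> r0; apply/nbhs_ballP; exists r => //= h.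
by rewrite /ball /= sub0r normrN.
Qed.

Lemma coord_open_out L i : coord_open [set x : 'rV[R]_n | L < `|x ord0 i|].
Proof.
move=> x /= xL j.
have h0 : 0 < `|x ord0 i| - L by rewrite subr_gt0.
apply: filterS (near0_norm h0) => h hh; rewrite /= shiftE.
have : `|h * (i == j)%:R| <= `|h| by case: eqP; rewrite ?mulr1// mulr0 normr0.
have := lerB_normD (x ord0 i) (h * (i == j)%:R); move: hh; lra.
Qed.

Lemma partials_cst0 s x : partials s (fun=> 0 : C) x = 0.
Proof.
elim: s x => //= i s IH x; have -> : partials s (fun=> 0 : C) = (fun=> 0 : C) by apply/funext.
by apply: complex_eq; exact: derive_cst.
Qed.

Lemma boxed_partials L s f : boxed L f -> boxed L (partials s f).
Proof.
move=> bf x i xL; rewrite -(partials_cst0 s x).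
apply: (@partials_local [set x | L < `|x ord0 i|]) => // [|y]; first exact: coord_open_out.
exact: bf.
Qed.

Lemma continuous_boxed_bounded L (g : 'rV[R]_n -> R) : continuous g -> boxed L g ->
  exists M, forall x, `|g x| <= M.
Proof.
move=> cg bg.
pose A : set 'rV[R]_n := [set x | forall i, [set` `[-`|L|, `|L|]] (x ord0 i)].
have cA : compact A.
  by apply: (@rV_compact _ _ (fun=> [set` `[-`|L|, `|L|]])) => i; exact: segment_compact.
have A0 : A !=set0 by exists 0 => i /=; rewrite in_itv/= mxE oppr_le0 normr_ge0.
have ng : continuous (fun x => `|g x|).
  by move=> x; apply: (@continuous_comp _ _ _ g Num.norm); [exact: cg|exact: norm_continuous].
have [c _ cM] := EVT_max_rV A0 cA (continuous_subspaceT ng).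
exists (`|g c|) => x; have [xA|] := pselect (A x); first by apply: cM; rewrite inE.
move=> /existsNP[i /negP xi]; rewrite (bg x i) ?normr0//.
move: xi; rewrite in_itv /= -ler_norml -ltNge; apply: le_lt_trans; exact: ler_norm.
Qed.

Lemma smooth_taylor D i f x (t : R) : Cinfty f ->
  blip_with D (fun x => complex.Re (partial i f x)) ->
  blip_with D (fun x => complex.Im (partial i f x)) ->
  nc (f (x + t *: e i) - f x - t%:C%C * partial i f x) <= 2 * D * t ^+ 2.
Proof.
move=> cf [_ DR] [_ DI]; have [_ _ d0] := cf [::].
have D0 : 0 <= D by have := DR 0 i 1; rewrite normr1 mulr1; apply: le_trans.
apply: le_trans (nc_le_ReIm _) _; rewrite -mulrA mulr2n mulrDl !mul1r.
apply: lerD; rewrite !(ReD, ImD, ReN, ImN, ReM, ImM) /= mul0r ?subr0 ?addr0.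
- have [r rt ->] := MVT_line x t (fun y => (d0 i y).1).
  rewrite -mulrBr normrM -(@real_normK _ t) ?num_real// expr2 mulrCA ler_wpM2l//.
  by apply: le_trans (DR _ _ _) _; rewrite ler_wpM2l.
- have [r rt ->] := MVT_line x t (fun y => (d0 i y).2).
  rewrite -mulrBr normrM -(@real_normK _ t) ?num_real// expr2 mulrCA ler_wpM2l//.
  by apply: le_trans (DI _ _ _) _; rewrite ler_wpM2l.
Qed.

Lemma partials_lip M s f : Cinfty f -> (forall x, nc (partials s f x) <= M) ->
  (forall i x, nc (partials (i :: s) f x) <= M) ->
  blip_with M (fun x => complex.Re (partials s f x)) /\
  blip_with M (fun x => complex.Im (partials s f x)).
Proof.
move=> cf fM dfM; have [_ _ d0] := cf s.
have M0 : 0 <= M by apply: le_trans (nc_ge0 _) (fM 0).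
split; split.
- by move=> x; apply: le_trans (Re_le_nc _) _.
- move=> x i h; have [r rt ->] := MVT_line x h (fun y => (d0 i y).1).
  rewrite normrM mulrC ler_wpM2r//.
  exact: le_trans (Re_le_nc (partials (i :: s) f _)) (dfM _ _).
- by move=> x; apply: le_trans (Im_le_nc _) _.
- move=> x i h; have [r rt ->] := MVT_line x h (fun y => (d0 i y).2).
  rewrite normrM mulrC ler_wpM2r//.
  exact: le_trans (Im_le_nc (partials (i :: s) f _)) (dfM _ _).
Qed.

Lemma boxed_partials_bounded L s f : Cinfty f -> boxed L f ->
  exists M, forall x, nc (partials s f x) <= M.
Proof.
move=> cf bf; have bs := boxed_partials s bf; have [cr ci _] := cf s.
have [|M1 H1] := @continuous_boxed_bounded L _ cr; first by move=> x i /bs ->.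
have [|M2 H2] := @continuous_boxed_bounded L _ ci; first by move=> x i /bs ->.
exists (M1 + M2) => x; apply: le_trans (nc_le_ReIm _) _; exact: lerD.
Qed.

Lemma smooth_blip L s f : Cinfty f -> boxed L f -> exists M,
  blip_with M (fun x => complex.Re (partials s f x)) /\
  blip_with M (fun x => complex.Im (partials s f x)).
Proof.
move=> cf bf.
have [M HM] := boxed_partials_bounded s cf bf.
have [N HN] := choice (fun i => boxed_partials_bounded (i :: s) cf bf).
exists (`|M| + \sum_i `|N i|); apply: partials_lip => // [x|i x].
  apply: le_trans (HM x) _; apply: le_trans (ler_norm _) _.
  by rewrite lerDl sumr_ge0.
apply: le_trans (HN i x) _; apply: le_trans (ler_norm _) _.
by apply: ler_wpDl => //; rewrite (bigD1 i)//= lerDl sumr_ge0.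
Qed.

Lemma smooth_cnice L s f : Cinfty f -> boxed L f -> cnice (partials s f).
Proof.
move=> cf bf; have bs := boxed_partials s bf; have [M [H1 H2]] := smooth_blip s cf bf.
split; split; try by exists M.
  by exists L => x i /bs ->.
by exists L => x i /bs ->.
Qed.

Lemma fourier_partials L s f xi : Cinfty f -> boxed L f ->
  fourier (partials s f) xi = (\prod_(i <- s) ('i%C * (xi ord0 i)%:C%C)) * fourier f xi.
Proof.
move=> cf bf; elim: s => [|i s IH]; first by rewrite big_nil mul1r.
rewrite big_cons -mulrA -IH /=.
have [D [H1 H2]] := smooth_blip (i :: s) cf bf.
apply: (@fourier_deriv R n _ _ i (2 * D)).
- exact: smooth_cnice bf.
- exact: (@smooth_cnice _ (i :: s) _ cf bf).
- exists L; split; [exact: boxed_partials|exact: (@boxed_partials _ (i :: s))].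
- by move=> x t; apply: smooth_taylor => //; exact: Cinfty_partials.
Qed.

Lemma nc_fourier_partials L s f xi : Cinfty f -> boxed L f ->
  nc (fourier (partials s f) xi) = (\prod_(i <- s) `|xi ord0 i|) * nc (fourier f xi).
Proof.
move=> cf bf; rewrite (fourier_partials _ _ cf bf) ComplexField.Normc.normcM; congr (_ * _).
elim: s => [|i s IH]; first by rewrite !big_nil ComplexField.Normc.normc1.
by rewrite !big_cons !ComplexField.Normc.normcM IH nc_i mul1r nc_real.
Qed.

End Smooth.

(** * Fejér kernels *)

Section Fejer.
Variable R : realType.
Local Notation mu := (@lebesgue_measure R).
Local Notation nc := (@ComplexField.Normc.normc R).
Implicit Types (t a b c s d : R) (N : nat).

(** The normalization gives mean [1] over a period. The double sum displays the frequencies [j - l],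
    each of which later becomes a translation of the Fourier transform. *)
Definition fejer N t : R :=
  N%:R^-1 * \sum_(j < N) \sum_(l < N) cos ((j%:R - l%:R) * t).

Lemma Re_sum (I : Type) (l : seq I) (F : I -> R[i]) :
  complex.Re (\sum_(i <- l) F i) = \sum_(i <- l) complex.Re (F i).
Proof. by apply: (big_morph _ (@ReD R)). Qed.

Lemma Im_sum (I : Type) (l : seq I) (F : I -> R[i]) :
  complex.Im (\sum_(i <- l) F i) = \sum_(i <- l) complex.Im (F i).
Proof. by apply: (big_morph _ (@ImD R)). Qed.

Lemma nc_sqr (z : R[i]) : nc z ^+ 2 = complex.Re z ^+ 2 + complex.Im z ^+ 2.
Proof. by case: z => a b /=; rewrite sqr_sqrtr// addr_ge0 ?sqr_ge0. Qed.

Lemma fejer_sqr N t : N%:R * fejer N t = nc (\sum_(j < N) expi (j%:R * t)) ^+ 2.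
Proof.
case: N => [|N]; first by rewrite mul0r big_ord0 nc0 expr0n.
rewrite /fejer mulVKf ?pnatr_eq0// nc_sqr Re_sum Im_sum !expr2 !mulr_suml -big_split /=.
apply: eq_bigr => j _; rewrite !mulr_sumr -big_split /=; apply: eq_bigr => l _.
by rewrite mulrBl cosB.
Qed.

Lemma fejer_ge0 N t : 0 <= fejer N t.
Proof.
case: N => [|N]; first by rewrite /fejer big_ord0 mulr0.
by rewrite -(pmulr_rge0 _ (ltr0Sn R N)) fejer_sqr sqr_ge0.
Qed.

Lemma geom_expi N t :
  (1 - expi t) * (\sum_(j < N) expi (j%:R * t)) = 1 - expi (N%:R * t).
Proof.
elim: N => [|N IH]; first by rewrite big_ord0 mulr0 mul0r expi0 subrr.
rewrite big_ord_recr /= mulrDr IH mulrBl mul1r -expiD.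
by rewrite -[N.+1%:R]natr1 mulrDl mul1r [t + _]addrC addrA subrK.
Qed.

(** One has [2 * (1 - cos t) = |1 - expi t| ^ 2], and the geometric sum multiplied by [1 - expi t]
    telescopes to [1 - expi (N t)], of modulus at most [2]. *)
Lemma fejer_decay N t : (1 - cos t) * fejer N t <= 2 / N%:R.
Proof.
case: N => [|N]; first by rewrite /fejer big_ord0 !mulr0 invr0 mulr0.
rewrite ler_pdivlMr ?ltr0Sn// -mulrA [fejer _ _ * _]mulrC fejer_sqr.
have h : 2 * (1 - cos t) = nc (1 - expi t) ^+ 2.
  rewrite nc_sqr ReD ImD ReN ImN /= add0r sqrrN.
  by have := cos2Dsin2 t; rewrite !expr2; lra.
have : 2 * ((1 - cos t) * nc (\sum_(j < N.+1) expi (j%:R * t)) ^+ 2) <= 2 * 2.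
  rewrite mulrA h -exprMn -ComplexField.Normc.normcM geom_expi.
  have : nc (1 - expi (N.+1%:R * t)) <= 2.
    apply: le_trans (le_normcD _ _) _.
    by rewrite normcN nc_expi ComplexField.Normc.normc1.
  have := nc_ge0 (1 - expi (N.+1%:R * t)); set z := nc _ => z0 z2.
  by rewrite -[2 * 2]expr2 lerXn2r// ?nnegrE.
by rewrite ler_pM2l.
Qed.

(** The mean value theorem gives [sin (x / 2) >= (x / 2) cos (x / 2)], so
    [sin x >= x * cos (x / 2) ^ 2]; and [cos x >= 0] means that this squared cosine is at least
    [1 / 2]. *)
Lemma sin_ge_half x : 0 <= x <= pi / 2 -> x / 2 <= sin x :> R.
Proof.
move=> /andP[x0 xpi].
have [c] := MVT_R 0 (x / 2) (@is_derive_sin R); rewrite !subr0 sin0 subr0 => cx sE.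
have x20 : 0 <= x / 2 by rewrite divr_ge0.
rewrite (ger0_norm x20) in cx.
have piE := @pi_ge0 R.
have cc : cos (x / 2) <= cos c.
  rewrite -(cos_norm c) -(@cos_norm R (x / 2)).
  have cpi : `|c| <= pi by apply: le_trans cx _; lra.
  rewrite (ger0_norm x20) leNgt; apply/negP; rewrite ltr_cos; first by rewrite ltNge cx.
    by rewrite in_itv /= x20; lra.
  by rewrite in_itv /= normr_ge0.
have cx0 : 0 <= cos (x / 2).
  by apply: cos_ge0_pihalf; apply/andP; split; lra.
have c0 : 0 <= cos x by apply: cos_ge0_pihalf; apply/andP; split; lra.
have xE : x = (x / 2) *+ 2 by rewrite mulr2n -splitr.
rewrite [in leRHS]xE sin_mulr2n.
rewrite xE cos_mulr2n in c0.
have : cos (x / 2) * cos (x / 2) * (x / 2) <= cos (x / 2) * sin (x / 2).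
  by rewrite -mulrA sE; apply: ler_wpM2l => //; apply: ler_wpM2r.
have : 0 <= x / 2 * (cos (x / 2) ^+ 2 *+ 2 - 1) by rewrite mulr_ge0.
set u := cos (x / 2); set v := sin _; set w := x / 2.
rewrite expr2 !mulr2n; nra.
Qed.

(** Here [1 - cos t = 2 sin (t / 2) ^ 2], and [sin_ge_half] bounds [sin (|t| / 2)] below by
    [|t| / 4]. *)
Lemma cos_le_sqr t : `|t| <= pi -> t ^+ 2 <= 8 * (1 - cos t) :> R.
Proof.
move=> tpi.
rewrite -(@cos_norm R t) -(real_normK (num_real t)); set a := `|t| in tpi *.
have a0 : 0 <= a by exact: normr_ge0.
have aE : a = (a / 2) *+ 2 by rewrite mulr2n -splitr.
rewrite [in leRHS]aE cos_mulr2n cos2sin2.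
have h : a / 2 / 2 <= sin (a / 2) by apply: sin_ge_half; apply/andP; split; lra.
have h0 : 0 <= a / 2 / 2 by rewrite !divr_ge0.
have : (a / 2 / 2) ^+ 2 <= sin (a / 2) ^+ 2 by rewrite lerXn2r// nnegrE// (le_trans h0).
rewrite !expr2 mulr2n; nra.
Qed.

(** The free parameter [d] separates near from far: [|t| <= d + t ^ 2 / d], and the quadratic part
    is controlled by the decay of the kernel, with [16 = 8 * 2] from [cos_le_sqr] and
    [fejer_decay]. *)
Lemma fejer_moment N d t : (0 < N)%N -> 0 < d -> `|t| <= pi ->
  `|t| * fejer N t <= d * fejer N t + 16 / (d * N%:R).
Proof.
move=> N0 d0 tpi; have F0 := fejer_ge0 N t; set F := fejer N t in F0 *.
have N0' : 0 < N%:R :> R by rewrite ltr0n.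
have td : `|t| <= d + t ^+ 2 / d.
  have t2d : 0 <= t ^+ 2 / d by rewrite divr_ge0 ?sqr_ge0// ltW.
  have [h|dt] := leP `|t| d; first exact: ler_wpDr.
  apply: ler_wpDl; first exact: ltW.
  rewrite ler_pdivlMr// -(real_normK (num_real t)) expr2 ler_wpM2l//.
  exact: ltW.
apply: (@le_trans _ _ ((d + t ^+ 2 / d) * F)); first by rewrite ler_wpM2r.
rewrite mulrDl lerD2l.
have -> : t ^+ 2 / d * F = (t ^+ 2 * F) / d by rewrite mulrAC.
have -> : 16 / (d * N%:R) = (16 / N%:R) / d by rewrite invfM; ring.
rewrite ler_pM2r ?invr_gt0//.
apply: (@le_trans _ _ (8 * (1 - cos t) * F)); first by rewrite ler_wpM2r// cos_le_sqr.
have := fejer_decay N t; rewrite -/F.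
have -> : 16 / N%:R = 8 * (2 / N%:R) :> R by rewrite mulrA -natrM.
by rewrite -mulrA => h; rewrite ler_wpM2l.
Qed.

Lemma fejer_le N t : fejer N t <= N%:R.
Proof.
case: N => [|N]; first by rewrite /fejer big_ord0 mulr0.
rewrite /fejer mulrC ler_pdivrMr ?ltr0Sn// -natrM.
apply: (@le_trans _ _ (\sum_(j < N.+1) \sum_(l < N.+1) 1)).
  by apply: ler_sum => j _; apply: ler_sum => l _; exact: cos_le1.
by rewrite !sumr_const !card_ord -mulrnA.
Qed.

Lemma fejer_lip N a b : `|fejer N a - fejer N b| <= N%:R ^+ 2 * `|a - b|.
Proof.
case: N => [|N]; first by rewrite /fejer !big_ord0 !mulr0 subrr normr0 expr0n mul0r.
rewrite /fejer -mulrBr normrM normfV (ger0_norm (ler0n _ _)) mulrC ler_pdivrMr ?ltr0Sn//.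
rewrite -sumrB; under eq_bigr do rewrite -sumrB.
apply: le_trans (ler_norm_sum _ _ _) _.
apply: (@le_trans _ _ (\sum_(j < N.+1) \sum_(l < N.+1) (N.+1%:R * `|a - b|))).
  apply: ler_sum => j _; apply: le_trans (ler_norm_sum _ _ _) _.
  apply: ler_sum => l _; apply: le_trans (cos_lip _ _) _.
  rewrite -mulrBr normrM ler_wpM2r// ler_norml.
  have := ltn_ord j; have := ltn_ord l; rewrite -!(ltr_nat R).
  move: (ler0n R j) (ler0n R l); move: (j%:R : R) (l%:R : R) (N.+1%:R : R) => x y z.
  by move=> x0 y0 xz yz; apply/andP; split; lra.
rewrite !sumr_const !card_ord -mulrnA -[leLHS]mulr_natr natrM.
by rewrite expr2 le_eqVlt; apply/orP; left; move: (N.+1%:R) => z; apply/eqP; ring.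
Qed.

Lemma fejer_continuous N c s : continuous (fun t => fejer N ((t - c) / s)).
Proof.
apply: (@lip1_continuous _ (N%:R ^+ 2 * `|s^-1|)) => t h.
apply: le_trans (fejer_lip _ _ _) _; rewrite -mulrA ler_wpM2l ?sqr_ge0//.
have -> : (t + h - c) / s - (t - c) / s = s^-1 * h by ring.
by rewrite normrM.
Qed.

Lemma sin_natpi k : sin (k%:R * pi) = 0 :> R.
Proof.
elim: k => [|k IH]; first by rewrite mul0r sin0.
by rewrite -natr1 mulrDl mul1r sinDpi IH oppr0.
Qed.

(** A primitive of the rescaled kernel. The diagonal terms are constants and integrate to [t]; the
    sines vanish at both ends of the period centred at [c], so only the diagonal contributes to the
    integral. *)
Definition fejer_prim N c s t : R :=
  N%:R^-1 * \sum_(j < N) \sum_(l < N)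
    (if j == l then t else s / (j%:R - l%:R) * sin ((j%:R - l%:R) * ((t - c) / s))).

Lemma is_derive_fejer N c s t : s != 0 ->
  is_derive t (1 : R) (fejer_prim N c s) (fejer N ((t - c) / s)).
Proof.
move=> s0; rewrite /fejer_prim /fejer.
apply: (@is_deriveZ _ _ _ (fun t => \sum_(j < N) \sum_(l < N) _)).
have sumfE (h : 'I_N -> R -> R) : (fun t => \sum_(j < N) h j t) = \sum_(j < N) h j.
  by apply/funext => x; rewrite fct_sumE.
rewrite sumfE; apply: is_derive_sum => j.
rewrite sumfE; apply: is_derive_sum => l.
case: eqP => [->|/eqP jl].
  by rewrite subrr mul0r cos0; exact: is_derive_id.
have k0 : (j%:R - l%:R : R) != 0 by rewrite subr_eq0 eqr_nat.
set k := (j%:R - l%:R) in k0 *.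
have -> : cos (k * ((t - c) / s)) = (s / k) *: (cos (k * ((t - c) / s)) * (k / s)).
  by rewrite -[RHS]/(s / k * _); move: (cos _) => y; clearbody k; field; rewrite k0 s0.
apply: (@is_deriveZ _ _ _ (fun t => sin (k * ((t - c) / s)))).
have H : is_derive t (1 : R) (fun t => k * ((t - c) / s)) (k / s).
  have -> : (fun t => k * ((t - c) / s)) = (fun t => (k / s) *: (t + - c)).
    by apply/funext => x; rewrite /GRing.scale /=; ring.
  rewrite -[X in is_derive _ _ _ X]mulr1.
  by apply: is_deriveZ; exact: is_derive_shift1.
exact: (@is_derive1_comp _ sin (fun t => k * ((t - c) / s))).

Qed.

Local Notation period_itv c s := ([set` `[c - pi * s, c + pi * s]] : set R).

Lemma period_integrable c s (f : R -> R) : continuous f ->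
  mu.-integrable (period_itv c s) (EFin \o f).
Proof.
move=> cf; apply: continuous_compact_integrable; first exact: segment_compact.
exact/continuous_subspaceT.
Qed.

Lemma fejer_integral N c s : (0 < N)%N -> 0 < s ->
  \int[mu]_(t in period_itv c s) fejer N ((t - c) / s) = 2 * pi * s.
Proof.
move=> N0 s0; have p0 := mulr_gt0 (@pi_gt0 R) s0.
have dF t := is_derive_fejer N c t (lt0r_neq0 s0).
have cF : continuous (fejer_prim N c s).
  by move=> t; apply/differentiable_continuous/derivable1_diffP; have [] := dF t.
rewrite /Rintegral (@continuous_FTC2 _ _ (fejer_prim N c s))/=.
- have jlE (j l : 'I_N) : (if j == l then c + pi * s else s / (j%:R - l%:R) * sin ((j%:R - l%:R) * ((c + pi * s - c) / s)))
     - (if j == l then c - pi * s else s / (j%:R - l%:R) * sin ((j%:R - l%:R) * ((c - pi * s - c) / s))) = (j == l)%:R * (2 * pi * s).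
    case: eqP => _; first by rewrite mul1r; ring.
    have -> : (c + pi * s - c) / s = pi by field; rewrite gt_eqF.
    have -> : (c - pi * s - c) / s = - pi by field; rewrite gt_eqF.
    by rewrite mulrN sinN mulrBl sinB !sin_natpi !(mul0r, mulr0) subrr oppr0 mulr0 subrr.
  rewrite /fejer_prim -mulrBr -sumrB.
  under eq_bigr do rewrite -sumrB.
  under eq_bigr do under eq_bigr do rewrite jlE.
  have jE (j : 'I_N) : \sum_(l < N) (j == l)%:R * (2 * pi * s) = 2 * pi * s.
    rewrite (bigD1 j)//= eqxx mul1r big1 ?addr0// => l.
    by rewrite eq_sym => /negbTE ->; rewrite mul0r.
  under eq_bigr do rewrite jE.
  by rewrite sumr_const card_ord -[X in _ * X]mulr_natl mulKf// pnatr_eq0 -lt0n.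
- by lra.
- exact/continuous_subspaceT/fejer_continuous.
- split => /=.
  + by move=> t _; have [] := dF t.
  + by apply: cvg_at_right_filter; exact: cF.
  + by apply: cvg_at_left_filter; exact: cF.
- by move=> t _; rewrite derive1E; have [_ ->] := dF t.
Qed.

Lemma period_le c s (f g : R -> R) : continuous f -> continuous g ->
  (forall t, period_itv c s t -> `|f t| <= g t) ->
  `|\int[mu]_(t in period_itv c s) f t| <= \int[mu]_(t in period_itv c s) g t.
Proof.
move=> cf cg fg; apply: le_trans (le_normr_Rintegral _ (period_integrable c s cf)) _ => //.
apply: le_Rintegral => //; last exact: period_integrable.
by apply: period_integrable => t; apply: (@continuous_comp _ _ _ f Num.norm); [exact: cf|exact: norm_continuous].
Qed.

Lemma period_cst c s M : 0 < s -> \int[mu]_(t in period_itv c s) M = 2 * pi * s * M.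
Proof.
move=> s0; have p0 := mulr_gt0 (@pi_gt0 R) s0.
rewrite Rintegral_cst//= lebesgue_measure_itv/= lte_fin ifT; last by lra.
by rewrite /=; ring.
Qed.

Lemma period_in c s t : 0 < s -> period_itv c s t -> `|(t - c) / s| <= pi.
Proof.
move=> s0; rewrite /= in_itv /= => /andP[h1 h2].
rewrite normrM normfV (gtr0_norm s0) ler_pdivrMr// ler_norml; apply/andP; split; lra.
Qed.

Lemma period_Rintegral c s (f : R -> R) : (forall t, pi * s < `|t - c| -> f t = 0) ->
  \int[mu]_t f t = \int[mu]_(t in period_itv c s) f t.
Proof.
move=> f0; rewrite [RHS]Rintegral_mkcond; apply: eq_Rintegral => t _.
rewrite patchE; case: ifPn => // /negP tL.
apply: f0; rewrite ltNge; apply/negP; rewrite ler_norml => /andP[h1 h2]; apply: tL.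
by rewrite inE /= in_itv/=; apply/andP; split; lra.
Qed.

(** As the kernel has mean [1], [g c] may be moved under the integral; the bound
    [|g t - g c| <= La * |t - c|] then leaves the first absolute moment of the kernel, estimated by
    [fejer_moment]. *)
Lemma fejer_approx1 N c s d (La : R) (g : R -> R) : (0 < N)%N -> 0 < s -> 0 < d -> 0 <= La ->
  (forall t h, `|g (t + h) - g t| <= La * `|h|) ->
  `|\int[mu]_(t in period_itv c s) (g t * fejer N ((t - c) / s)) - 2 * pi * s * g c| <=
   2 * pi * s * (La * s * (d + 16 / (d * N%:R))).
Proof.
move=> N0 s0 d0 La0 gL; have cg := lip1_continuous gL; have cF := @fejer_continuous N c s.
have cM (f1 f2 : R -> R) : continuous f1 -> continuous f2 -> continuous (fun t => f1 t * f2 t).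
  by move=> c1 c2 t; apply: continuousM; [exact: c1|exact: c2].
have cC (k : R) : continuous (fun _ : R => k) by move=> t; exact: cvg_cst.
have -> : 2 * pi * s * g c = \int[mu]_(t in period_itv c s) (g c * fejer N ((t - c) / s)).
  by rewrite RintegralZl ?fejer_integral//; [rewrite mulrC|exact: period_integrable].
rewrite -RintegralB//; try (apply: period_integrable; exact: cM).
have -> : 2 * pi * s * (La * s * (d + 16 / (d * N%:R))) =
  \int[mu]_(t in period_itv c s) (La * s * d * fejer N ((t - c) / s) + La * s * (16 / (d * N%:R))).
  rewrite RintegralD//; try by apply: period_integrable => //; apply: cM.
  rewrite RintegralZl//; last exact: period_integrable.
  by rewrite fejer_integral// period_cst//; ring.
apply: period_le.
- by move=> t; apply: cvgB; [exact: (cM _ _ cg cF t)|exact: (cM _ _ (cC _) cF t)].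
- by move=> t; apply: cvgD; [exact: (cM _ _ (cC _) cF t)|exact: (cC _ t)].
- move=> t tI; rewrite -mulrBl normrM (ger0_norm (fejer_ge0 _ _)).
  have := gL c (t - c); rewrite subrKC => h1.
  have h2 := fejer_moment N0 d0 (period_in s0 tI).
  have F0 := fejer_ge0 N ((t - c) / s).
  apply: (@le_trans _ _ (La * `|t - c| * fejer N ((t - c) / s))); first by rewrite ler_wpM2r.
  have -> : `|t - c| = s * `|(t - c) / s|.
    by rewrite normrM normfV (gtr0_norm s0) mulrC divfK// gt_eqF.
  have LS : 0 <= La * s by rewrite mulr_ge0// ltW.
  by have := ler_wpM2l LS h2; rewrite mulrDr !mulrA.
Qed.

End Fejer.

(** * Fejér approximation in several variables *)

Section Kernels.
Variable R : realType.
Local Notation mu := (@lebesgue_measure R).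
Local Notation nc := (@ComplexField.Normc.normc R).
Local Notation period_itv c s := ([set` `[c - pi * s, c + pi * s]] : set R).

Lemma blip_coord n (F : R -> R) (i : 'I_n) M D : 0 <= M -> 0 <= D ->
  (forall t, `|F t| <= M) -> (forall a b, `|F a - F b| <= D * `|a - b|) ->
  blip (fun x : 'rV[R]_n => F (x ord0 i)).
Proof.
move=> M0 D0 FM FD; exists (M + D); split => [x|x j h].
  by apply: le_trans (FM _) _; rewrite lerDl.
apply: le_trans (FD _ _) _; rewrite shiftE addrC addKr.
apply: ler_pM => //; first by rewrite lerDr.
by case: (i == j); rewrite ?mulr1// mulr0 normr0.
Qed.

Lemma blip_prod n (I : Type) (r : seq I) (F : I -> 'rV[R]_n -> R) :
  (forall i, blip (F i)) -> blip (fun x => \prod_(i <- r) F i x).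
Proof.
move=> bF; elim: r => [|i r IH].
  by have := @blip_cst R n 1; congr blip; apply/funext => x; rewrite big_nil.
by have := blipM (bF i) IH; congr blip; apply/funext => x; rewrite big_cons.
Qed.

Lemma blip_fejer n N (s c : R) (i : 'I_n) : blip (fun x : 'rV[R]_n => fejer N ((x ord0 i - c) / s)).
Proof.
apply: (@blip_coord n (fun t => fejer N ((t - c) / s)) i N%:R (N%:R ^+ 2 * `|s^-1|)) => //.
- by move=> t; rewrite ger0_norm ?fejer_ge0// fejer_le.
- move=> a b; apply: le_trans (fejer_lip _ _ _) _; rewrite -[leRHS]mulrA ler_wpM2l ?sqr_ge0//.
  have -> : (a - c) / s - (b - c) / s = s^-1 * (a - b) by ring.
  by rewrite normrM.
Qed.

Definition fejer_kernel n N (s : R) (c x : 'rV[R]_n) : R :=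
  \prod_(i < n) fejer N ((x ord0 i - c ord0 i) / s).

Lemma blip_fejer_kernel n N (s : R) (c : 'rV[R]_n) : blip (fejer_kernel N s c).
Proof. by apply: blip_prod => i; exact: blip_fejer. Qed.

(** Induction on the dimension: the inner integral is replaced by a value of [g], then the
    one-dimensional estimate is applied in the first coordinate. Each coordinate contributes the
    same error, whence the factor [n]. *)
Lemma fejer_approx n N (s d La : R) (g : 'rV[R]_n -> R) (c : 'rV[R]_n) : (0 < N)%N -> 0 < s -> 0 < d -> 0 <= La ->
  nice g -> (forall x i h, `|g (x + h *: delta_mx ord0 i) - g x| <= La * `|h|) ->
  (forall (x : 'rV[R]_n) i, pi * s < `|x ord0 i - c ord0 i| -> g x = 0) ->
  `|iintegral (fun x => g x * fejer_kernel N s c x) - (2 * pi * s) ^+ n * g c| <=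
    n%:R * ((2 * pi * s) ^+ n * (La * s * (d + 16 / (d * N%:R)))).
Proof.
move=> N0 s0 d0 La0; set E := La * s * _.
have ps0 : 0 <= 2 * pi * s by rewrite !mulr_ge0 ?pi_ge0// ltW.
elim: n g c => [g c _ _ _|m IH g c ng gL g0].
  rewrite /= /fejer_kernel big_ord0 mulr1 expr0 mul1r mul0r.
  have -> : c = 0 by apply/rowP => -[].
  by rewrite subrr normr0.
pose c0 := c ord0 ord0; pose c' : 'rV[R]_m := \row_j c ord0 (lift ord0 j).
pose F t := fejer N ((t - c0) / s).
pose J t := iintegral (fun y => slice g t y * fejer_kernel N s c' y).
have cE : c = rv_cons c0 c' by exact: rv_consE.
have kE t y : fejer_kernel N s c (rv_cons t y) = F t * fejer_kernel N s c' y.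
  rewrite /fejer_kernel big_ord_recl rv_cons0; congr (_ * _).
  by apply: eq_bigr => i _; rewrite rv_consS mxE.
have nslice t : nice (fun y => slice g t y * fejer_kernel N s c' y).
  by apply: nice_mul; [exact: nice_slice|exact: blip_fejer_kernel].
have JE : iintegral (fun x => g x * fejer_kernel N s c x) = \int[mu]_t (F t * J t).
  rewrite iintegralS; apply: eq_Rintegral => t _; rewrite /J -iintegralZ//.
  by congr iintegral; apply/funext => y; rewrite /slice kE mulrCA.
(* [J] is the integral of the slices of [g] times the kernel in the remaining coordinates only. That
   product is a nice function of all the variables, so [slice_continuous] applies. *)
have cJ : continuous J.
  have -> : J = (fun t => iintegral (slice (fun x : 'rV[R]_m.+1 => g x *
       \prod_(i < m) fejer N ((x ord0 (lift ord0 i) - c' ord0 i) / s)) t)).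
    apply/funext => t; congr iintegral; apply/funext => y; rewrite /slice.
    by congr (_ * _); apply: eq_bigr => i _; rewrite rv_consS.
  apply: (slice_continuous (iint_specP R m)); apply: nice_mul => //.
  by apply: blip_prod => i; exact: blip_fejer.
have cF : continuous F by exact: fejer_continuous.
have cg : continuous (fun t => g (rv_cons t c')).
  by apply: (@lip1_continuous _ La) => t h; rewrite -rv_cons_shift0; exact: gL.
have cM (f1 f2 : R -> R) : continuous f1 -> continuous f2 -> continuous (fun t => f1 t * f2 t).
  by move=> c1 c2 t; apply: continuousM; [exact: c1|exact: c2].
have cC (k : R) : continuous (fun _ : R => k) by move=> t; exact: cvg_cst.
have J0 t : pi * s < `|t - c0| -> J t = 0.
  move=> tc; rewrite /J; have -> : (fun y => slice g t y * fejer_kernel N s c' y) = (fun y => 0 * (slice g t y * fejer_kernel N s c' y)).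
    apply/funext => y; rewrite mul0r; have -> : slice g t y = 0; last by rewrite mul0r.
    by apply: (g0 _ ord0); rewrite rv_cons0.
  by rewrite iintegralZ// mul0r.
have JJ t : `|J t - (2 * pi * s) ^+ m * g (rv_cons t c')| <= m%:R * ((2 * pi * s) ^+ m * E).
  apply: (IH (slice g t) c'); first exact: nice_slice.
    by move=> y i h; rewrite /slice -rv_cons_shiftS; exact: gL.
  move=> y i yi; apply: (g0 _ (lift ord0 i)); rewrite rv_consS.
  by move: yi; rewrite mxE.
have F0 t : 0 <= F t by exact: fejer_ge0.
rewrite JE (@period_Rintegral _ c0 s); last by move=> t /J0 ->; rewrite mulr0.
have gE := fejer_approx1 c0 N0 s0 d0 La0 (g := fun t => g (rv_cons t c')).
rewrite -cE in gE.
have gL' t h : `|g (rv_cons (t + h) c') - g (rv_cons t c')| <= La * `|h|.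
  by rewrite -rv_cons_shift0; exact: gL.
have {gL' gE} := gE gL'.
rewrite -/E; set K := \int[mu]_(t in _) (g _ * _) => gE.
(* The kernel is nonnegative of mass [2 * pi * s], so the error of the inner integral is merely
   multiplied by that mass. *)
have H1 : `|\int[mu]_(t in period_itv c0 s) (F t * J t) - (2 * pi * s) ^+ m * K| <=
    m%:R * ((2 * pi * s) ^+ m.+1 * E).
  rewrite -RintegralZl//; last by apply: period_integrable; exact: cM.
  rewrite -RintegralB//; last first.
  - by apply: period_integrable; exact: (cM _ _ (cC _) (cM _ _ cg cF)).
  - by apply: period_integrable; exact: cM.
  have -> : m%:R * ((2 * pi * s) ^+ m.+1 * E) =
      \int[mu]_(t in period_itv c0 s) (m%:R * ((2 * pi * s) ^+ m * E) * F t).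
    by rewrite RintegralZl ?fejer_integral//; [rewrite exprS; ring|exact: period_integrable].
  apply: period_le.
  - by move=> t; apply: cvgB; [exact: (cM _ _ cF cJ t)|exact: (cM _ _ (cC _) (cM _ _ cg cF) t)].
  - exact: cM.
  - move=> t _; have -> : F t * J t - (2 * pi * s) ^+ m * (g (rv_cons t c') * fejer N ((t - c0) / s))
       = (J t - (2 * pi * s) ^+ m * g (rv_cons t c')) * F t by rewrite /F; ring.
    by rewrite normrM (ger0_norm (F0 t)) ler_wpM2r.
have H2 : `|(2 * pi * s) ^+ m * K - (2 * pi * s) ^+ m.+1 * g c| <= (2 * pi * s) ^+ m.+1 * E.
  have pm : 0 <= (2 * pi * s) ^+ m by rewrite exprn_ge0.
  have -> : (2 * pi * s) ^+ m * K - (2 * pi * s) ^+ m.+1 * g c =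
      (2 * pi * s) ^+ m * (K - 2 * pi * s * g c) by rewrite exprSr; ring.
  by rewrite normrM (ger0_norm pm) exprSr -[leRHS]mulrA ler_wpM2l.
set A := \int[mu]_(t in _) _ in H1 *.
have -> : A - (2 * pi * s) ^+ m.+1 * g c = (A - (2 * pi * s) ^+ m * K) + ((2 * pi * s) ^+ m * K - (2 * pi * s) ^+ m.+1 * g c) by ring.
by apply: le_trans (ler_normD _ _) _; rewrite -[m.+1%:R]natr1 [leRHS]mulrDl mul1r; exact: lerD.
Qed.

Variable n : nat.
Implicit Types (f : 'rV[R]_n -> R[i]) (xi eta : 'rV[R]_n) (h : 'rV[R]_n -> R).

Lemma cnice_blip f h : cnice f -> blip h -> cnice (fun x => f x * (h x)%:C%C).
Proof. by move=> nf bh; apply: cnice_mul => //; exact: cblip_real. Qed.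

(** The transform at frequency [0] is the plain integral. This puts [fejer_approx] into a form where
    a point value is controlled by transforms. *)
Lemma nc_recover N (s d La : R) f (c : 'rV[R]_n) : (0 < N)%N -> 0 < s -> 0 < d -> 0 <= La ->
  cnice f ->
  (forall (x : 'rV[R]_n) i (h : R), `|complex.Re (f (x + h *: delta_mx ord0 i)) - complex.Re (f x)| <= La * `|h|) ->
  (forall (x : 'rV[R]_n) i (h : R), `|complex.Im (f (x + h *: delta_mx ord0 i)) - complex.Im (f x)| <= La * `|h|) ->
  (forall (x : 'rV[R]_n) i, pi * s < `|x ord0 i - c ord0 i| -> f x = 0) ->
  (2 * pi * s) ^+ n * nc (f c) <= nc (fourier (fun x => f x * (fejer_kernel N s c x)%:C%C) 0) +
    2 * (n%:R * ((2 * pi * s) ^+ n * (La * s * (d + 16 / (d * N%:R))))).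
Proof.
move=> N0 s0 d0 La0 [fr fi] fLr fLi f0.
have HR := fejer_approx N0 s0 d0 La0 fr fLr (c := c).
have {}HR := HR (fun x i xc => congr1 (@complex.Re R) (f0 x i xc)).
have HI := fejer_approx N0 s0 d0 La0 fi fLi (c := c).
have {}HI := HI (fun x i xc => congr1 (@complex.Im R) (f0 x i xc)).
rewrite fourierE; set P := (2 * pi * s) ^+ n in HR HI *.
have P0 : 0 <= P by rewrite exprn_ge0// !mulr_ge0 ?pi_ge0// ltW.
set Z := cint _.
have -> : P * nc (f c) = nc (P%:C%C * f c).
  by rewrite ComplexField.Normc.normcM nc_real ger0_norm.
have -> : P%:C%C * f c = Z - (Z - P%:C%C * f c) by ring.
apply: le_trans (le_normcD _ _) _; rewrite normcN lerD2l.
apply: le_trans (nc_le_ReIm _) _; rewrite mulr2n mulrDl !mul1r; apply: lerD.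
- apply: le_trans HR; rewrite ReD ReN ReM /= mul0r subr0.
  set A := iintegral _; set B := iintegral _; suff -> : A = B by [].
  congr iintegral; apply/funext => x; rewrite !ReM /=.
  have -> : dot x 0 = 0 by rewrite /dot big1// => i _; rewrite mxE mulr0.
  by rewrite oppr0 cos0 sin0 !mulr0 !subr0 mulr1.
- apply: le_trans HI; rewrite ImD ImN ImM /= mul0r addr0.
  set A := iintegral _; set B := iintegral _; suff -> : A = B by [].
  congr iintegral; apply/funext => x; rewrite !ImM /=.
  have -> : dot x 0 = 0 by rewrite /dot big1// => i _; rewrite mxE mulr0.
  by rewrite oppr0 cos0 sin0 !mulr0 !add0r mulr1.
Qed.

End Kernels.

(** * Frequency lattices and trigonometric localizers *)

Section Lattice.
Variables (R : realType) (n : nat).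
Local Notation nc := (@ComplexField.Normc.normc R).
Local Notation e i := (delta_mx (ord0 : 'I_1) i : 'rV[R]_n).
Implicit Types (f : 'rV[R]_n -> R[i]) (x xi eta c : 'rV[R]_n) (h : 'rV[R]_n -> R) (s t : R).

Lemma cnice0 : cnice (fun _ : 'rV[R]_n => 0 : R[i]).
Proof.
have n0 : nice (fun _ : 'rV[R]_n => 0 : R) by split; [exact: blip_cst|exists 0].
by split; exact: n0.
Qed.

Lemma fourier0 xi : fourier (fun _ : 'rV[R]_n => 0 : R[i]) xi = 0.
Proof.
rewrite -[RHS](mul0r (fourier (fun=> 0) xi)) -fourierZ; last exact: cnice0.
by congr fourier; apply/funext => x; rewrite mul0r.
Qed.

Lemma fourier_sum (I : Type) (r : seq I) (F : I -> 'rV[R]_n -> R[i]) xi :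
  (forall i, cnice (F i)) ->
  cnice (fun x => \sum_(i <- r) F i x) /\
  fourier (fun x => \sum_(i <- r) F i x) xi = \sum_(i <- r) fourier (F i) xi.
Proof.
move=> nF; elim: r => [|i r [IH1 IH2]].
  rewrite big_nil (_ : (fun x => _) = fun=> 0); last by apply/funext => x; rewrite big_nil.
  by split; [exact: cnice0|exact: fourier0].
have -> : (fun x => \sum_(j <- i :: r) F j x) = (fun x => F i x + \sum_(j <- r) F j x).
  by apply/funext => x; rewrite big_cons.
split; first exact: cniceD.
by rewrite big_cons fourierD// IH2.
Qed.

Lemma nc_sum (I : Type) (r : seq I) (F : I -> R[i]) :
  nc (\sum_(i <- r) F i) <= \sum_(i <- r) nc (F i).
Proof.
elim: r => [|i r IH]; first by rewrite !big_nil nc0.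
by rewrite !big_cons; apply: le_trans (le_normcD _ _) _; rewrite lerD2l.
Qed.

Lemma dot_axis x (a : R) i : dot x (a *: e i) = a * x ord0 i.
Proof.
rewrite /dot (bigD1 i)//= !mxE !eqxx /= mulr1 mulrC big1 ?addr0// => j ji.
by rewrite !mxE (negbTE ji) andbF mulr0 mulr0.
Qed.

Lemma cnice_modulation f b eta : cnice f -> cnice (fun x => expi (dot x eta + b) * f x).
Proof.
move=> nf; have bE : cblip (fun x => expi (dot x eta + b)).
  by apply: (@cblip_expi _ _ _ (fun i => eta ord0 i)) => x i t; rewrite dot_shift addrAC.
by have := cnice_mul nf bE; congr cnice; apply/funext => x; rewrite mulrC.
Qed.

Lemma nc_fourier_modulation f b eta xi : cnice f ->
  nc (fourier (fun x => expi (dot x eta + b) * f x) xi) = nc (fourier f (xi - eta)).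
Proof. by move=> nf; rewrite fourier_modulation// ComplexField.Normc.normcM nc_expi mul1r. Qed.

(** The imaginary part cancels because exchanging [j] and [l] changes the sign of the sine. *)
Lemma fejer_expi N t : (fejer N t)%:C%C =
  \sum_(j < N) \sum_(l < N) (N%:R^-1)%:C%C * expi ((j%:R - l%:R) * t).
Proof.
have -> : \sum_(j < N) \sum_(l < N) (N%:R^-1)%:C%C * expi ((j%:R - l%:R) * t) =
   (N%:R^-1)%:C%C * \sum_(j < N) \sum_(l < N) expi ((j%:R - l%:R) * t).
  by rewrite mulr_sumr; apply: eq_bigr => j _; rewrite mulr_sumr.
rewrite /fejer rmorphM; congr (_ * _); apply: complex_eq.
  by rewrite Re_sum /=; apply: eq_bigr => j _; rewrite Re_sum.
rewrite Im_sum /=; set S := \sum_(j < N) _.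
have SE : S = \sum_(j < N) \sum_(l < N) sin ((j%:R - l%:R) * t).
  by apply: eq_bigr => j _; rewrite Im_sum.
have : S = - S.
  rewrite {1}SE exchange_big SE /= -sumrN; apply: eq_bigr => j _.
  by rewrite -sumrN; apply: eq_bigr => l _; rewrite -sinN -mulNr opprB.
by move: S {SE} => S h; lra.
Qed.

Lemma fourier_fejer_coord f i N s (c : R) xi : cnice f ->
  nc (fourier (fun x => f x * (fejer N ((x ord0 i - c) / s))%:C%C) xi) <=
  N%:R^-1 * \sum_(j < N) \sum_(l < N) nc (fourier f (xi - ((j%:R - l%:R) / s) *: e i)).
Proof.
move=> nf.
pose G (j l : 'I_N) x := (N%:R^-1)%:C%C * (expi (dot x (((j%:R - l%:R) / s) *: e i) + (j%:R - l%:R) * (- c / s)) * f x).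
have nG j l : cnice (G j l) by apply: cniceZ; exact: cnice_modulation.
have -> : (fun x => f x * (fejer N ((x ord0 i - c) / s))%:C%C) = (fun x => \sum_(j < N) \sum_(l < N) G j l x).
  apply/funext => x; rewrite fejer_expi mulr_sumr; apply: eq_bigr => j _.
  rewrite mulr_sumr; apply: eq_bigr => l _; rewrite /G dot_axis mulrC -mulrA.
  by congr (_ * (expi _ * _)); ring.
have [_ ->] := @fourier_sum _ (index_enum 'I_N) (fun j x => \sum_(l < N) G j l x) xi
   (fun j => (@fourier_sum _ (index_enum 'I_N) (G j) xi (nG j)).1).
apply: le_trans (nc_sum _ _) _; rewrite mulr_sumr; apply: ler_sum => j _.
have [_ ->] := @fourier_sum _ (index_enum 'I_N) (G j) xi (nG j).
apply: le_trans (nc_sum _ _) _; rewrite mulr_sumr; apply: ler_sum => l _.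
rewrite /G fourierZ; last exact: cnice_modulation.
by rewrite ComplexField.Normc.normcM nc_real ger0_norm ?invr_ge0// nc_fourier_modulation.
Qed.

(** The lattice dual to the period [2 * pi * s]: the frequencies that the kernels of scale [s] reach
    from [0]. *)
Definition lat s (k : 'I_n -> int) : 'rV[R]_n := \row_i ((k i)%:~R / s).

(** The map [l + B - j] sends the counted indices injectively into an ordinal of size
    [2 * B + 1]. *)
Lemma count_band N B (j : 'I_N) :
  (\sum_(l < N) (`|(j%:Z - l%:Z)%R|%N <= B) <= 2 * B + 1)%N.
Proof.
rewrite (eq_bigr (fun l : 'I_N => if `|(j%:Z - l%:Z)%R|%N <= B then 1 else 0)%N); last first.
  by move=> l _; case: leqP.
rewrite -big_mkcond sum1_card.
pose g (l : 'I_N) : 'I_(2 * B).+1 := inord (l + B - j).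
rewrite -(@card_in_imset _ _ g).
  by apply: leq_trans (max_card _) _; rewrite card_ord addn1.
move=> l l'; rewrite !unfold_in => h1 h2 /(congr1 val); rewrite /g /= !inordK; try lia.
by move=> E; apply/val_inj => /=; lia.
Qed.

(** The coordinates in [l] are exempt because they already carry a Fejér factor and have been summed
    over. *)
Definition in_band (B : nat) (l : seq 'I_n) (k : 'I_n -> int) : bool :=
  [forall i, (i \notin l) ==> (`|k i|%N <= B)%N].

(** A Fejér factor is a sum of [N ^ 2] translates with weight [1 / N]. For each [j], at most
    [2 * B + 1] values of the other index keep the new coordinate in the band, so the large bound
    [A] is charged [2 * B + 1] times and not [N] times; only the small bound [y] pays the factor
    [N]. *)
Lemma fejer_band_seq f N B s c (A y : R) (l : seq 'I_n) : cnice f -> (0 < N)%N ->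
  0 <= A -> 0 <= y -> uniq l ->
  (forall k : 'I_n -> int, (forall i, (`|k i|%N < N)%N) ->
     nc (fourier f (lat s k)) <= A * (in_band B [::] k)%:R + y) ->
  forall k : 'I_n -> int, (forall i, (`|k i|%N < N)%N) -> (forall i, i \in l -> k i = 0) ->
  nc (fourier (fun x => f x * (\prod_(i <- l) fejer N ((x ord0 i - c ord0 i) / s))%:C%C) (lat s k))
   <= A * (2 * B + 1)%:R ^+ size l * (in_band B l k)%:R + y * N%:R ^+ size l.
Proof.
move=> nf N0 A0 y0 ul H; elim: l ul => [_ k kN _|i l IH]; last first.
  rewrite cons_uniq => /andP[il ul] k kN k0.
pose g x := f x * (\prod_(i <- l) fejer N ((x ord0 i - c ord0 i) / s))%:C%C.
have ng : cnice g by apply: cnice_blip => //; apply: blip_prod => j; exact: blip_fejer.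
have -> : (fun x => f x * (\prod_(i0 <- i :: l) fejer N ((x ord0 i0 - c ord0 i0) / s))%:C%C)
  = (fun x => g x * (fejer N ((x ord0 i - c ord0 i) / s))%:C%C).
  by apply/funext => x; rewrite big_cons rmorphM /g mulrCA mulrC.
apply: le_trans (fourier_fejer_coord _ _ _ _ _ ng) _.
(* The coordinate [i] of [k] is zero, so the translation merely sets it to [m - j], which stays
   below [N] in absolute value. *)
pose k' (j m : 'I_N) i' : int := if i' == i then m%:Z - j%:Z else k i'.
have kE (j m : 'I_N) : lat s k - ((j%:R - m%:R) / s) *: e i = lat s (k' j m).
  apply/rowP => i'; rewrite !mxE /k' eqxx /=; case: eqP => [->|_].
    by rewrite (k0 i) ?mem_head// mul0r mulr1 sub0r -mulNr opprB intrB.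
  by rewrite mulr0 subr0.
have k'N (j m : 'I_N) i' : (`|k' j m i'|%N < N)%N.
  by rewrite /k'; case: eqP => // _; have := ltn_ord j; have := ltn_ord m; lia.
have k'0 (j m : 'I_N) i' : i' \in l -> k' j m i' = 0.
  move=> i'l; rewrite /k'; case: eqP => [E|_]; first by rewrite -E i'l in il.
  by apply: k0; rewrite inE i'l orbT.
have bE (j m : 'I_N) : (in_band B l (k' j m) <= in_band B (i :: l) k * (`|(j%:Z - m%:Z)%R|%N <= B))%N.
  case: (boolP (in_band B l (k' j m))) => // /forallP bl.
  have := bl i; rewrite il /= /k' eqxx => ijm.
  have -> : (`|(j%:Z - m%:Z)%R|%N <= B)%N by lia.
  rewrite muln1 lt0b; apply/forallP => i'; apply/implyP; rewrite inE negb_or => /andP[i'i i'l].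
  by have := bl i'; rewrite i'l /= /k' (negbTE i'i).
set P := (2 * B + 1)%:R ^+ size l : R; set Q := N%:R ^+ size l : R.
have P0 : 0 <= P by rewrite exprn_ge0.
have Q0 : 0 <= Q by rewrite exprn_ge0.
have N0' : 0 < N%:R :> R by rewrite ltr0n.
apply: (@le_trans _ _ (N%:R^-1 * \sum_(j < N) \sum_(m < N)
   (A * P * (in_band B (i :: l) k * (`|(j%:Z - m%:Z)%R|%N <= B))%:R + y * Q))).
  rewrite ler_wpM2l ?invr_ge0// ler_sum// => j _; rewrite ler_sum// => m _.
  rewrite kE; apply: le_trans (IH ul _ (k'N j m) (k'0 j m)) _.
  by rewrite lerD2r ler_wpM2l ?mulr_ge0// ler_nat bE.
rewrite ler_pdivrMl//.
apply: (@le_trans _ _ (\sum_(j < N) (A * P * (in_band B (i :: l) k)%:R * (2 * B + 1)%:R + N%:R * (y * Q)))).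
  apply: ler_sum => j _; rewrite big_split /= sumr_const card_ord -[_ *+ N]mulr_natl lerD2r.
  rewrite -mulr_sumr -[leRHS]mulrA ler_wpM2l ?mulr_ge0//.
  rewrite -natr_sum -natrM ler_nat -big_distrr /= leq_mul2l count_band orbT //.
rewrite sumr_const card_ord -[leLHS]mulr_natl !exprS -/P -/Q.
rewrite le_eqVlt; apply/orP; left; apply/eqP.
move: ((2 * B + 1)%:R : R) (N%:R : R) ((in_band _ _ _)%:R : R) => a b d; ring.
rewrite !expr0 !mulr1; suff -> : (fun x => f x * (\prod_(i <- [::]) fejer N ((x ord0 i - c ord0 i) / s))%:C%C) = f.
  exact: H.
by apply/funext => x; rewrite big_nil mulr1.
Qed.

Lemma fejer_band f N B s c (A y : R) : cnice f -> (0 < N)%N -> 0 <= A -> 0 <= y ->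
  (forall k : 'I_n -> int, (forall i, (`|k i|%N <= B)%N) -> nc (fourier f (lat s k)) <= A) ->
  (forall k : 'I_n -> int, (forall i, (`|k i|%N < N)%N) -> (exists i, (B < `|k i|)%N) ->
     nc (fourier f (lat s k)) <= y) ->
  nc (fourier (fun x => f x * (fejer_kernel N s c x)%:C%C) 0) <=
    A * (2 * B + 1)%:R ^+ n + y * N%:R ^+ n.
Proof.
move=> nf N0 A0 y0 HA Hy.
have H (k : 'I_n -> int) : (forall i, (`|k i|%N < N)%N) ->
     nc (fourier f (lat s k)) <= A * (in_band B [::] k)%:R + y.
  move=> kN; case: (boolP (in_band B [::] k)) => [/forallP b|].
    by rewrite mulr1 ler_wpDr//; apply: HA => i; have := b i.
  move=> /forallPn[j]; rewrite /= -ltnNge => ki.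
  by rewrite mulr0 add0r; apply: Hy => //; exists j.
have := fejer_band_seq c nf N0 A0 y0 (index_enum_uniq 'I_n) H (k := fun=> 0).
have -> : lat s (fun=> 0) = 0 by apply/rowP => i; rewrite !mxE mul0r.
move=> h; apply: le_trans (h _ _) _ => //.
have -> : size (index_enum 'I_n) = n by rewrite -sum1_size sum_nat_const card_ord muln1.
by rewrite lerD2r ler_piMr ?mulr_ge0 ?exprn_ge0//; case: (in_band _ _ _); rewrite ?lexx ?ler01.
Qed.

Lemma recover_band N B s dl (La A y : R) f c : (0 < N)%N -> 1 <= s -> 0 < dl ->
  0 <= La -> 0 <= A -> 0 <= y -> cnice f ->
  (forall x i (h : R), `|complex.Re (f (x + h *: e i)) - complex.Re (f x)| <= La * `|h|) ->
  (forall x i (h : R), `|complex.Im (f (x + h *: e i)) - complex.Im (f x)| <= La * `|h|) ->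
  (forall x i, pi * s < `|x ord0 i - c ord0 i| -> f x = 0) ->
  (forall k : 'I_n -> int, (forall i, (`|k i|%N <= B)%N) -> nc (fourier f (lat s k)) <= A) ->
  (forall k : 'I_n -> int, (forall i, (`|k i|%N < N)%N) -> (exists i, (B < `|k i|)%N) ->
     nc (fourier f (lat s k)) <= y) ->
  nc (f c) <= A * (2 * B + 1)%:R ^+ n + y * N%:R ^+ n +
    2 * (n%:R * (La * s * (dl + 16 / (dl * N%:R)))).
Proof.
move=> N0 s1 dl0 La0 A0 y0 nf fr fi f0 low high.
have s0 : 0 < s by lra.
have rec := nc_recover N0 s0 dl0 La0 nf fr fi f0.
have band := fejer_band c nf N0 A0 y0 low high.
set P := (2 * pi * s) ^+ n in rec.
have P1 : 1 <= P.
  apply: exprn_ege1; rewrite -[leLHS]mulr1; apply: ler_pM => //.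
  by have := @pi_ge2 R; lra.
have P0 : 0 < P by apply: lt_le_trans P1.
rewrite -(ler_pM2l P0); apply: le_trans rec _; rewrite [leRHS]mulrDr; apply: lerD.
  apply: le_trans band _; rewrite ler_peMl//.
  by rewrite addr_ge0// mulr_ge0// exprn_ge0.
by rewrite le_eqVlt; apply/orP; left; apply/eqP; ring.
Qed.

Definition n1 x := \sum_i `|x ord0 i|.

Lemma n1_ge0 x : 0 <= n1 x. Proof. exact: sumr_ge0. Qed.

Lemma n1D x eta : n1 (x + eta) <= n1 x + n1 eta.
Proof. by rewrite /n1 -big_split; apply: ler_sum => i _; rewrite mxE ler_normD. Qed.

Lemma n1N x : n1 (- x) = n1 x.
Proof. by apply: eq_bigr => i _; rewrite mxE normrN. Qed.

Lemma n1_axis a i : n1 (a *: e i) = `|a|.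
Proof.
rewrite /n1 (bigD1 i)//= !mxE !eqxx /= mulr1 big1 ?addr0// => j ji.
by rewrite !mxE (negbTE ji) andbF mulr0 normr0.
Qed.

Lemma coord_le_n1 x i : `|x ord0 i| <= n1 x.
Proof. by rewrite /n1 (bigD1 i)//= lerDl sumr_ge0. Qed.

(** An exact way to say that multiplication by [h] averages the transform over translates of size at
    most [p] with total weight at most [1]. No constant is lost, so the property survives
    arbitrarily high powers: the radii add and the bound [M] stays. *)
Definition spreads (p : R) h := blip h /\ forall f M xi, cnice f ->
  (forall eta, n1 (eta - xi) <= p -> nc (fourier f eta) <= M) ->
  nc (fourier (fun x => f x * (h x)%:C%C) xi) <= M.

Lemma spreads1 : spreads 0 (fun=> 1).
Proof.
split=> [|f M xi nf H]; first exact: blip_cst.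
have -> : (fun x => f x * 1%:C%C) = f by apply/funext => x; rewrite mulr1.
by apply: H; rewrite subrr /n1 big1// => i _; rewrite mxE normr0.
Qed.

Lemma spreadsM p q h1 h2 : spreads p h1 -> spreads q h2 -> spreads (p + q) (fun x => h1 x * h2 x).
Proof.
move=> [b1 s1] [b2 s2]; split=> [|f M xi nf H]; first exact: blipM.
have -> : (fun x => f x * (h1 x * h2 x)%:C%C) = (fun x => f x * (h1 x)%:C%C * (h2 x)%:C%C).
  by apply/funext => x; rewrite rmorphM mulrA.
apply: s2; first exact: cnice_blip.
move=> eta etaq; apply: s1 => // z zp; apply: H.
have -> : z - xi = (z - eta) + (eta - xi) by rewrite addrA subrK.
by apply: le_trans (n1D _ _) _; exact: lerD.
Qed.

Lemma spreadsX p h K : spreads p h -> spreads (K%:R * p) (fun x => h x ^+ K).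
Proof.
move=> sh; elim: K => [|K IH].
  by rewrite mul0r; have := spreads1; congr spreads; apply/funext.
have := spreadsM sh IH; rewrite -natr1 mulrDl mul1r addrC; congr spreads.
by apply/funext => x; rewrite exprS.
Qed.

Lemma spreads_prod p (I : Type) (r : seq I) (F : I -> 'rV[R]_n -> R) :
  (forall i, spreads p (F i)) -> spreads ((size r)%:R * p) (fun x => \prod_(i <- r) F i x).
Proof.
move=> sF; elim: r => [|i r IH].
  by rewrite mul0r; have := spreads1; congr spreads; apply/funext => x; rewrite big_nil.
have := spreadsM (sF i) IH; rewrite /= -natr1 mulrDl mul1r addrC; congr spreads.
by apply/funext => x; rewrite big_cons.
Qed.

Definition cos_bump (c s t : R) : R := (1 + cos ((t - c) / s)) / 2.

Lemma cos_bump_ge0 (c0 s t : R) : 0 <= cos_bump c0 s t.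
Proof. by rewrite divr_ge0//; have := cos_geN1 ((t - c0) / s); lra. Qed.

Lemma cos_bump_le1 (c0 s t : R) : cos_bump c0 s t <= 1.
Proof. by rewrite ler_pdivrMr//; have := cos_le1 ((t - c0) / s); lra. Qed.

Lemma cos_bump_lip (c0 s a b : R) : 1 <= s -> `|cos_bump c0 s a - cos_bump c0 s b| <= `|a - b|.
Proof.
move=> s1; have s0 : 0 < s by lra.
have -> : cos_bump c0 s a - cos_bump c0 s b = (cos ((a - c0) / s) - cos ((b - c0) / s)) / 2.
  by rewrite /cos_bump; field.
rewrite normrM [`|2^-1|]ger0_norm ?invr_ge0// ler_pdivrMr//.
apply: le_trans (cos_lip _ _) _.
have -> : (a - c0) / s - (b - c0) / s = (a - b) / s by ring.
rewrite normrM normfV (gtr0_norm s0) ler_pdivrMr// -mulrA ler_peMr//; lra.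
Qed.

(** The bump is a constant plus two exponentials, with weights [1/2], [1/4], [1/4] that sum to [1];
    the exponentials translate by [1 / s] along the axis [i]. *)
Lemma spreads_cos_bump (c0 s : R) i : 1 <= s -> spreads s^-1 (fun x => cos_bump c0 s (x ord0 i)).
Proof.
move=> s1; have s0 : 0 < s by lra.
split.
  apply: (@blip_coord _ _ (cos_bump c0 s) i 1 1) => // [t|a b].
    by rewrite ger0_norm ?cos_bump_ge0 ?cos_bump_le1.
  by rewrite mul1r cos_bump_lip.
move=> f M xi nf H.
pose G (a : R) x := expi (dot x ((a / s) *: e i) + a * (- c0 / s)) * f x.
have nG a : cnice (G a) by exact: cnice_modulation.
have -> : (fun x => f x * (cos_bump c0 s (x ord0 i))%:C%C) =
   (fun x => (2^-1)%:C%C * f x + ((4^-1)%:C%C * G 1 x + (4^-1)%:C%C * G (-1) x)).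
  apply/funext => x; rewrite /G !dot_axis.
  have -> : 1 / s * x ord0 i + 1 * (- c0 / s) = (x ord0 i - c0) / s by ring.
  have -> : -1 / s * x ord0 i + -1 * (- c0 / s) = - ((x ord0 i - c0) / s) by ring.
  rewrite !mulrA -!mulrDl mulrC; congr (_ * _).
  rewrite /cos_bump; set t := (_ - _) / s.
  by apply: complex_eq; rewrite !(ReD, ImD, ReM, ImM) /= ?cosN ?sinN; field.
rewrite fourierD; [|exact: cniceZ|by apply: cniceD; exact: cniceZ].
rewrite fourierD; [|exact: cniceZ|exact: cniceZ].
rewrite !fourierZ//.
have HG a : `|a| = 1 -> nc (fourier (G a) xi) <= M.
  move=> a1; rewrite nc_fourier_modulation//; apply: H.
  by rewrite addrAC subrr add0r n1N n1_axis normrM a1 mul1r normfV gtr0_norm.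
have H0 : nc (fourier f xi) <= M.
  by apply: H; rewrite subrr /n1 big1 ?invr_ge0 ?ltW// => j _; rewrite mxE normr0.
have H1 := HG 1 (normr1 _); have HN1 := HG (-1) (normrN1 _).
apply: le_trans (le_normcD _ _) _.
have := le_normcD ((4^-1)%:C%C * fourier (G 1) xi) ((4^-1)%:C%C * fourier (G (-1)) xi).
rewrite !ComplexField.Normc.normcM !nc_real !ger0_norm ?invr_ge0//.
lra.
Qed.

Definition cos_kernel K s c x : R := \prod_(i < n) cos_bump (c ord0 i) s (x ord0 i) ^+ K.

Lemma spreads_cos_kernel K s c : 1 <= s ->
  spreads (n%:R * (K%:R / s)) (cos_kernel K s c).
Proof.
move=> s1; have := @spreads_prod (K%:R / s) _ (index_enum 'I_n)
  (fun i x => cos_bump (c ord0 i) s (x ord0 i) ^+ K).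
have -> : size (index_enum 'I_n) = n by rewrite -sum1_size sum_nat_const card_ord muln1.
by apply => i; apply: spreadsX; exact: spreads_cos_bump.
Qed.

Lemma cos_kernel_ge0 K s c x : 0 <= cos_kernel K s c x.
Proof. by apply: prodr_ge0 => i _; rewrite exprn_ge0// cos_bump_ge0. Qed.

Lemma cos_kernel_le1 K s c x : cos_kernel K s c x <= 1.
Proof.
apply: prodr_ile1 => i _.
by rewrite exprn_ge0 ?cos_bump_ge0// exprn_ile1 ?cos_bump_ge0 ?cos_bump_le1.
Qed.

Lemma cos_kernel_center K s c : cos_kernel K s c c = 1.
Proof.
rewrite /cos_kernel big1// => i _; rewrite /cos_bump subrr mul0r cos0.
by rewrite divff ?expr1n// -natr1 gt_eqF.
Qed.

Lemma expr_lip (a b : R) K : 0 <= a <= 1 -> 0 <= b <= 1 ->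
  `|a ^+ K - b ^+ K| <= K%:R * `|a - b|.
Proof.
move=> /andP[a0 a1] /andP[b0 b1]; elim: K => [|K IH]; first by rewrite subrr normr0 mul0r.
rewrite !exprS; have -> : a * a ^+ K - b * b ^+ K = a * (a ^+ K - b ^+ K) + (a - b) * b ^+ K by ring.
apply: le_trans (ler_normD _ _) _; rewrite -natr1 [leRHS]mulrDl mul1r !normrM; apply: lerD.
  by rewrite ger0_norm//; apply: le_trans IH; rewrite ler_piMl.
by rewrite ler_piMr// ger0_norm ?exprn_ge0// exprn_ile1.
Qed.

Lemma cos_kernel_lip K s c x i (h : R) : 1 <= s ->
  `|cos_kernel K s c (x + h *: e i) - cos_kernel K s c x| <= K%:R * `|h|.
Proof.
move=> s1; rewrite /cos_kernel (bigD1 i)//= [X in _ - X](bigD1 i)//= shiftE eqxx mulr1.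
rewrite (eq_bigr (fun j => cos_bump (c ord0 j) s (x ord0 j) ^+ K)); last first.
  by move=> j ji; rewrite shiftE (negbTE ji) mulr0 addr0.
rewrite -mulrBl normrM; set P := \prod_(_ | _) _.
have P0 : 0 <= P by apply: prodr_ge0 => j _; rewrite exprn_ge0// cos_bump_ge0.
have P1 : P <= 1.
  apply: prodr_ile1 => j _.
  by rewrite exprn_ge0 ?cos_bump_ge0// exprn_ile1 ?cos_bump_ge0 ?cos_bump_le1.
rewrite (ger0_norm P0); apply: le_trans (ler_piMr _ P1) _ => //.
apply: le_trans (expr_lip _ _ _) _; rewrite ?cos_bump_ge0 ?cos_bump_le1//.
rewrite ler_wpM2l//; apply: le_trans (cos_bump_lip _ _ _ s1) _.
by rewrite addrC addKr.
Qed.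

(** Within half a period, [cos_le_sqr] bounds one bump by [1 - (r / s) ^ 2 / 16], hence by the
    exponential of the negative term; the other factors are at most [1]. *)
Lemma cos_kernel_decay K s c x i (r : R) : 1 <= s -> 0 <= r ->
  r <= `|x ord0 i - c ord0 i| -> `|x ord0 i - c ord0 i| <= pi * s ->
  cos_kernel K s c x <= expR (- (K%:R * (r / s) ^+ 2 / 16)).
Proof.
move=> s1 r0 rx xs; have s0 : 0 < s by lra.
have F0 j : 0 <= cos_bump (c ord0 j) s (x ord0 j) ^+ K by rewrite exprn_ge0// cos_bump_ge0.
have F1 j : cos_bump (c ord0 j) s (x ord0 j) ^+ K <= 1.
  by rewrite exprn_ile1 ?cos_bump_ge0 ?cos_bump_le1.
rewrite /cos_kernel (bigD1 i)//=.
apply: (@le_trans _ _ (cos_bump (c ord0 i) s (x ord0 i) ^+ K)).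
  by rewrite ler_piMr// prodr_ile1// => j _; rewrite F0 F1.
have -> : - (K%:R * (r / s) ^+ 2 / 16) = K%:R * - ((r / s) ^+ 2 / 16) by ring.
rewrite expRM_natl lerXn2r ?nnegrE ?cos_bump_ge0 ?expR_ge0//.
apply: le_trans (expR_ge1Dx _).
set t := (x ord0 i - c ord0 i) / s.
have tE : `|t| = `|x ord0 i - c ord0 i| / s by rewrite /t normrM normfV (gtr0_norm s0).
have tpi : `|t| <= pi by rewrite tE ler_pdivrMr.
have := cos_le_sqr tpi.
have : (r / s) ^+ 2 <= t ^+ 2.
  rewrite -(real_normK (num_real t)) lerXn2r ?nnegrE ?divr_ge0 ?(ltW s0)//.
  by rewrite tE ler_pM2r ?invr_gt0.
rewrite /cos_bump -/t; lra.
Qed.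

End Lattice.

(** * Powers of rho, saturation and overspill *)

Section SmallEps.
Variable R : realType.
Implicit Types (e : eps R) (a b : R).

Definition pw e a : R := (val e) `^ a.

Lemma eps_gt0 e : 0 < val e. Proof. by have /andP[] := valP e. Qed.
Lemma eps_le1 e : val e <= 1. Proof. by have /andP[] := valP e. Qed.

Lemma near_small (r : R) : 0 < r -> \forall e \near small R, val e <= r.
Proof. by move=> r0; exists r. Qed.

Lemma pw_gt0 e a : 0 < pw e a. Proof. exact/powR_gt0/eps_gt0. Qed.
Lemma pw_ge0 e a : 0 <= pw e a. Proof. exact/ltW/pw_gt0. Qed.

Lemma pwD e a b : pw e (a + b) = pw e a * pw e b.
Proof. by rewrite /pw powRD// (gt_eqF (eps_gt0 e)) implybT. Qed.

Lemma pwN e a : pw e (- a) = (pw e a)^-1.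
Proof. exact: powRN. Qed.

Lemma pw0 e : pw e 0 = 1. Proof. exact: powRr0. Qed.

Lemma pwX e a k : pw e a ^+ k = pw e (k%:R * a).
Proof.
elim: k => [|k IH]; first by rewrite mul0r pw0.
by rewrite exprS IH -pwD -natr1 mulrDl mul1r addrC.
Qed.

Lemma pw_le e a b : b <= a -> pw e a <= pw e b.
Proof. by move=> ba; apply: ger_powR => //; rewrite eps_gt0 eps_le1. Qed.

Lemma pw_le1 e a : 0 <= a -> pw e a <= 1.
Proof. by move=> a0; rewrite -(pw0 e) pw_le. Qed.

Lemma pw_ge1 e a : a <= 0 -> 1 <= pw e a.
Proof. by move=> a0; rewrite -(pw0 e) pw_le. Qed.

Lemma near_pw_le (a r : R) : 0 < a -> 0 < r -> \forall e \near small R, pw e a <= r.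
Proof.
move=> a0 r0; have r1 : 0 < r `^ a^-1 by exact: powR_gt0.
apply: filterS (near_small r1) => e er.
have -> : r = (r `^ a^-1) `^ a by rewrite -powRrM mulVf ?gt_eqF// powRr1// ltW.
by apply: ge0_ler_powR => //; rewrite ?nnegrE ?(ltW (eps_gt0 e)) ?ltW.
Qed.

(** Constants are absorbed by an arbitrarily small loss in the exponent; this is why later estimates
    carry integer slack such as [n + 1] and [n + 2]. *)
Lemma near_pw_mul (M a b : R) : b < a -> \forall e \near small R, M * pw e a <= pw e b.
Proof.
move=> ba; have ab0 : 0 < a - b by rewrite subr_gt0.
have M0 : 0 < (`|M| + 1)^-1 by rewrite invr_gt0 ltr_pwDr.
apply: filterS (near_pw_le ab0 M0) => e h.
rewrite -(subrK b a) pwD mulrA ler_piMl ?pw_ge0//.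
apply: (@le_trans _ _ ((`|M| + 1) * pw e (a - b))).
  by rewrite ler_wpM2r ?pw_ge0// (le_trans (ler_norm _))// lerDl.
by rewrite -ler_pdivlMl ?ltr_pwDr// mulr1.
Qed.

Lemma near_pw_ge (M a : R) : a < 0 -> \forall e \near small R, M <= pw e a.
Proof.
by move=> a0; apply: filterS (near_pw_mul M a0) => e; rewrite pw0 mulr1.
Qed.

End SmallEps.

Section Saturation.
Variable R : realType.
Implicit Types (e : eps R).

(** For each [e] a point violating [Q] is chosen if there is one. The resulting net satisfies [B],
    hence [Q] for small [e], so at those [e] no violation existed. *)
Lemma near_forall_net (T : Type) (B Q : eps R -> T -> Prop) :
  (\forall e \near small R, exists x, B e x) ->
  (forall x : eps R -> T, (\forall e \near small R, B e (x e)) ->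
     \forall e \near small R, Q e (x e)) ->
  \forall e \near small R, forall x, B e x -> Q e x.
Proof.
move=> B0 H.
have [t0 _] : exists t : T, True by have [e [x _]] := filter_ex B0; exists x.
have ch e : exists x, ((exists x, B e x) -> B e x) /\ (~ (forall x, B e x -> Q e x) -> ~ Q e x).
  have [h|/existsNP[x /not_implyP[Bx Qx]]] := pselect (forall x, B e x -> Q e x).
    have [[x Bx]|nB] := pselect (exists x, B e x); first by exists x.
    by exists t0.
  by exists x.
have [x xP] := choice ch.
have : \forall e \near small R, B e (x e) by apply: filterS B0 => e /(xP e).1.
move=> /H h; apply: filterS h => e Qx.
by have [//|nf] := pselect (forall y, B e y -> Q e y); case: ((xP e).2 nf Qx).
Qed.

(** The exponent of [2] in [k] takes each value infinitely often. A single injective sequence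
    tending to [0] thus meets every [F n] at arbitrarily small parameters. *)
Lemma shrinking_sequence (F : nat -> eps R -> Prop) :
  (forall n, ~ \forall e \near small R, ~ F n e) ->
  exists s : nat -> eps R, [/\ injective s,
    (forall k, val (s k) <= (2^-1) ^+ k) &
    forall k, F (logn 2 k) (s k)].
Proof.
move=> HF.
have G (q : nat * R) : exists e : eps R, 0 < q.2 -> val e <= q.2 /\ F q.1 e.
  have [q0|q0] := pselect (0 < q.2); last first.
    by have [e _] := filter_ex (near_small (@ltr01 R)); exists e.
  have [//|h] := pselect (exists e, val e <= q.2 /\ F q.1 e); first by move=> [e ?]; exists e.
  by exfalso; apply: (HF q.1); exists q.2 => // e eq Fe; apply: h; exists e.
have [g gP] := choice G.
pose s := fix s k := match k with 0 => g (logn 2 0, 1)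
  | k'.+1 => g (logn 2 k'.+1, val (s k') / 2) end.
have sS k : s k.+1 = g (logn 2 k.+1, val (s k) / 2) by [].
have h2 k : 0 < val (s k) / 2 by rewrite divr_gt0 ?eps_gt0.
have sH k : val (s k.+1) <= val (s k) / 2 by rewrite sS; have [] := gP (logn 2 k.+1, _) (h2 k).
have slt j k : (j < k)%N -> val (s k) < val (s j).
  elim: k => // k IH; rewrite ltnS leq_eqVlt => jk; apply: le_lt_trans (sH k) _.
  have sk : val (s k) / 2 < val (s k) by have := eps_gt0 (s k); lra.
  by move: jk => /orP[/eqP ->//|/IH]; exact: lt_trans.
exists s; split.
- move=> j k E; have [jk|kj|//] := ltngtP j k.
    by have := slt _ _ jk; rewrite E ltxx.
  by have := slt _ _ kj; rewrite E ltxx.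
- elim => [|k IH]; first by rewrite expr0 eps_le1.
  by apply: le_trans (sH k) _; rewrite exprSr ler_pM2r ?invr_gt0.
- by case=> [|k]; [have [] := gP (logn 2 0, 1) ltr01|have [] := gP (logn 2 k.+1, _) (h2 k)].
Qed.

(** If every [n] failed, a single net could collect failures of each [n] at arbitrarily small
    parameters, and no [n] would suit that net. Each [n] has to recur because the conditions [Q n]
    may be unrelated to one another, as in [ModInfty_uniform]. *)
Lemma diagonal_net (T : Type) (B : eps R -> T -> Prop) (Q : nat -> eps R -> T -> Prop) :
  (\forall e \near small R, exists x, B e x) ->
  (forall x : eps R -> T, (\forall e \near small R, B e (x e)) ->
     exists n, \forall e \near small R, Q n e (x e)) ->
  exists n, \forall e \near small R, forall x, B e x -> Q n e x.
Proof.
move=> B0 H; apply: contrapT => nH.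
pose F n e := exists2 x, B e x & ~ Q n e x.
have HF n : ~ \forall e \near small R, ~ F n e.
  move=> h; apply: nH; exists n; apply: filterS h => e nF x Bx.
  by apply: contrapT => nQ; apply: nF; exists x.
have [s [sinj sle sF]] := shrinking_sequence HF.
have [t0 _] : exists t : T, True by have [e [x _]] := filter_ex B0; exists x.
have ch e : exists x, ((exists x, B e x) -> B e x) /\
    forall k, e = s k -> ~ Q (logn 2 k) e x.
  have [[k ek]|nk] := pselect (exists k, e = s k).
    have [x Bx nQ] := sF k; exists x; rewrite ek; split => // j /sinj <-//.
  have [[x Bx]|nB] := pselect (exists x, B e x).
    by exists x; split => // k ek; case: nk; exists k.
  by exists t0; split => // k ek; case: nk; exists k.
have [x xP] := choice ch.
have : \forall e \near small R, B e (x e) by apply: filterS B0 => e /(xP e).1.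
move=> /H[n [eta eta0 hQ]].
have [j jeta] : exists j : nat, (2^-1 : R) ^+ j <= eta.
  exists (Num.Def.archi_bound eta^-1); have := Num.Theory.upper_nthrootP (leqnn (Num.Def.archi_bound eta^-1)).
  by rewrite exprVn => h; rewrite invf_ple ?posrE ?exprn_gt0//; exact: ltW.
(* This index codes the condition [Q n], as its odd part does not affect [logn 2], and it is at
   least [j], so that [s k] lies below [eta]. *)
pose k := (2 ^ n * (2 * j + 1))%N.
have kn : logn 2 k = n.
  rewrite /k lognM ?expn_gt0 ?addn1// pfactorK// logn_coprime ?addn0//.
  by rewrite coprime2n /= mul2n odd_double.
have sk : val (s k) <= eta.
  apply: le_trans (sle k) _; apply: le_trans jeta.
  apply: ler_wiXn2l => //; rewrite ?invr_ge0// ?invf_le1 ?ler1n//.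
  rewrite /k; have : (0 < 2 ^ n)%N by rewrite expn_gt0.
  nia.
by have := hQ _ sk; rewrite -{1}kn; exact: (xP (s k)).2.
Qed.

(** [m e] is the largest number up to the cap [b e ~ 1 / e] below which all [P k e] hold. The cap
    makes the maximum exist; it tends to infinity, so it does not prevent [m] from being
    infinite. *)
Lemma overspill (P : nat -> eps R -> Prop) :
  (forall k, \forall e \near small R, P k e) ->
  exists m : eps R -> nat, (\forall e \near small R, forall k, (k <= m e)%N -> P k e) /\
    forall M, \forall e \near small R, (M <= m e)%N.
Proof.
move=> HP.
pose b e := Num.truncn (val e)^-1.
have ch e : exists m, (P 0 e -> forall k, (k <= m)%N -> P k e) /\
    forall M, (M <= b e)%N -> (forall k, (k <= M)%N -> P k e) -> (M <= m)%N.
  move: (b e) => N; elim: N => [|N [m [m1 m2]]].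
    exists 0 => //; split => [P0 k|M]; by rewrite leqn0 => /eqP ->.
  have [h|h] := pselect (forall k, (k <= N.+1)%N -> P k e).
    by exists N.+1; split => // _; exact: h.
  exists m; split => // M; rewrite leq_eqVlt => /orP[/eqP -> //|]; exact: m2.
have [m mP] := choice ch; exists m; split.
  by apply: filterS (HP 0) => e /(mP e).1.
move=> M.
have hM : \forall e \near small R, forall k : 'I_M.+1, P k e.
  by apply: filter_forall => k; exact: HP.
have hb : \forall e \near small R, (M <= b e)%N.
  have M0 : 0 < (M%:R + 1 : R)^-1 by rewrite invr_gt0 ltr_wpDl.
  apply: filterS (near_small M0) => e eM.
  rewrite /b Num.Theory.truncn_ge_nat ?invr_ge0 ?(ltW (eps_gt0 e))//.
  apply: (@le_trans _ _ (M%:R + 1)); first by rewrite lerDl.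
  by rewrite -[leLHS]invrK lef_pV2 ?posrE ?eps_gt0.
apply: filterS2 hM hb => e h1 h2; apply: (mP e).2 => // k kM.
by have := h1 (Ordinal (kM : (k < M.+1)%N)).
Qed.

End Saturation.

Section Norms.
Variables (R : realType) (d : nat).
Implicit Types (x y : 'rV[R]_d).

Lemma enorm_ge0 x : 0 <= enorm x. Proof. exact: sqrtr_ge0. Qed.

Lemma dot_ge0 x : 0 <= dot x x.
Proof. by apply: sumr_ge0 => i _; rewrite -expr2 sqr_ge0. Qed.

Lemma enorm_sqr x : enorm x ^+ 2 = \sum_i x ord0 i ^+ 2.
Proof. by rewrite sqr_sqrtr ?dot_ge0//; apply: eq_bigr => i _; rewrite expr2. Qed.

Lemma enorm_le_n1 x : enorm x <= n1 x.
Proof.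
rewrite -(@ler_pXn2r _ 2)// ?nnegrE ?enorm_ge0 ?n1_ge0// enorm_sqr expr2.
rewrite {1}/n1 mulr_suml; apply: ler_sum => i _.
by rewrite -(real_normK (num_real _)) expr2 ler_wpM2l// coord_le_n1.
Qed.

Lemma coord_le_enorm x i : `|x ord0 i| <= enorm x.
Proof.
rewrite -(@ler_pXn2r _ 2)// ?nnegrE ?enorm_ge0// enorm_sqr (real_normK (num_real _)).
by rewrite (bigD1 i)//= lerDl sumr_ge0// => j _; rewrite sqr_ge0.
Qed.

Lemma n1_le_enorm x : n1 x <= d%:R * enorm x.
Proof.
apply: (@le_trans _ _ (\sum_(i < d) enorm x)).
  by apply: ler_sum => i _; exact: coord_le_enorm.
by rewrite sumr_const card_ord mulr_natl.
Qed.

Lemma enormZ (a : R) x : enorm (a *: x) = `|a| * enorm x.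
Proof.
rewrite /enorm -sqrtr_sqr -sqrtrM ?sqr_ge0//; congr Num.sqrt.
by rewrite /dot mulr_sumr; apply: eq_bigr => i _; rewrite !mxE; ring.
Qed.

Lemma enorm_sub_n1 x y : `|enorm x - enorm y| <= n1 (x - y).
Proof.
have [s0|s0] := eqVneq (enorm x + enorm y) 0.
  have := enorm_ge0 x; have := enorm_ge0 y; move: s0 => /eqP.
  rewrite addr_eq0 => /eqP E y0 x0.
  have -> : enorm y = 0 by lra.
  have -> : enorm x = 0 by lra.
  by rewrite subrr normr0 n1_ge0.
have S0 : 0 < enorm x + enorm y by rewrite lt_neqAle eq_sym s0 addr_ge0 ?enorm_ge0.
rewrite -(ler_pM2r S0) -{1}(gtr0_norm S0) -normrM.
have -> : (enorm x - enorm y) * (enorm x + enorm y) =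
    \sum_i (x ord0 i - y ord0 i) * (x ord0 i + y ord0 i).
  by rewrite -subr_sqr !enorm_sqr -sumrB; apply: eq_bigr => i _; rewrite subr_sqr.
apply: le_trans (ler_norm_sum _ _ _) _; rewrite /n1 mulr_suml; apply: ler_sum => i _.
rewrite normrM !mxE ler_wpM2l//; apply: le_trans (ler_normD _ _) _.
by apply: lerD; exact: coord_le_enorm.
Qed.

End Norms.

(** * From generalized points and functions to estimates on representatives *)

Section Unwind.
Variable R : realType.

Lemma star_rel_cls (T U : Type) (r : T -> U -> Prop) (f : eps R -> T) (g : eps R -> U) :
  star_rel r (cls f) (cls g) <-> \forall e \near small R, r (f e) (g e).
Proof.
split=> h.
  by apply: filterS3 h (rep_cls f) (rep_cls g) => e h E1 E2; move: h; rewrite E1 E2.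
by apply: filterS3 h (rep_cls f) (rep_cls g) => e h -> ->.
Qed.

Lemma rho_powE (a : R) : rho_pow a = cls (fun e => pw e a).
Proof. by apply/clsP; apply: filterS (rep_cls (fun e : eps R => val e)) => e; rewrite /rho => ->. Qed.

Variable d : nat.
Local Notation Rd := 'rV[R]_d.
Local Notation sRd := (star R 'rV[R]_d).
Local Notation sFun := (star R ('rV[R]_d -> R[i])).
Local Notation nc := (@ComplexField.Normc.normc R).
Implicit Types (x : sRd) (u v : sFun).

Lemma sapp_mapE (F : (Rd -> R[i]) -> Rd -> R[i]) u x :
  sapp (star_map F u) x = cls (fun e => F (rep u e) (rep x e)).
Proof.
by apply/clsP; apply: filterS (rep_cls (fun e => F (rep u e))) => e; rewrite /star_map => ->.
Qed.

Lemma cnorm_cls (z : eps R -> R[i]) : cnorm (cls z) = cls (fun e => nc (z e)).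
Proof. by apply/clsP; apply: filterS (rep_cls z) => e ->. Qed.

Lemma sle_map_pow (F : (Rd -> R[i]) -> Rd -> R[i]) u x a :
  sle (cnorm (sapp (star_map F u) x)) (rho_pow a) <->
  \forall e \near small R, nc (F (rep u e) (rep x e)) <= pw e a.
Proof. by rewrite sapp_mapE cnorm_cls rho_powE; exact: star_rel_cls. Qed.

Lemma sle_map_pow_cls (F : (Rd -> R[i]) -> Rd -> R[i]) u (x : eps R -> Rd) a :
  sle (cnorm (sapp (star_map F u) (cls x))) (rho_pow a) <->
  \forall e \near small R, nc (F (rep u e) (x e)) <= pw e a.
Proof.
split=> [/sle_map_pow h|h]; [|apply/sle_map_pow].
  by apply: filterS2 h (rep_cls x) => e h E; rewrite E in h.
by apply: filterS2 h (rep_cls x) => e h ->.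
Qed.

Lemma sapp_eq u v x : sapp u x = sapp v x <->
  \forall e \near small R, rep u e (rep x e) = rep v e (rep x e).
Proof. exact: clsP. Qed.

Lemma sdist_pow x y a : sle (sdist x y) (rho_pow a) <->
  \forall e \near small R, enorm (rep x e - rep y e) <= pw e a.
Proof. by rewrite rho_powE; exact: star_rel_cls. Qed.

Lemma snorm_pow x a : sle (rho_pow a) (snorm x) <->
  \forall e \near small R, pw e a <= enorm (rep x e).
Proof. by rewrite rho_powE; exact: star_rel_cls. Qed.

Lemma slt0_sdist x y : slt (cst_star R (0 : R)) (sdist x y) <->
  \forall e \near small R, 0 < enorm (rep x e - rep y e).
Proof. exact: star_rel_cls. Qed.

Lemma sle_sdist x y (r : star R R) : sle (sdist x y) r <->
  \forall e \near small R, enorm (rep x e - rep y e) <= rep r e.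
Proof. by rewrite -{1}(repK r); exact: star_rel_cls. Qed.

Lemma slow_nonneg (r : star R R) a : slt (cst_star R (0 : R)) r -> slow_infinitesimal r -> 0 < a ->
  \forall e \near small R, pw e a <= rep r e <= a.
Proof.
move=> r0 rs a0; have [] := rs _ a0; rewrite rho_powE /sle /sabs /star_map /cst_star => /star_rel_cls h1 /star_rel_cls h2.
have /star_rel_cls h3 : star_rel (fun a b : R => a < b) (cls (fun=> 0)) (cls (rep r)) by rewrite repK.
apply: filterS3 h1 h2 h3 => e h1 h2 h3.
by move: h1 h2; rewrite (gtr0_norm h3) => -> ->.
Qed.

Lemma compact_n1_bounded (K : set Rd) : compact K -> exists L, forall x : Rd, K x -> n1 x <= L.
Proof.
move=> cK; have [[y Ky]|K0] := pselect (exists y, K y); last first.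
  by exists 0 => x Kx; case: K0; exists x.
have HK i : exists L, forall x : Rd, K x -> `|x ord0 i| <= L.
  have cn : continuous (fun x : Rd => `|x ord0 i|).
    move=> x; apply: (@continuous_comp _ _ _ (fun y : Rd => y ord0 i) Num.norm).
      exact: coord_continuous.
    exact: norm_continuous.
  have [|c _ cM] := EVT_max_rV _ cK (continuous_subspaceT cn); first by exists y.
  by exists (`|c ord0 i|) => x Kx; apply: cM; rewrite inE.
have [L HL] := choice HK.
by exists (\sum_i L i) => x Kx; apply: ler_sum => i _; exact: HL.
Qed.

Lemma compact_points_bounded Omega x : compact_points Omega x ->
  exists L, \forall e \near small R, n1 (rep x e) <= L.
Proof.
move=> [K [cK _ _ xK]]; have [L KL] := compact_n1_bounded cK.
by exists L; apply: filterS xK => e; exact: KL.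
Qed.

Lemma exists_n1_gt (hd : (0 < d)%N) (L : R) : exists x : Rd, L < n1 x.
Proof.
exists ((`|L| + 1) *: delta_mx ord0 (Ordinal hd)); rewrite n1_axis.
by rewrite gtr0_norm ?ltr_pwDr//; have := ler_norm L; lra.
Qed.

(** Every point of the internal support is bounded by a real number of its own, and [diagonal_net]
    makes one integer serve for all of them. A net beyond that bound has positive distance from each
    point of the support, so [v] vanishes along it. *)
Lemma support_boxed (hd : (0 < d)%N) Omega v : compactly_supported_in (compact_points Omega) v ->
  exists2 L, 0 <= L & \forall e \near small R, boxed L (rep v e).
Proof.
move=> [S [[K Knear ->] SO v0]].
have K0 : \forall e \near small R, exists x : Rd, K e x.
  by apply: filterS Knear => e [_ [x Kx]]; exists x.
have [L0 KL] : exists L0 : nat, \forall e \near small R, forall x : Rd, K e x -> n1 x <= L0%:R.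
  apply: (diagonal_net K0 (Q := fun k e (x : Rd) => n1 x <= k%:R)) => x xK.
  have : compact_points Omega (cls x).
    by apply: SO; apply: filterS2 xK (rep_cls x) => e Kx ->.
  move=> /compact_points_bounded[L hL].
  exists (Num.Def.archi_bound `|L|); apply: filterS2 hL (rep_cls x) => e h E.
  rewrite -E; apply: le_trans h _; apply: le_trans (ler_norm L) _.
  exact/ltW/Num.Theory.archi_boundP.
exists L0%:R => //.
have : \forall e \near small R, forall x : Rd, L0%:R < n1 x -> rep v e x = 0.
  apply: (near_forall_net (B := fun e (x : Rd) => L0%:R < n1 x)).
    by apply: nearW => e; exact: exists_n1_gt.
  move=> x xL.
  have /clsP h : sapp v (cls x) = cst_star R (0 : R[i]).
    apply: v0 => a Sa; apply/slt0_sdist.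
    near=> e; rewrite lt_neqAle enorm_ge0 andbT eq_sym; apply/eqP => E.
    have hK : n1 (rep a e) <= L0%:R.
      by near: e; apply: filterS2 KL Sa => e; apply.
    have xa : L0%:R < n1 (rep (cls x) e) by near: e; apply: filterS2 xL (rep_cls x) => e h ->.
    have : n1 (rep (cls x) e - rep a e) <= 0.
      by apply: le_trans (n1_le_enorm _) _; rewrite E mulr0.
    have := n1D (rep (cls x) e - rep a e) (rep a e); rewrite subrK; lra.
  by apply: filterS2 h (rep_cls x) => e h E; move: h; rewrite E.
move=> H; apply: filterS H => e h x i xi; apply: h; exact: lt_le_trans xi (coord_le_n1 _ _).
Unshelve. all: by end_near. Qed.

(** Moderateness is assumed at all generalized points, infinitely large ones included, so saturation
    gives one exponent valid on the whole space. *)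
Lemma moderate_uniform u al :
  (forall x, moderate_star (sapp (sderiv al u) x)) ->
  exists N : nat, \forall e \near small R, forall x : Rd, nc (deriv_mi al (rep u e) x) <= pw e (- N%:R).
Proof.
move=> H.
have [|x _|N hN] := @diagonal_net R Rd (fun _ _ => True)
    (fun N e (x : Rd) => nc (deriv_mi al (rep u e) x) <= pw e (- N%:R)).
- by apply: nearW => e; exists 0.
- by have [N /sle_map_pow_cls h] := H (cls x); exists N.
- by exists N; apply: filterS hN => e h x; exact: h.
Qed.

Lemma fast_eq_uniform u v x0 (b : R) : 0 < b ->
  (forall x, fast_close x x0 -> sapp u x = sapp v x) ->
  \forall e \near small R, forall y : Rd, n1 (y - rep x0 e) <= pw e b -> rep u e y = rep v e y.
Proof.
move=> b0 H; apply: (near_forall_net (B := fun e y => n1 (y - rep x0 e) <= pw e b)).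
  apply: nearW => e; exists (rep x0 e); rewrite subrr /n1 big1 ?pw_ge0// => i _.
  by rewrite mxE normr0.
move=> x xb; have /H/sapp_eq h : fast_close (cls x) x0.
  exists b => //; apply/sdist_pow; apply: filterS2 xb (rep_cls x) => e h ->.
  exact: le_trans (enorm_le_n1 _) _.
by apply: filterS2 h (rep_cls x) => e h E; move: h; rewrite E.
Qed.

Lemma negligible_net v (xi0 : sRd) (xi : eps R -> Rd) (a b : R) : 0 < a -> 0 < b ->
  (forall x, fast_scale x -> fast_close (direction x) xi0 ->
      negligible_star (sapp (sfourier v) x)) ->
  (\forall e \near small R, pw e (- a) <= enorm (xi e)) ->
  (\forall e \near small R, enorm ((enorm (xi e))^-1 *: xi e - rep xi0 e) <= pw e b) ->
  forall k : nat, \forall e \near small R, nc (fourier (rep v e) (xi e)) <= pw e k%:R.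
Proof.
move=> a0 b0 H ha hb k.
have /H : fast_scale (cls xi).
  by exists a => //; apply/snorm_pow; apply: filterS2 ha (rep_cls xi) => e h ->.
move=> /(_ _ k)/sle_map_pow_cls; apply.
exists b => //; apply/sdist_pow; apply: filterS3 hb (rep_cls xi)
  (rep_cls (fun e => (enorm (rep (cls xi) e))^-1 *: rep (cls xi) e)) => e h E1 E2.
by rewrite /direction /star_map E2 E1.
Qed.

End Unwind.

(** * From microlocal regularity to slow scale regularity *)

Section Localization.
Variables (R : realType) (d : nat) (hd : (0 < d)%N).
Local Notation Rd := 'rV[R]_d.
Local Notation sRd := (star R 'rV[R]_d).
Local Notation sFun := (star R ('rV[R]_d -> R[i])).
Local Notation nc := (@ComplexField.Normc.normc R).
Implicit Types (u v : sFun) (e : eps R).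

(** The bound [exp (- x) <= k.+1! / x ^ k.+1] is used with [k.+1 * q > m]. *)
Lemma near_expR_decay (C q m : R) : 0 < C -> 0 < q ->
  \forall e \near small R, expR (- (C * pw e (- q))) <= pw e m.
Proof.
move=> C0 q0; pose k := Num.Def.archi_bound (`|m| / q).
have kq : m < k.+1%:R * q.
  apply: le_lt_trans (ler_norm m) _; rewrite -ltr_pdivrMr// -natr1.
  apply: lt_trans (Num.Theory.archi_boundP _) _; first by rewrite divr_ge0// ltW.
  by rewrite ltrDl.
have := near_pw_mul ((k.+1)`!%:R / C ^+ k.+1) kq.
apply: filterS => e h; apply: le_trans h.
have x0 : 0 < C * pw e (- q) by rewrite mulr_gt0// pw_gt0.
rewrite expRN; apply: (@le_trans _ _ ((C * pw e (- q)) ^+ k.+1 / (k.+1)`!%:R)^-1).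
  rewrite lef_pV2 ?posrE ?expR_gt0 ?divr_gt0 ?exprn_gt0 ?ltr0n ?fact_gt0//.
  by apply: le_trans (expR_ge1Dxn k (ltW x0)); rewrite lerDr.
rewrite invfM invrK exprMn invfM pwN exprVn invrK pwX le_eqVlt; apply/orP; left.
by apply/eqP; ring.
Qed.

Lemma partials_moderate v s : (forall al x, moderate_star (sapp (sderiv al v) x)) ->
  (\forall e \near small R, Cinfty (rep v e)) ->
  exists N : nat, \forall e \near small R, forall x : Rd, nc (partials s (rep v e) x) <= pw e (- N%:R).
Proof.
move=> mv cv; have [N hN] := moderate_uniform (mv (fun i => count_mem i s)).
by exists N; apply: filterS2 hN cv => e h c x; rewrite (partialsE s c).
Qed.

Lemma prod_le_n1 (s : seq 'I_d) (x : Rd) r : n1 x <= r -> \prod_(i <- s) `|x ord0 i| <= r ^+ size s.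
Proof.
move=> xr; elim: s => [|i s IH]; first by rewrite big_nil expr0.
rewrite big_cons /= exprS ler_pM// ?prodr_ge0//.
exact: le_trans (coord_le_n1 _ _) _.
Qed.

(** Normalization is Lipschitz away from the origin with a constant of order [1 / |x|]; this turns
    an absolute displacement of frequencies into an angular one. *)
Lemma direction_close (x y : Rd) : 0 < enorm x -> 0 < enorm y ->
  enorm ((enorm y)^-1 *: y - (enorm x)^-1 *: x) <= (d%:R + 1) * n1 (y - x) / enorm x.
Proof.
move=> x0 y0.
have -> : (enorm y)^-1 *: y - (enorm x)^-1 *: x =
   ((enorm x - enorm y) / (enorm x * enorm y)) *: y + (enorm x)^-1 *: (y - x).
  apply/rowP => i; rewrite !mxE; field.
  by rewrite !gt_eqF.
have n1Z (a : R) (z : Rd) : n1 (a *: z) = `|a| * n1 z.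
  by rewrite /n1 mulr_sumr; apply: eq_bigr => i _; rewrite mxE normrM.
apply: le_trans (enorm_le_n1 _) _; apply: le_trans (n1D _ _) _; rewrite !n1Z.
have -> : (d%:R + 1) * n1 (y - x) / enorm x = d%:R * n1 (y - x) / enorm x + n1 (y - x) / enorm x by ring.
apply: lerD; last first.
  by rewrite normfV (gtr0_norm x0) mulrC.
rewrite normrM normfV (gtr0_norm (mulr_gt0 x0 y0)) invfM.
have h1 : `|enorm x - enorm y| <= n1 (y - x) by rewrite -n1N opprB enorm_sub_n1.
have h2 := n1_le_enorm y.
apply: (@le_trans _ _ (n1 (y - x) * ((enorm x)^-1 * (enorm y)^-1) * (d%:R * enorm y))).
  by rewrite ler_pM ?mulr_ge0 ?n1_ge0 ?invr_ge0 ?(ltW x0) ?(ltW y0)// ler_wpM2r// mulr_ge0 ?invr_ge0 ?(ltW x0) ?(ltW y0).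
rewrite le_eqVlt; apply/orP; left; apply/eqP; field.
by rewrite !gt_eqF.
Qed.

Definition ceil_pw (a : R) e : nat := (Num.truncn (pw e (- a))).+1.

Lemma ceil_pw_ge a e : pw e (- a) <= (ceil_pw a e)%:R.
Proof. exact/ltW/Num.Theory.truncnS_gt. Qed.

Lemma ceil_pw_le a e : 0 <= a -> (ceil_pw a e)%:R <= 2 * pw e (- a).
Proof.
move=> a0; have h1 : 1 <= pw e (- a) by apply: pw_ge1; rewrite oppr_le0.
have /andP[h _] := Num.Theory.truncn_itv (pw_ge0 e (- a)).
by rewrite /ceil_pw -natr1 mulr2n mulrDl mul1r lerD.
Qed.

Definition scale_s (q : R) e : R := pw e (- q).
Definition scale_K (q : R) e : nat := ceil_pw (5 * q) e.

Lemma scale_s_ge1 q e : 0 < q -> 1 <= scale_s q e.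
Proof. by move=> q0; apply: pw_ge1; lra. Qed.

Lemma scale_KV q e : 0 < q -> (scale_K q e)%:R / scale_s q e <= 2 * pw e (- (4 * q)).
Proof.
move=> q0; rewrite ler_pdivrMr ?pw_gt0// -mulrA -pwD.
have -> : - (4 * q) + - q = - (5 * q) by ring.
by apply: ceil_pw_le; rewrite mulr_ge0// ltW.
Qed.

Lemma coord_open_n1 (c : Rd) (r : R) : coord_open [set y : Rd | n1 (y - c) < r].
Proof.
move=> x /= xr i; have h0 : 0 < r - n1 (x - c) by rewrite subr_gt0.
apply: filterS (near0_norm h0) => h hh /=.
rewrite addrAC; apply: le_lt_trans (n1D _ _) _; rewrite n1_axis; move: hh; lra.
Qed.

(* The cutoff is tiny off the ball of radius [rho^q], and [g] vanishes on it. *)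
Lemma cutoff_small (q L N m : R) (c : eps R -> Rd) (g : eps R -> Rd -> R[i]) : 0 < q ->
  (\forall e \near small R, boxed L (g e)) ->
  (\forall e \near small R, n1 (c e) <= L) ->
  (\forall e \near small R, forall y, nc (g e y) <= pw e (- N)) ->
  (\forall e \near small R, forall y, n1 (y - c e) < pw e q -> g e y = 0) ->
  \forall e \near small R, forall y,
    nc (g e y * (cos_kernel (scale_K q e) (scale_s q e) (c e) y)%:C%C) <= pw e m.
Proof.
move=> q0 hL hc hN h0.
have d0 : 0 < d%:R :> R by rewrite ltr0n.
have C0 : 0 < (16 * d%:R ^+ 2)^-1 :> R by rewrite invr_gt0 mulr_gt0 ?exprn_gt0.
near=> e => y.
have gL : boxed L (g e) by near: e.
have cL : n1 (c e) <= L by near: e.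
have gN z : nc (g e z) <= pw e (- N) by move: z; near: e.
have g0 z : n1 (z - c e) < pw e q -> g e z = 0 by move: z; near: e.
have hexp : expR (- ((16 * d%:R ^+ 2)^-1 * pw e (- q))) <= pw e (m + N).
  by near: e; exact: near_expR_decay.
have hs : L <= scale_s q e by near: e; apply: near_pw_ge; lra.
rewrite ComplexField.Normc.normcM nc_real (ger0_norm (cos_kernel_ge0 _ _ _ _)).
(* [g] vanishes near [c] and outside the box. In the remaining region some coordinate is at least
   [rho^q / d] away from that of [c], and the box lies within half a period, so the decay of the
   kernel applies. *)
have [yc|yc] := ltP (n1 (y - c e)) (pw e q).
  by rewrite (g0 _ yc) nc0 mul0r pw_ge0.
have [[i yi]|ny] := pselect (exists i, L < `|y ord0 i|).
  by rewrite (gL _ _ yi) nc0 mul0r pw_ge0.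
have [i yi] : exists i, pw e q / d%:R <= `|y ord0 i - c e ord0 i|.
  apply: contrapT => nh; have : n1 (y - c e) < pw e q; last by rewrite ltNge yc.
  apply: (@lt_le_trans _ _ (\sum_(i < d) pw e q / d%:R)); last first.
    by rewrite sumr_const card_ord -[leLHS]mulr_natr divfK// gt_eqF.
  have lt i : `|(y - c e) ord0 i| < pw e q / d%:R.
    by rewrite ltNge; apply/negP => h; apply: nh; exists i; move: h; rewrite !mxE.
  rewrite /n1 (bigD1 (Ordinal hd))//= [ltRHS](bigD1 (Ordinal hd))//=.
  by apply: ltr_leD => //; apply: ler_sum => i _; exact/ltW.
have yle j : `|y ord0 j| <= L by rewrite leNgt; apply/negP => h; apply: ny; exists j.
have s1 := scale_s_ge1 e q0.
have hpi : `|y ord0 i - c e ord0 i| <= pi * scale_s q e.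
  apply: le_trans (ler_normB _ _) _; have := yle i; have := coord_le_n1 (c e) i.
  have := @pi_ge2 R => p2; have : 2 * scale_s q e <= pi * scale_s q e by rewrite ler_wpM2r//; lra.
  move: hs cL; lra.
have r0 : 0 <= pw e q / d%:R by rewrite divr_ge0 ?pw_ge0.
have := cos_kernel_decay (scale_K q e) s1 r0 yi hpi.
set F := cos_kernel _ _ _ _ => hF.
have hF' : F <= pw e (m + N).
  apply: le_trans hF _; apply: le_trans hexp; rewrite ler_expR lerN2.
  (* The exponents add up to [- 5 q + 2 (q + q) = - q], so the exponential beats every power of
     [rho]. *)
  apply: (@le_trans _ _ (pw e (- (5 * q)) * (pw e q / d%:R / scale_s q e) ^+ 2 / 16)); last first.
    by rewrite ler_pM2r// ler_wpM2r ?sqr_ge0// ceil_pw_ge.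
  rewrite /scale_s pwN invrK.
  have -> : pw e (- (5 * q)) * (pw e q / d%:R * pw e q) ^+ 2 / 16 =
    (16 * d%:R ^+ 2)^-1 * (pw e (- (5 * q)) * (pw e q * pw e q * (pw e q * pw e q))).
    by field; rewrite gt_eqF.
  rewrite -!pwD -pwN ler_wpM2l ?(ltW C0)//; apply: pw_le; lra.
apply: (@le_trans _ _ (pw e (- N) * pw e (m + N))).
  by rewrite ler_pM ?nc_ge0 ?cos_kernel_ge0.
by rewrite -pwD; apply: pw_le; lra.
Unshelve. all: by end_near. Qed.

End Localization.

(** * Exchange of localizations and negligible transforms *)

Section Necessity.
Variables (R : realType) (d : nat) (hd : (0 < d)%N).
Local Notation Rd := 'rV[R]_d.
Local Notation sRd := (star R 'rV[R]_d).
Local Notation sFun := (star R ('rV[R]_d -> R[i])).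
Local Notation nc := (@ComplexField.Normc.normc R).
Implicit Types (u v : sFun) (e : eps R).

(** The derivatives become monomials in the frequency before the averaging, so they cost
    [r ^+ size s] and require no bound on derivatives of [f]. *)
Lemma spread_partials (f : Rd -> R[i]) L p (h : Rd -> R) (s : seq 'I_d) (r M : R) (xi : Rd) :
  Cinfty f -> boxed L f -> spreads p h -> 0 <= M ->
  (forall eta, n1 (eta - xi) <= p -> n1 eta <= r /\ nc (fourier f eta) <= M) ->
  nc (fourier (fun x => partials s f x * (h x)%:C%C) xi) <= r ^+ size s * M.
Proof.
move=> cf bf sh M0 H; apply: sh.2; first exact: smooth_cnice bf.
move=> eta /H[er eM]; rewrite (nc_fourier_partials _ _ cf bf).
by rewrite ler_pM ?nc_ge0 ?prodr_ge0// prod_le_n1.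
Qed.

Definition localizer (q : R) (c : eps R -> Rd) e : Rd -> R :=
  cos_kernel (scale_K q e) (scale_s q e) (c e).

Lemma localizer_spreads q c e : 0 < q ->
  spreads (d%:R * (2 * pw e (- (4 * q)))) (localizer q c e).
Proof.
move=> q0; have [b H] := spreads_cos_kernel (scale_K q e) (c e) (scale_s_ge1 e q0).
split => // f M xi nf HM; apply: H => // eta he; apply: HM; apply: le_trans he _.
by rewrite ler_wpM2l// scale_KV.
Qed.

Lemma ModC_moderate Omega v : ModC (compact_points Omega) v ->
  forall al x, moderate_star (sapp (sderiv al v) x).
Proof. by move=> [[_ H] _] al x; exact: H. Qed.

Lemma ModC_smooth Omega v : ModC (compact_points Omega) v ->
  \forall e \near small R, Cinfty (rep v e).
Proof. by move=> [[H _] _]. Qed.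

Lemma ModC_boxed Omega v : ModC (compact_points Omega) v ->
  exists2 L, 0 <= L & \forall e \near small R, boxed L (rep v e).
Proof. by move=> [_ H]; exact: support_boxed hd Omega v H. Qed.

(** Every [eta] in the ball has size at least [rho^(-4q)] and deviates from the direction of [xi] by
    at most a constant times [rho^q]; the exponent [q / 2] absorbs the constant. Thus the whole ball
    lies in the region where [v] is known to be negligible, and saturation makes this uniform. *)
Lemma fourier_negligible_near v (xi : eps R -> Rd) (q m : R) : 0 < q ->
  (forall x, fast_scale x ->
     fast_close (direction x) (cls (fun e => (enorm (xi e))^-1 *: xi e)) ->
     negligible_star (sapp (sfourier v) x)) ->
  (\forall e \near small R, pw e (- (5 * q)) <= n1 (xi e)) ->
  \forall e \near small R, forall eta : Rd,
    n1 (eta - xi e) <= d%:R * (2 * pw e (- (4 * q))) -> nc (fourier (rep v e) eta) <= pw e m.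
Proof.
move=> q0 H hxi; have d0 : 0 < d%:R :> R by rewrite ltr0n.
apply: near_forall_net.
  apply: nearW => e; exists (xi e); rewrite subrr /n1 big1 ?mulr_ge0 ?pw_ge0// => i _.
  by rewrite mxE normr0.
move=> eta heta.
have hx : \forall e \near small R, pw e (- (5 * q)) / d%:R <= enorm (xi e).
  apply: filterS hxi => e h; rewrite ler_pdivrMr// [leRHS]mulrC.
  by apply: le_trans h _; exact: n1_le_enorm.
have h1 : \forall e \near small R, pw e (- (4 * q)) <= enorm (eta e).
  near=> e.
  have a1 : n1 (eta e - xi e) <= d%:R * (2 * pw e (- (4 * q))) by near: e.
  have a2 : pw e (- (5 * q)) <= n1 (xi e) by near: e.
  have a3 : 3 * d%:R * pw e (- (4 * q)) <= pw e (- (5 * q)).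
    by near: e; apply: near_pw_mul; lra.
  have a4 := n1_le_enorm (eta e).
  have a5 := n1D (eta e) (xi e - eta e).
  rewrite subrKC -(n1N (xi e - eta e)) opprB in a5.
  rewrite -(ler_pM2l d0); apply: le_trans a4; move: a1 a2 a3 a5; lra.
have h2 : \forall e \near small R,
   enorm ((enorm (eta e))^-1 *: eta e - rep (cls (fun e => (enorm (xi e))^-1 *: xi e)) e) <= pw e (q / 2).
  near=> e.
  have -> : rep (cls (fun e => (enorm (xi e))^-1 *: xi e)) e = (enorm (xi e))^-1 *: xi e.
    by near: e; exact: rep_cls.
  have b1 : pw e (- (5 * q)) / d%:R <= enorm (xi e) by near: e.
  have b2 : pw e (- (4 * q)) <= enorm (eta e) by near: e.
  have b3 : n1 (eta e - xi e) <= d%:R * (2 * pw e (- (4 * q))) by near: e.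
  have b4 : (d%:R + 1) * (d%:R * 2) * d%:R * pw e q <= pw e (q / 2).
    by near: e; apply: near_pw_mul; lra.
  have x0 : 0 < enorm (xi e) by apply: lt_le_trans b1; rewrite divr_gt0// pw_gt0.
  have y0 : 0 < enorm (eta e) by apply: lt_le_trans b2; rewrite pw_gt0.
  apply: le_trans (direction_close x0 y0) _; apply: le_trans b4.
  rewrite ler_pdivrMr//.
  apply: (@le_trans _ _ ((d%:R + 1) * (d%:R * 2) * d%:R * pw e q * (pw e (- (5 * q)) / d%:R))); last first.
    by rewrite ler_wpM2l// !mulr_ge0 ?pw_ge0// addr_ge0.
  have -> : (d%:R + 1) * (d%:R * 2) * d%:R * pw e q * (pw e (- (5 * q)) / d%:R) =
     (d%:R + 1) * (d%:R * (2 * (pw e q * pw e (- (5 * q))))).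
    by field; rewrite gt_eqF.
  rewrite -pwD; have -> : q + - (5 * q) = - (4 * q) by ring.
  by rewrite ler_wpM2l// addr_ge0.
have q4 : 0 < 4 * q by lra.
have q2 : 0 < q / 2 by lra.
have := negligible_net q4 q2 H h1 h2 (Num.Def.archi_bound `|m|).
apply: filterS => e h; apply: le_trans h _; apply: pw_le.
apply: le_trans (ler_norm m) _; exact/ltW/Num.Theory.archi_boundP.
Unshelve. all: by end_near. Qed.

Variables (Omega : set Rd) (u : sFun) (x0 : sRd).
Hypothesis hx0 : compact_points Omega x0.
Hypothesis hreg : forall xi0, ssphere xi0 -> microregular Omega u x0 xi0.

Section Point.
Variables (v : sFun) (q a' : R) (c : eps R -> Rd).
Hypothesis hv : ModC (compact_points Omega) v.
Hypothesis huv : forall x, fast_close x x0 -> sapp u x = sapp v x.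
Hypotheses (q0 : 0 < q) (q1 : q <= 1) (a0 : 0 < a').
Hypothesis hc : \forall e \near small R, n1 (c e - rep x0 e) <= pw e a'.

(** An exponent [b] below both [q] and [a'] makes the ball of radius [rho^b] about [x0] contain the
    ball of radius [rho^q] about [c]. Equality on the latter, which is open along the axes, passes
    to derivatives. *)
Lemma near_center (w : sFun) s : (forall x, fast_close x x0 -> sapp u x = sapp w x) ->
  \forall e \near small R, forall y : Rd, n1 (y - c e) < pw e q ->
    partials s (rep u e) y = partials s (rep w e) y.
Proof.
move=> hw.
have [b [b0 bq ba]] : exists b, [/\ 0 < b, b < q & b < a'].
  move: q0 a0 => q0' a0'; have [h|h] := ltP q a'; first by exists (q / 2); split; lra.
  by exists (a' / 2); split; lra.
near=> e => y yc.
have H z : n1 (z - rep x0 e) <= pw e b -> rep u e z = rep w e z.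
  by move: z; near: e; exact: fast_eq_uniform.
apply: (partials_local s (@coord_open_n1 _ _ (c e) (pw e q))) => // z /= zc.
apply: H.
have h1 : n1 (c e - rep x0 e) <= pw e a' by near: e.
have h2 : 2 * pw e q <= pw e b by near: e; exact: near_pw_mul.
have h3 : 2 * pw e a' <= pw e b by near: e; exact: near_pw_mul.
have := n1D (z - c e) (c e - rep x0 e); rewrite addrA subrK; move: zc h1 h2 h3; lra.
Unshelve. all: by end_near. Qed.

Lemma center_bounded : exists L, \forall e \near small R, n1 (c e) <= L.
Proof.
have [L hL] := compact_points_bounded hx0; exists (L + 1).
near=> e.
have h1 : n1 (c e - rep x0 e) <= pw e a' by near: e.
have h2 : n1 (rep x0 e) <= L by near: e.
have h3 : pw e a' <= 1 by apply/pw_le1/ltW.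
have := n1D (c e - rep x0 e) (rep x0 e); rewrite subrK; move: h1 h2 h3; lra.
Unshelve. all: by end_near. Qed.

(** For a net [xi], regularity in its own direction supplies [v']. The localized derivative of [v]
    splits into that of [v - v'], pointwise tiny because both agree with [u] near [c], and that of
    [v'], an average of negligible values. Only [v] occurs in the conclusion, so a worst net [xi]
    may be chosen. The upper bound on [xi] keeps the monomials moderate. *)
Lemma localized_negligible s (n p : R) : 5 * q <= p ->
  \forall e \near small R, forall xi : Rd, pw e (- (5 * q)) <= n1 xi <= pw e (- p) ->
    nc (fourier (fun x => partials s (rep v e) x * (localizer q c e x)%:C%C) xi) <= pw e n.
Proof.
have q0' := q0; move=> qp; have d0 : 0 < d%:R :> R by rewrite ltr0n.
apply: (near_forall_net (B := fun e (xi : Rd) => pw e (- (5 * q)) <= n1 xi <= pw e (- p))).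
  apply: nearW => e; exists (pw e (- (5 * q)) *: delta_mx ord0 (Ordinal hd)).
  by rewrite n1_axis gtr0_norm ?pw_gt0// lexx pw_le// lerN2.
move=> xi hxi.
have hxi1 : \forall e \near small R, pw e (- (5 * q)) <= n1 (xi e).
  by apply: filterS hxi => e /andP[].
pose xi0 : sRd := cls (fun e => (enorm (xi e))^-1 *: xi e).
have Sxi0 : ssphere xi0.
  apply: filterS2 hxi1 (rep_cls (fun e => (enorm (xi e))^-1 *: xi e)) => e h E.
  rewrite /= E enormZ.
  have h0 : 0 < enorm (xi e).
    have := lt_le_trans (pw_gt0 e (- (5 * q))) (le_trans h (n1_le_enorm _)).
    by rewrite pmulr_rgt0.
  by rewrite normfV gtr0_norm// mulVf// gt_eqF.
have [v' [hv' huv' neg]] := hreg Sxi0.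
have cv := ModC_smooth hv; have cv' := ModC_smooth hv'.
have [L L0 bv] := ModC_boxed hv; have [L' L0' bv'] := ModC_boxed hv'.
have [N hN] := partials_moderate s (ModC_moderate hv) cv.
have [N' hN'] := partials_moderate s (ModC_moderate hv') cv'.
have [Lc hLc] := center_bounded.
(* The last term pays for the monomial, at most [rho^(-(p + 1))] per derivative; the [1] is slack
   for adding the two parts. *)
pose m := n + 1 + (p + 1) * (size s)%:R.
have hm := fourier_negligible_near m q0 neg hxi1.
pose g e (y : Rd) := partials s (rep v e) y - partials s (rep v' e) y.
pose LL := Num.max L (Num.max L' Lc).
have hsm := @cutoff_small R d hd q LL (N%:R + N'%:R + 1) (n + 2) c g q0.
have hg1 : \forall e \near small R, boxed LL (g e).
  apply: filterS2 bv bv' => e b1 b2 x i xi'.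
  rewrite /g (boxed_partials s b1 (i := i)) ?(boxed_partials s b2 (i := i)) ?subrr//.
    by apply: le_lt_trans xi'; rewrite /LL !le_max lexx !orbT.
  by apply: le_lt_trans xi'; rewrite /LL !le_max lexx.
have hg2 : \forall e \near small R, n1 (c e) <= LL.
  by apply: filterS hLc => e h; apply: le_trans h _; rewrite /LL !le_max lexx !orbT.
have hg3 : \forall e \near small R, forall y, nc (g e y) <= pw e (- (N%:R + N'%:R + 1)).
  near=> e => y; apply: le_trans (le_normcD _ _) _; rewrite normcN.
  have h1 : forall y, nc (partials s (rep v e) y) <= pw e (- N%:R) by near: e.
  have h2 : forall y, nc (partials s (rep v' e) y) <= pw e (- N'%:R) by near: e.
  move: {h1 h2} (h1 y) (h2 y) => h1 h2.
  have h3 : pw e (- N%:R) <= pw e (- (N%:R + N'%:R)) by apply: pw_le; rewrite lerN2 lerDl.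
  have h4 : pw e (- N'%:R) <= pw e (- (N%:R + N'%:R)) by apply: pw_le; rewrite lerN2 lerDr.
  have h5 : 2 * pw e (- (N%:R + N'%:R)) <= pw e (- (N%:R + N'%:R + 1)).
    by near: e; apply: near_pw_mul; lra.
  by move: h1 h2 h3 h4 h5; lra.
have hg4 : \forall e \near small R, forall y, n1 (y - c e) < pw e q -> g e y = 0.
  apply: filterS2 (near_center s huv) (near_center s huv') => e h1 h2 y yc.
  by rewrite /g -(h1 _ yc) -(h2 _ yc) subrr.
have {}hsm := hsm hg1 hg2 hg3 hg4.
near=> e.
have [cve cve'] : Cinfty (rep v e) /\ Cinfty (rep v' e).
  by near: e; apply: filterS2 cv cv' => e.
have bve : boxed L (rep v e) by near: e; exact: bv.
have bve' : boxed L' (rep v' e) by near: e; exact: bv'.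
have bge : boxed LL (g e) by near: e; exact: hg1.
have nv : cnice (partials s (rep v e)) by exact: smooth_cnice bve.
have nv' : cnice (partials s (rep v' e)) by exact: smooth_cnice bve'.
have sp := localizer_spreads c e q0.
have xie : n1 (xi e) <= pw e (- p) by near: e; apply: filterS hxi => e /andP[].
have r1 : pw e (- p) + d%:R * (2 * pw e (- (4 * q))) <= pw e (- (p + 1)).
  have i1 : 2 * pw e (- p) <= pw e (- (p + 1)) by near: e; apply: near_pw_mul; lra.
  have i2 : 4 * d%:R * pw e (- (4 * q)) <= pw e (- (p + 1)) by near: e; apply: near_pw_mul; lra.
  by move: i1 i2; lra.
have A1 : nc (fourier (fun x => partials s (rep v' e) x * (localizer q c e x)%:C%C) (xi e)) <=
    pw e (- (p + 1)) ^+ size s * pw e m.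
  apply: (spread_partials s cve' bve' sp (pw_ge0 _ _)) => eta he; split.
    have := n1D (eta - xi e) (xi e); rewrite subrK => h.
    by apply: le_trans h _; apply: le_trans r1; rewrite addrC lerD.
  by move: eta he; near: e.
rewrite pwX -pwD in A1.
have mE : (size s)%:R * - (p + 1) + m = n + 1 by rewrite /m; ring.
rewrite mE in A1.
have A2 : nc (fourier (fun x => g e x * (localizer q c e x)%:C%C) (xi e)) <= pw e (n + 1).
  have i1 : 2 * (2 * LL) ^+ d * pw e (n + 2) <= pw e (n + 1) by near: e; apply: near_pw_mul; lra.
  apply: le_trans i1; rewrite -mulrA; apply: fourier_bound.
  - by apply: cnice_blip; [apply: cniceB|exact: sp.1].
  - by rewrite /LL le_max L0.
  - by move=> y i yi; rewrite (bge _ _ yi) mul0r.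
  - by near: e.
have -> : (fun x => partials s (rep v e) x * (localizer q c e x)%:C%C) =
  (fun x => g e x * (localizer q c e x)%:C%C + partials s (rep v' e) x * (localizer q c e x)%:C%C).
  by apply/funext => x; rewrite -mulrDl /g subrK.
rewrite fourierD; [|by apply: cnice_blip; [apply: cniceB|exact: sp.1]|by apply: cnice_blip => //; exact: sp.1].
apply: le_trans (le_normcD _ _) _.
have i3 : 2 * pw e (n + 1) <= pw e n by near: e; apply: near_pw_mul; lra.
by apply: le_trans (lerD A2 A1) _; rewrite -mulr2n -mulr_natl.
Unshelve. all: by end_near. Qed.

End Point.
End Necessity.

(** * Pointwise bounds on derivatives from the bounded band *)

Section NecessityMain.
Variables (R : realType) (d : nat) (hd : (0 < d)%N).
Local Notation Rd := 'rV[R]_d.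
Local Notation sRd := (star R 'rV[R]_d).
Local Notation sFun := (star R ('rV[R]_d -> R[i])).
Local Notation nc := (@ComplexField.Normc.normc R).
Implicit Types (u v : sFun) (e : eps R).

Lemma n1_lat (s r : R) (k : 'I_d -> int) : 0 < s -> (forall i, (`|k i|%N)%:R <= r * s) ->
  n1 (lat s k) <= d%:R * r.
Proof.
move=> s0 hk; apply: (@le_trans _ _ (\sum_(i < d) r)).
  apply: ler_sum => i _; rewrite mxE normrM normfV (gtr0_norm s0) ler_pdivrMr//.
  by rewrite -intr_norm -abszE; exact: hk.
by rewrite sumr_const card_ord mulr_natl.
Qed.

Lemma coord_lat_ge (s r : R) (k : 'I_d -> int) i : 0 < s -> r * s <= (`|k i|%N)%:R ->
  r <= n1 (lat s k).
Proof.
move=> s0 hk; apply: le_trans (coord_le_n1 _ i); rewrite mxE normrM normfV (gtr0_norm s0).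
by rewrite ler_pdivlMr// -intr_norm -abszE.
Qed.

Lemma mul_lip (M K : R) (a b p t : R) (x y : R) : 0 <= p <= 1 ->
  `|x| <= M -> `|y - x| <= M * t -> `|p - b| <= K * t -> 0 <= M -> 0 <= t ->
  `|y * p - x * b| <= (M + K * M) * t.
Proof.
move=> /andP[p0 p1] xM yx pb M0 t0.
have -> : y * p - x * b = (y - x) * p + x * (p - b) by ring.
apply: le_trans (ler_normD _ _) _; rewrite !normrM (ger0_norm p0) mulrDl; apply: lerD.
  by apply: le_trans (ler_piMr _ p1) _.
have -> : K * M * t = M * (K * t) by ring.
exact: ler_pM.
Qed.

Variables (Omega : set Rd) (u : sFun) (x0 : sRd).
Hypothesis hx0 : compact_points Omega x0.
Hypothesis hreg : forall xi0, ssphere xi0 -> microregular Omega u x0 xi0.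

Lemma near_fejer_error (NN q : R) : 0 <= NN -> 0 < q -> q <= 1 ->
  exists n4 n5, [/\ 5 <= n5 & \forall e \near small R,
    2 * (d%:R * ((pw e (- NN) + (scale_K q e)%:R * pw e (- NN)) * scale_s q e *
      (pw e n4 + 16 / (pw e n4 * (ceil_pw n5 e)%:R)))) <= 1].
Proof.
move=> NN0 q0 q1.
(* [rho^(-n3)] dominates the Lipschitz constant times [s], of order [rho^(-NN - 6q)] with [q <= 1].
   The moment parameter [rho^n4] then beats it, and the kernel order [rho^(-n5)] beats both it and
   [rho^(-n4)], each with [rho^2] to spare. *)
pose n3 := 7 + NN; pose n4 := n3 + 2; pose n5 := n3 + n4 + 2.
exists n4, n5; split; first by rewrite /n5 /n4 /n3; lra.
near=> e.
have KM : (pw e (- NN) + (scale_K q e)%:R * pw e (- NN)) <= 3 * pw e (- (5 * q)) * pw e (- NN).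
  have h : (scale_K q e)%:R <= 2 * pw e (- (5 * q)) by apply: ceil_pw_le; lra.
  have h1 : 1 <= pw e (- (5 * q)) by apply: pw_ge1; lra.
  rewrite -[X in X + _]mul1r -mulrDl; apply: ler_wpM2r; first exact: pw_ge0.
  by move: h h1; move: (scale_K q e)%:R (pw e _) => x y h h1; lra.
have KMs : (pw e (- NN) + (scale_K q e)%:R * pw e (- NN)) * scale_s q e <= pw e (- n3).
  have h1 : 3 * pw e (- (5 * q + NN + q)) <= pw e (- n3).
    by near: e; apply: near_pw_mul; rewrite /n3; lra.
  apply: le_trans h1; have -> : - (5 * q + NN + q) = - (5 * q) + - NN + - q by ring.
  by rewrite !pwD mulrA mulrA; apply: ler_wpM2r; first exact: pw_ge0.
have h16 : 16 / (pw e n4 * (ceil_pw n5 e)%:R) <= 16 * (pw e (- n4) * pw e n5).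
  rewrite ler_wpM2l// invfM -pwN ler_wpM2l ?pw_ge0//.
  rewrite -[n5 in leRHS]opprK pwN lef_pV2 ?posrE ?pw_gt0 ?ltr0n//.
  exact: ceil_pw_ge.
have E : 34 * d%:R * pw e 2 <= pw e 0 by near: e; apply: near_pw_mul.
rewrite pw0 in E.
apply: le_trans E.
have -> : 34 * d%:R * pw e 2 = 2 * (d%:R * (pw e 2 + 16 * pw e 2)) by ring.
do 2 (apply: ler_wpM2l; first by []).
apply: (@le_trans _ _ (pw e (- n3) * (pw e n4 + 16 * (pw e (- n4) * pw e n5)))).
  apply: ler_pM => //.
  - by rewrite mulr_ge0 ?addr_ge0 ?mulr_ge0 ?pw_ge0.
  - by rewrite addr_ge0 ?divr_ge0 ?mulr_ge0 ?pw_ge0.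
  - by rewrite lerD2l.
rewrite mulrDr mulrCA -!pwD.
have -> : - n3 + n4 = 2 by rewrite /n4; ring.
by have -> : - n3 + (- n4 + n5) = 2 by rewrite /n5; ring.
Unshelve. all: by end_near. Qed.

Definition band_A (L Nv q : R) (s : seq 'I_d) e : R :=
  pw e (- (6 * q)) ^+ size s * (2 * ((2 * L) ^+ d * pw e (- Nv))).

(** Lattice indices up to [rho^(-6q)] are frequencies up to order [rho^(-5q)], and with the spread
    they stay below [rho^(-6q)]. The transform itself is bounded through the sup of [v] alone, so
    [Nv] does not depend on [s]. *)
Lemma near_low v (L Nv q : R) (c : eps R -> Rd) s : 0 <= L -> 0 < q ->
  (\forall e \near small R, Cinfty (rep v e)) ->
  (\forall e \near small R, boxed L (rep v e)) ->
  (\forall e \near small R, forall y : Rd, nc (rep v e y) <= pw e (- Nv)) ->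
  \forall e \near small R, forall k : 'I_d -> int,
    (forall i, (`|k i|%N <= Num.truncn (pw e (- (6 * q))))%N) ->
    nc (fourier (fun x => partials s (rep v e) x * (localizer q c e x)%:C%C) (lat (scale_s q e) k))
      <= band_A L Nv q s e.
Proof.
move=> L0 q0 cv bv hNv; near=> e => k kB.
have cve : Cinfty (rep v e) by near: e; exact: cv.
have bve : boxed L (rep v e) by near: e; exact: bv.
have vNv : forall y, nc (rep v e y) <= pw e (- Nv) by near: e; exact: hNv.
apply: (spread_partials s cve bve (localizer_spreads c e q0)).
  by rewrite !mulr_ge0 ?exprn_ge0 ?pw_ge0// mulr_ge0.
move=> eta he; split; last exact: fourier_bound (@smooth_cnice _ _ _ [::] _ cve bve) L0 bve vNv.
have scE : pw e (- (5 * q)) * scale_s q e = pw e (- (6 * q)).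
  by rewrite /scale_s -pwD; congr pw; ring.
have h1 : n1 (lat (scale_s q e) k) <= d%:R * pw e (- (5 * q)).
  apply: n1_lat => [|i]; first exact: pw_gt0.
  have /andP[Ble _] := Num.Theory.truncn_itv (pw_ge0 e (- (6 * q))).
  by rewrite scE; apply: le_trans Ble; rewrite ler_nat.
have h2 : 2 * d%:R * pw e (- (5 * q)) <= pw e (- (6 * q)) by near: e; apply: near_pw_mul; lra.
have h3 : 4 * d%:R * pw e (- (4 * q)) <= pw e (- (6 * q)) by near: e; apply: near_pw_mul; lra.
have := n1D (eta - lat (scale_s q e) k) (lat (scale_s q e) k); rewrite subrK => h4.
apply: le_trans h4 _; apply: le_trans (lerD he h1) _.
move: h2 h3; move: (pw e _) (pw e _) (pw e _) => x y z h2 h3; lra.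
Unshelve. all: by end_near. Qed.

(** An index beyond [rho^(-6q)] in some coordinate gives a frequency of size at least [rho^(-5q)],
    and the order of the kernel keeps it below [rho^(-(n5 + 1))]: this is the range of
    [localized_negligible]. *)
Lemma near_high v (q a' n5 n6 : R) (c : eps R -> Rd) (s : seq 'I_d) :
  ModC (compact_points Omega) v -> (forall x, fast_close x x0 -> sapp u x = sapp v x) ->
  0 < q -> q <= 1 -> 0 < a' -> 5 <= n5 ->
  (\forall e \near small R, n1 (c e - rep x0 e) <= pw e a') ->
  \forall e \near small R, forall k : 'I_d -> int,
    (forall i, (`|k i|%N < ceil_pw n5 e)%N) ->
    (exists i, (Num.truncn (pw e (- (6 * q))) < `|k i|)%N) ->
    nc (fourier (fun x => partials s (rep v e) x * (localizer q c e x)%:C%C) (lat (scale_s q e) k))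
      <= pw e n6.
Proof.
move=> hv huv q0 q1 a0 n50 hc.
have qp : 5 * q <= n5 + 1 by lra.
have hneg := localized_negligible hd hx0 hreg hv huv q0 a0 hc s n6 qp.
near=> e => k kN [i kB].
have neg : forall xi : Rd, pw e (- (5 * q)) <= n1 xi <= pw e (- (n5 + 1)) ->
  nc (fourier (fun x => partials s (rep v e) x * (localizer q c e x)%:C%C) xi) <= pw e n6.
  by near: e; exact: hneg.
have scE : pw e (- (5 * q)) * scale_s q e = pw e (- (6 * q)).
  by rewrite /scale_s -pwD; congr pw; ring.
have s0 : 0 < scale_s q e by exact: pw_gt0.
apply: neg; apply/andP; split.
  apply: (@coord_lat_ge _ _ _ i) => //; rewrite scE.
  by apply/ltW/(lt_le_trans (Num.Theory.truncnS_gt _)); rewrite ler_nat.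
have h1 : n1 (lat (scale_s q e) k) <= d%:R * (ceil_pw n5 e)%:R.
  apply: n1_lat => // j; apply: (@le_trans _ _ (ceil_pw n5 e)%:R); first by rewrite ler_nat ltnW.
  by rewrite ler_peMr// scale_s_ge1.
have h2 : d%:R * 2 * pw e (- n5) <= pw e (- (n5 + 1)) by near: e; apply: near_pw_mul; lra.
apply: le_trans h1 _; apply: le_trans h2; rewrite -mulrA ler_wpM2l//.
by apply: ceil_pw_le; lra.
Unshelve. all: by end_near. Qed.

(** The number of band frequencies contributes [rho^(-6qd)], hence at most [rho^(-6d)], and the
    monomials contribute [6 q * size s]. The high frequencies sum to at most [1] by the choice of
    their exponent, and the extra [1] in the result absorbs constants. *)
Lemma near_sum (L Nv q n5 : R) (s : seq 'I_d) : 0 <= L -> 0 <= Nv -> 0 < q -> q <= 1 -> 0 <= n5 ->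
  \forall e \near small R,
   band_A L Nv q s e * (2 * Num.truncn (pw e (- (6 * q))) + 1)%:R ^+ d +
   pw e ((n5 + 1) * d%:R) * (ceil_pw n5 e)%:R ^+ d + 1 <=
   pw e (- (Nv + 6 * d%:R + 1 + 6 * q * (size s)%:R)).
Proof.
move=> L0 Nv0 q0 q1 n50; have d0 : 0 <= d%:R :> R by [].
have s0 : 0 <= (size s)%:R :> R by [].
pose m := Nv + 6 * d%:R + 6 * q * (size s)%:R.
near=> e.
have E3 : pw e ((n5 + 1) * d%:R) * (ceil_pw n5 e)%:R ^+ d <= 1.
  have h : 2 * pw e (- n5) <= pw e (- (n5 + 1)) by near: e; apply: near_pw_mul; lra.
  have h1 : (ceil_pw n5 e)%:R ^+ d <= pw e (- (n5 + 1)) ^+ d.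
    by rewrite lerXn2r ?nnegrE ?pw_ge0// (le_trans _ h)// ceil_pw_le.
  rewrite pwX in h1.
  apply: (@le_trans _ _ (pw e ((n5 + 1) * d%:R) * pw e (d%:R * - (n5 + 1)))).
    by rewrite ler_wpM2l ?pw_ge0.
  rewrite -pwD; have -> : (n5 + 1) * d%:R + d%:R * - (n5 + 1) = 0 by ring.
  by rewrite pw0.
have E4 : band_A L Nv q s e * (2 * Num.truncn (pw e (- (6 * q))) + 1)%:R ^+ d <=
    2 * (2 * L) ^+ d * 3 ^+ d * pw e (- m).
  have h1 : 1 <= pw e (- (6 * q)) by apply: pw_ge1; lra.
  have /andP[Ble _] := Num.Theory.truncn_itv (pw_ge0 e (- (6 * q))).
  have h2 : (2 * Num.truncn (pw e (- (6 * q))) + 1)%:R ^+ d <= (3 * pw e (- (6 * q))) ^+ d.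
    rewrite lerXn2r ?nnegrE ?mulr_ge0 ?pw_ge0// natrD natrM.
    by move: Ble h1; lra.
  have A0 : 0 <= band_A L Nv q s e.
    by rewrite !mulr_ge0 ?exprn_ge0 ?pw_ge0// mulr_ge0.
  apply: (@le_trans _ _ (band_A L Nv q s e * (3 * pw e (- (6 * q))) ^+ d)); first by rewrite ler_wpM2l.
  rewrite /band_A [(3 * _) ^+ _]exprMn !pwX.
  have -> : pw e ((size s)%:R * - (6 * q)) * (2 * ((2 * L) ^+ d * pw e (- Nv))) *
     (3 ^+ d * pw e (d%:R * - (6 * q))) = 2 * (2 * L) ^+ d * 3 ^+ d *
     (pw e ((size s)%:R * - (6 * q)) * pw e (- Nv) * pw e (d%:R * - (6 * q))) by ring.
  rewrite -!pwD ler_wpM2l ?mulr_ge0 ?exprn_ge0 ?mulr_ge0//.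
  apply: pw_le; rewrite /m.
  have : d%:R * (6 * q) <= d%:R * 6 by rewrite ler_wpM2l//; lra.
  by move: (d%:R : R) ((size s)%:R : R) => x y h; lra.
have E5 : (2 * (2 * L) ^+ d * 3 ^+ d + 2) * pw e (- m) <= pw e (- (m + 1)).
  by near: e; apply: near_pw_mul; lra.
have W1 : 1 <= pw e (- m).
  by apply: pw_ge1; rewrite oppr_le0 !addr_ge0 ?mulr_ge0// ltW.
have -> : Nv + 6 * d%:R + 1 + 6 * q * (size s)%:R = m + 1 by rewrite /m; ring.
apply: le_trans E5; rewrite [leRHS]mulrDl -[leLHS]addrA; apply: lerD => //.
by apply: le_trans (lerD E3 (lexx 1)) _; move: (pw e (- m)) W1 => z; lra.
Unshelve. all: by end_near. Qed.

Lemma value_bound v (q a' Nv : R) (c : eps R -> Rd) (s : seq 'I_d) :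
  ModC (compact_points Omega) v ->
  (forall x, fast_close x x0 -> sapp u x = sapp v x) ->
  (\forall e \near small R, forall y : Rd, nc (rep v e y) <= pw e (- Nv)) ->
  0 <= Nv -> 0 < q -> q <= 1 -> 0 < a' ->
  (\forall e \near small R, n1 (c e - rep x0 e) <= pw e a') ->
  \forall e \near small R,
    nc (partials s (rep u e) (c e)) <= pw e (- (Nv + 6 * d%:R + 1 + 6 * q * (size s)%:R)).
Proof.
move=> hv huv hNv Nv0 q0 q1 a0 hc.
have cv := ModC_smooth hv.
have [L L0 bv] := ModC_boxed hd hv.
have [N1 hN1] := partials_moderate s (ModC_moderate hv) cv.
have [N2 hN2] := choice (fun i => partials_moderate (i :: s) (ModC_moderate hv) cv).
have [Lc hLc] := center_bounded hx0 a0 hc.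
(* One exponent for the derivative and for its Lipschitz constants. It depends on [s], which is
   harmless: it enters only the Fejér error, made at most [1] by the choice of [n4] and [n5]. *)
pose NN : R := N1%:R + (\sum_i N2 i)%:R.
have NN0 : 0 <= NN by rewrite addr_ge0.
have [n4 [n5 [n55 herr]]] := near_fejer_error NN0 q0 q1.
have n50 : 0 <= n5 by lra.
have hlow := near_low c s L0 q0 cv bv hNv.
have hhigh := near_high ((n5 + 1) * d%:R) s hv huv q0 q1 a0 n55 hc.
have hsum := near_sum s L0 Nv0 q0 q1 n50.
have hnear := near_center q0 a0 hc s huv.
have hN2' : \forall e \near small R, forall (i : 'I_d) (y : Rd), nc (partials (i :: s) (rep v e) y) <= pw e (- (N2 i)%:R).
  by apply: filter_forall => i; exact: hN2.
near=> e.
have cve : Cinfty (rep v e) by near: e; exact: cv.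
have bve : boxed L (rep v e) by near: e; exact: bv.
have v1 : forall y, nc (partials s (rep v e) y) <= pw e (- N1%:R) by near: e; exact: hN1.
have v2 : forall i y, nc (partials (i :: s) (rep v e) y) <= pw e (- (N2 i)%:R).
  by near: e; exact: hN2'.
have ce : n1 (c e) <= Lc by near: e; exact: hLc.
have low : forall k : 'I_d -> int, (forall i, (`|k i|%N <= Num.truncn (pw e (- (6 * q))))%N) ->
    nc (fourier (fun x => partials s (rep v e) x * (localizer q c e x)%:C%C) (lat (scale_s q e) k))
      <= band_A L Nv q s e by near: e; exact: hlow.
have high : forall k : 'I_d -> int, (forall i, (`|k i|%N < ceil_pw n5 e)%N) ->
    (exists i, (Num.truncn (pw e (- (6 * q))) < `|k i|)%N) ->
    nc (fourier (fun x => partials s (rep v e) x * (localizer q c e x)%:C%C) (lat (scale_s q e) k))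
      <= pw e ((n5 + 1) * d%:R) by near: e; exact: hhigh.
have err : 2 * (d%:R * ((pw e (- NN) + (scale_K q e)%:R * pw e (- NN)) * scale_s q e *
      (pw e n4 + 16 / (pw e n4 * (ceil_pw n5 e)%:R)))) <= 1 by near: e; exact: herr.
have sum : band_A L Nv q s e * (2 * Num.truncn (pw e (- (6 * q))) + 1)%:R ^+ d +
   pw e ((n5 + 1) * d%:R) * (ceil_pw n5 e)%:R ^+ d + 1 <=
   pw e (- (Nv + 6 * d%:R + 1 + 6 * q * (size s)%:R)) by near: e; exact: hsum.
have uv : forall y : Rd, n1 (y - c e) < pw e q -> partials s (rep u e) y = partials s (rep v e) y.
  by near: e; exact: hnear.
(* The support then lies within half a period of [c e] in each coordinate, as the Fejér
   approximation requires. *)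
have sL : L + Lc <= scale_s q e by near: e; apply: near_pw_ge; rewrite oppr_lt0.
have M1 y : nc (partials s (rep v e) y) <= pw e (- NN).
  by apply: le_trans (v1 y) _; apply: pw_le; rewrite lerN2 lerDl.
have M2 i y : nc (partials (i :: s) (rep v e) y) <= pw e (- NN).
  apply: le_trans (v2 i y) _; apply: pw_le; rewrite lerN2 /NN (bigD1 i)//= natrD.
  by rewrite addrCA lerDl addr_ge0.
have [lipr lipi] := partials_lip cve M1 M2.
have s1 : 1 <= scale_s q e by exact: scale_s_ge1.
pose f x := partials s (rep v e) x * (localizer q c e x)%:C%C.
have nf : cnice f.
  by apply: cnice_blip; [exact: smooth_cnice bve|exact: (localizer_spreads c e q0).1].
have loc01 x : 0 <= localizer q c e x <= 1 by rewrite cos_kernel_ge0 cos_kernel_le1.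
set La := pw e (- NN) + _ in err.
have La0 : 0 <= La by rewrite addr_ge0 ?mulr_ge0 ?pw_ge0.
have fr x i h : `|complex.Re (f (x + h *: delta_mx ord0 i)) - complex.Re (f x)| <= La * `|h|.
  rewrite /f !ReM /= !mulr0 !subr0; apply: mul_lip => //; last exact: pw_ge0.
  - exact: lipr.1.
  - exact: lipr.2.
  - exact: cos_kernel_lip.
have fi x i h : `|complex.Im (f (x + h *: delta_mx ord0 i)) - complex.Im (f x)| <= La * `|h|.
  rewrite /f !ImM /= !mulr0 !add0r; apply: mul_lip => //; last exact: pw_ge0.
  - exact: lipi.1.
  - exact: lipi.2.
  - exact: cos_kernel_lip.
have f0 (x : Rd) i : pi * scale_s q e < `|x ord0 i - c e ord0 i| -> f x = 0.
  move=> xi; rewrite /f (boxed_partials s bve (i := i)) ?mul0r//.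
  have h3 : scale_s q e <= pi * scale_s q e.
    by rewrite ler_peMl ?(le_trans ler01 s1)// (le_trans _ (pi_ge2 R))// ler1n.
  have h1 := le_trans (coord_le_n1 (c e) i) ce; have h2 := ler_normB (x ord0 i) (c e ord0 i).
  have := lt_le_trans (le_lt_trans h3 xi) h2.
  by move: `|x ord0 i| `|c e ord0 i| (scale_s q e) sL h1 => a b s0; lra.
have A0 : 0 <= band_A L Nv q s e.
  by rewrite !mulr_ge0 ?exprn_ge0 ?pw_ge0// mulr_ge0.
have -> : partials s (rep u e) (c e) = f (c e).
  rewrite /f /localizer cos_kernel_center mulr1 uv// subrr /n1 big1 ?pw_gt0// => i _.
  by rewrite mxE normr0.
apply: le_trans sum; apply: le_trans (recover_band _ s1 (pw_gt0 e n4) La0 A0 (pw_ge0 e _) nf fr fi f0 low high) _ => //.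
by rewrite lerD2l.
Unshelve. all: by end_near. Qed.

End NecessityMain.

(** * Overspill from fast balls to a slow scale ball *)

Section NecessityEnd.
Variables (R : realType) (d : nat).
Local Notation Rd := 'rV[R]_d.
Local Notation nc := (@ComplexField.Normc.normc R).

(** For infinite [m] the radius [rho^(1 / (m + 1))] exceeds every [rho^a]. It is infinitesimal only
    if [m] grows slowly, which the second condition on [m] ensures. *)
Lemma pw_inv_slow (m : eps R -> nat) (C : R) : 0 < C ->
  (forall M, \forall e \near small R, (M <= m e)%N) ->
  (\forall e \near small R, pw e (m e).+1%:R^-1 <= (m e).+1%:R^-1) ->
  (forall a, 0 < a -> \forall e \near small R, pw e a <= pw e (m e).+1%:R^-1 / C) /\
  (forall a, 0 < a -> \forall e \near small R, pw e (m e).+1%:R^-1 / C <= a).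
Proof.
move=> C0 hm hpw.
have hM (a : R) : 0 < a -> \forall e \near small R, (m e).+1%:R^-1 <= a.
  move=> a0; apply: filterS (hm (Num.Def.archi_bound a^-1)) => e h.
  rewrite invf_ple ?posrE ?ltr0n//.
  apply/ltW/(lt_trans (Num.Theory.archi_boundP _)); first by rewrite invr_ge0 ltW.
  by rewrite ltr_nat ltnS.
split => a a0.
  have a20 : 0 < a / 2 by lra.
  near=> e.
  have h1 : (m e).+1%:R^-1 <= a / 2 by near: e; exact: hM.
  have h2 : C * pw e a <= pw e (a / 2) by near: e; apply: near_pw_mul; lra.
  rewrite ler_pdivlMr// mulrC; apply: le_trans h2 _; exact: pw_le.
have aC : 0 < a * C by rewrite mulr_gt0.
apply: filterS2 (hM _ aC) hpw => e h1 h2.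
by rewrite ler_pdivrMr// (le_trans h2).
Unshelve. all: by end_near. Qed.

(** Overspill runs over natural numbers, so the multi-indices are enumerated; a number that codes
    none stands for the zero index. *)
Definition multi_index (k : nat) : 'I_d -> nat :=
  if unpickle k is Some f then (f : {ffun 'I_d -> nat}) else fun=> 0%N.

Lemma multi_index_onto (al : 'I_d -> nat) : exists k, multi_index k = al.
Proof.
exists (pickle [ffun i => al i]); rewrite /multi_index pickleK.
by apply/funext => i; rewrite ffunE.
Qed.

Hypothesis hd : (0 < d)%N.

Lemma microregular_ModInfty (Omega : set Rd) (x0 : star R Rd) (u : star R (Rd -> R[i])) :
  compact_points Omega x0 -> Mod (compact_points Omega) u ->
  (forall xi0, ssphere xi0 -> microregular Omega u x0 xi0) ->
  exists2 V, slow_scale_nbhd x0 V & ModInfty V u.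
Proof.
move=> hx0 hu hreg; have d0 : 0 < d%:R :> R by rewrite ltr0n.
(* An arbitrary direction, used only to obtain the fixed localization [v]. *)
pose w : Rd := delta_mx ord0 (Ordinal hd).
have [v [hv huv _]] : microregular Omega u x0 (cls (fun=> w)).
  apply: hreg; apply: filterS (rep_cls (fun=> w)) => e /= ->.
  rewrite /enorm /dot (bigD1 (Ordinal hd))//= !mxE !eqxx mulr1 big1 ?addr0 ?sqrtr1// => j jd.
  by rewrite !mxE (negbTE jd) andbF mulr0.
have [Nv hNv] := partials_moderate [::] (ModC_moderate hv) (ModC_smooth hv).
(* The exponent of [value_bound] once [6 * q * size s] has been made at most [1]. *)
pose N0 : R := Nv%:R + 6 * d%:R + 2.
(* The first [j + 1] multi-indices are controlled on a ball whose radius exponent tends to [0] with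
   growing [j]. The last conjunct keeps the radius infinitesimal after overspill. *)
pose P j e := (forall (k : 'I_j.+1) (y : Rd), n1 (y - rep x0 e) <= pw e j.+1%:R^-1 ->
    nc (deriv_mi (multi_index k) (rep u e) y) <= pw e (- N0)) /\
  pw e j.+1%:R^-1 <= j.+1%:R^-1.
have hP j : \forall e \near small R, P j e.
  have k0 : 0 < j.+1%:R^-1 :> R by rewrite invr_gt0 ltr0n.
  suff H : \forall e \near small R, forall (k : 'I_j.+1) (y : Rd),
      n1 (y - rep x0 e) <= pw e j.+1%:R^-1 ->
      nc (deriv_mi (multi_index k) (rep u e) y) <= pw e (- N0).
    by apply: filterS2 H (near_pw_le k0 k0) => e.
  apply: filter_forall => k.
  apply: (near_forall_net (B := fun e (y : Rd) => n1 (y - rep x0 e) <= pw e j.+1%:R^-1)).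
    apply: nearW => e; exists (rep x0 e); rewrite subrr /n1 big1 ?pw_ge0// => i _.
    by rewrite mxE normr0.
  move=> c hc.
  set s := flatten [seq nseq (multi_index k i) i | i <- enum 'I_d].
  (* The freedom in [q] is spent here: the loss per derivative becomes so small that all derivatives
     in [s] together cost at most one power of [rho]. *)
  pose q : R := (6 * (size s)%:R + 1)^-1.
  have q10 : 0 < 6 * (size s)%:R + 1 :> R by rewrite ltr_wpDl ?mulr_ge0.
  have q0 : 0 < q by rewrite invr_gt0.
  have q1 : q <= 1 by rewrite invf_le1// lerDr mulr_ge0.
  have := value_bound hd hx0 hreg s hv huv hNv (ler0n _ _) q0 q1 k0 hc.
  apply: filterS => e h; apply: le_trans h _; apply: pw_le; rewrite lerN2 /N0.
  have : 6 * q * (size s)%:R <= 1.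
    have -> : 6 * q * (size s)%:R = (6 * (size s)%:R) / (6 * (size s)%:R + 1) by rewrite /q; ring.
    by rewrite ler_pdivrMr// mul1r lerDl.
  by move: (6 * q * (size s)%:R) => z; lra.
have [m [mP hm]] := overspill hP.
have hpw : \forall e \near small R, pw e (m e).+1%:R^-1 <= (m e).+1%:R^-1.
  by apply: filterS mP => e h; have [] := h (m e) (leqnn _).
have [r1 r2] := pw_inv_slow d0 hm hpw.
(* Division by [d] makes the Euclidean ball fit into the [n1] ball of [P]. *)
pose r : star R R := cls (fun e => pw e (m e).+1%:R^-1 / d%:R).
exists [set x | sle (sdist x x0) r].
  exists r; split => //.
    by apply/star_rel_cls; apply: nearW => e; rewrite divr_gt0// pw_gt0.
  have rE : sabs r = r.
    apply/clsP; apply: filterS (rep_cls (fun e => pw e (m e).+1%:R^-1 / d%:R)) => e ->.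
    by rewrite ger0_norm// divr_ge0 ?pw_ge0.
  move=> a a0; rewrite rE rho_powE; split; apply/star_rel_cls; [exact: r1|exact: r2].
split; first exact: hu.1.
move=> x xV; exists (Num.Def.archi_bound N0) => al.
have [k <-] := multi_index_onto al.
apply/sle_map_pow.
have xr : \forall e \near small R, enorm (rep x e - rep x0 e) <= pw e (m e).+1%:R^-1 / d%:R.
  move: xV; rewrite /= => /sle_sdist h.
  by apply: filterS2 h (rep_cls (fun e => pw e (m e).+1%:R^-1 / d%:R)) => e h E; rewrite E in h.
near=> e.
have h1 : forall k, (k <= m e)%N -> P k e by near: e; exact: mP.
have h2 : (k <= m e)%N by near: e; exact: hm.
have h3 : enorm (rep x e - rep x0 e) <= pw e (m e).+1%:R^-1 / d%:R by near: e; exact: xr.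
apply: (@le_trans _ _ (pw e (- N0))).
  have [H _] := h1 _ (leqnn _); apply: (H (Ordinal (h2 : (k < (m e).+1)%N))).
  apply: le_trans (n1_le_enorm _) _.
  by rewrite mulrC -ler_pdivlMr.
apply: pw_le; rewrite lerN2; apply/ltW/Num.Theory.archi_boundP.
by rewrite /N0 !addr_ge0// mulr_ge0.
Unshelve. all: by end_near. Qed.

End NecessityEnd.

(** * A smooth bump function *)

Section Bump.
Variable R : realType.
Implicit Types (P Q : {poly R}) (x t : R) (f g : R -> R).

Lemma is_derive_near f g x df : (\forall y \near x, f y = g y) ->
  is_derive x (1 : R) g df -> is_derive x (1 : R) f df.
Proof.
move=> fg [dg gE].
have fgx : f x = g x by exact: nbhs_singleton fg.
have E : (fun h => h^-1 *: ((f \o shift x) (h *: (1 : R)) - f x)) @ 0^' =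
         (fun h => h^-1 *: ((g \o shift x) (h *: (1 : R)) - g x)) @ 0^'.
  apply: eq_near_lim; apply: (@nbhs_dnbhs R 0).
  have : \forall h \near (0 : R), f (h + x) = g (h + x).
    move: fg => /nbhs_ballP[r /= r0 B]; apply: filterS (near0_norm r0) => h hr.
    by apply: B; rewrite /ball /= opprD addrCA subrr addr0 normrN.
  by apply: filterS => h E /=; rewrite fgx [h *: _]mulr1 E.
by split; [rewrite /derivable E|rewrite /derive E].
Qed.

Lemma poly_growth P : exists C k, 0 <= C /\ forall y : R, 1 <= y -> `|P.[y]| <= C * y ^+ k.
Proof.
exists (\sum_(i < size P) `|P`_i|), (size P); split; first exact: sumr_ge0.
move=> y y1; rewrite horner_coef mulr_suml; apply: le_trans (ler_norm_sum _ _ _) _.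
apply: ler_sum => i _; rewrite normrM ler_wpM2l// normrX ger0_norm ?(le_trans ler01)//.
by apply: ler_weXn2l => //; exact: ltnW.
Qed.

(** The polynomial is a parameter so that the family contains its own derivatives: differentiation
    sends [P] to [flat_deriv P], also at the origin. *)
Definition flat P x : R := if 0 < x then P.[x^-1] * expR (- x^-1) else 0.

Lemma flat_le P : exists2 C, 0 <= C & forall x, 0 < x -> x <= 1 -> `|flat P x| <= C * x.
Proof.
have [C [k [C0 Pk]]] := poly_growth P.
exists (C * (k.+1)`!%:R) => [|x x0 x1]; first by rewrite mulr_ge0.
have y1 : 1 <= x^-1 by rewrite invf_ge1.
have y0 : 0 < x^-1 by rewrite invr_gt0.
rewrite /flat x0 normrM (ger0_norm (expR_ge0 _)).
apply: (@le_trans _ _ (C * x^-1 ^+ k * ((k.+1)`!%:R / x^-1 ^+ k.+1))); last first.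
  rewrite exprSr invfM invrK le_eqVlt; apply/orP; left; apply/eqP; field.
  by rewrite expf_neq0// gt_eqF.
apply: ler_pM => //; rewrite ?expR_ge0//; first exact: Pk.
rewrite expRN -[leRHS]invrK lef_pV2 ?posrE ?expR_gt0//; last first.
  by rewrite invr_gt0 divr_gt0 ?exprn_gt0// ltr0n fact_gt0.
rewrite invf_div; apply: le_trans (expR_ge1Dxn k (ltW y0)).
by rewrite lerDr.
Qed.

Definition flat_deriv P : {poly R} := 'X^2 * (P - P^`()).

(** Away from [0] this is the chain rule. At [0] the difference quotient of [flat P] is
    [flat ('X * P)] on the right and zero on the left, and [flat_le] makes it tend to [0]. *)
Lemma is_derive_flat P x : is_derive x (1 : R) (flat P) (flat (flat_deriv P) x).
Proof.
have [x0|x0|x0] := ltgtP x 0.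
- have fE : flat (flat_deriv P) x = 0 by rewrite /flat ltNge (ltW x0).
  rewrite fE; apply: (@is_derive_near _ (cst (0 : R))).
    by apply: filterS (lt_nbhsl x0) => y y0; rewrite /flat ltNge (ltW y0).
- rewrite /flat x0; apply: (@is_derive_near _ (fun y => P.[y^-1] * expR (- y^-1))).
    by apply: filterS (lt_nbhsr x0) => y y0; rewrite y0.
  have xn0 : x != 0 by rewrite gt_eqF.
  have dV : is_derive x (1 : R) (fun y : R => y^-1) (- x ^- 2).
    rewrite -[- _]mulr1; apply: (@is_deriveV _ id) => //; exact: is_derive_id.
  have dP : is_derive x (1 : R) (fun y => P.[y^-1]) (P^`().[x^-1] * (- x ^- 2)).
    exact: (@is_derive1_comp _ (horner P) (fun y => y^-1)).

  have dE : is_derive x (1 : R) (fun y => expR (- y^-1)) (expR (- x^-1) * (x ^- 2)).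
    apply: (@is_derive1_comp _ expR (fun y => - y^-1)).
    by rewrite -[x ^- 2]opprK; exact: is_deriveN.
  have H := @is_deriveM _ _ (fun y : R => P.[y^-1]) (fun y : R => expR (- y^-1)) x 1 _ _ dP dE.
  apply: (is_derive_eq H).
  rewrite /flat_deriv !hornerE /GRing.scale /=; field; exact: xn0.
- rewrite {x}x0; have [C C0 HC] := flat_le ('X * P).
  have f0 Q : flat Q 0 = 0 by rewrite /flat ltxx.
  have lim0 : (fun h : R => h^-1 *: ((flat P \o shift 0) (h *: (1 : R)) - flat P 0)) h @[h --> 0^'] --> (0 : R).
    rewrite f0; apply/cvgrPdist_le => eta eta0.
    have r0 : 0 < Num.min 1 (eta / (C + 1)) by rewrite lt_min ltr01 divr_gt0// ltr_wpDl.
    apply: (@nbhs_dnbhs R 0); apply: filterS (near0_norm r0) => h.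
    rewrite lt_min => /andP[h1 heta].
    rewrite sub0r normrN subr0 /= addr0 [h *: _]mulr1.
    have [hp|hp] := ltP 0 h; last by rewrite /flat ltNge hp /= scaler0 normr0 ltW.
    have -> : h^-1 *: flat P h = flat ('X * P) h.
      by rewrite /flat hp hornerM hornerX -mulrA.
    rewrite gtr0_norm// in h1 heta; apply: le_trans (HC _ hp (ltW h1)) _.
    apply: (@le_trans _ _ ((C + 1) * h)); first by apply: ler_wpM2r; [exact: ltW|rewrite lerDl].
    by rewrite -ler_pdivlMl ?ltr_wpDl// mulrC ltW.
  rewrite f0; split; last by rewrite /derive; apply: cvg_lim.
  by rewrite /derivable; apply/cvg_ex; exists 0.
Qed.

Definition flat1 : R -> R := flat 1.

Lemma flat1_gt0 x : 0 < x -> 0 < flat1 x.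
Proof. by move=> x0; rewrite /flat1 /flat x0 hornerC mul1r expR_gt0. Qed.

Lemma flat1_le0 x : x <= 0 -> flat1 x = 0.
Proof. by move=> x0; rewrite /flat1 /flat ltNge x0. Qed.

Lemma flat1_ge0 x : 0 <= flat1 x.
Proof. by have [/flat1_le0 ->|/flat1_gt0/ltW] := leP x 0. Qed.

Definition step_den x : R := flat1 x + flat1 (1 - x).

Lemma step_den_gt0 x : 0 < step_den x.
Proof.
rewrite /step_den; have [x0|x0] := leP x 0.
  by rewrite (flat1_le0 x0) add0r flat1_gt0//; lra.
by rewrite ltr_pwDl ?flat1_gt0// flat1_ge0.
Qed.

(* A class of functions that contains the cutoff and is closed under
   differentiation. *)
Inductive sm : (R -> R) -> Prop :=
| sm_flat P : sm (flat P)
| sm_inv : sm (fun x => (step_den x)^-1)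
| sm_add f g : sm f -> sm g -> sm (fun x => f x + g x)
| sm_mul f g : sm f -> sm g -> sm (fun x => f x * g x)
| sm_scale a f : sm f -> sm (fun x => a * f x)
| sm_affine a b f : sm f -> sm (fun x => f (a * x + b)).

Lemma is_derive_affine a b f df x : is_derive (a * x + b) (1 : R) f df ->
  is_derive x (1 : R) (fun y => f (a * y + b)) (a * df).
Proof.
move=> fd; rewrite mulrC.
have H : is_derive x (1 : R) (fun y => a * y + b) a.
  have -> : (fun y => a * y + b) = (fun y => a *: (y : R)) + cst b by apply/funext.
  rewrite -[X in is_derive _ _ _ X]addr0 -[X in is_derive _ _ _ (X + _)]mulr1.
  by apply: is_deriveD; apply: is_deriveZ.
exact: (@is_derive1_comp _ f (fun y => a * y + b)).
Qed.

Lemma sm_deriv f : sm f -> exists2 g, sm g & forall x, is_derive x (1 : R) f (g x).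
Proof.
elim=> {f} [P||f g _ [f' sf' df] _ [g' sg' dg]|f g sf [f' sf' df] sg [g' sg' dg]|a f _ [f' sf' df]|a b f _ [f' sf' df]].
- by exists (flat (flat_deriv P)); [exact: sm_flat|exact: is_derive_flat].
- pose d1 := flat (flat_deriv 1).
  exists (fun x => (step_den x)^-1 * ((step_den x)^-1 * ((-1) * (d1 x + (-1) * d1 ((-1) * x + 1))))).
    apply: (sm_mul sm_inv); apply: (sm_mul sm_inv); apply: sm_scale; apply: sm_add.
      exact: sm_flat.
    by apply: sm_scale; apply: (sm_affine (-1) 1); exact: sm_flat.
  move=> x.
  have d2 : is_derive x (1 : R) step_den (d1 x + (-1) * d1 ((-1) * x + 1)).
    have -> : step_den = flat1 + (fun y => flat1 ((-1) * y + 1)).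
      by apply/funext => y; rewrite /step_den fctE; congr (_ + flat1 _); rewrite mulN1r addrC.
    apply: is_deriveD; first exact: is_derive_flat.
    by apply: is_derive_affine; exact: is_derive_flat.
  have := @is_deriveV _ _ _ _ _ (lt0r_neq0 (step_den_gt0 x)) d2.
  move=> H; apply: (is_derive_eq H); rewrite /GRing.scale /=.
  by move: (d1 x + _) (lt0r_neq0 (step_den_gt0 x)) => z sn0; field; exact: sn0.
- exists (fun x => f' x + g' x); first exact: sm_add.
  by move=> x; apply: is_deriveD.
- exists (fun x => f x * g' x + g x * f' x).
    by apply: sm_add; apply: sm_mul.
  by move=> x; exact: (@is_deriveM _ _ f g x 1 _ _ (df x) (dg x)).
- exists (fun x => a * f' x); first exact: sm_scale.
  by move=> x; exact: (@is_deriveZ _ _ _ f a x 1 _ (df x)).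
- exists (fun x => a * f' (a * x + b)); first exact/sm_scale/sm_affine.
  by move=> x; exact: is_derive_affine.
Qed.

Lemma sm_derivs f : sm f -> exists F : nat -> R -> R, F 0%N = f /\
  forall k x, is_derive x (1 : R) (F k) (F k.+1 x).
Proof.
move=> sf.
have ch (p : {f | sm f}) : exists q : {f | sm f}, forall x, is_derive x (1 : R) (sval p) (sval q x).
  case: p => h sh; have [g sg hg] := sm_deriv sh.
  by exists (exist _ g sg).
have [D DP] := choice ch.
exists (fun k => sval (iter k D (exist _ f sf))); split => // k x.
Qed.

(** [step] rises smoothly from [0] to [1] across [[0, 1]]; the two factors cut off on the left and
    on the right. *)
Definition plateau t : R := let step x := flat1 x * (step_den x)^-1 in
  step (2 * t + 2) * step (-2 * t + 2).

Lemma sm_plateau : sm plateau.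
Proof.
have s1 : sm (fun x => flat1 x * (step_den x)^-1) by exact: (sm_mul (sm_flat 1) sm_inv).
exact: (sm_mul (sm_affine 2 2 s1) (sm_affine (-2) 2 s1)).
Qed.

Lemma plateau1 t : `|t| <= 1 / 2 -> plateau t = 1.
Proof.
rewrite ler_norml => /andP[t1 t2].
have H x : 1 <= x -> flat1 x * (step_den x)^-1 = 1.
  move=> x1; rewrite /step_den [flat1 (1 - x)]flat1_le0 ?addr0 ?subr_le0// divff//.
  by rewrite gt_eqF// flat1_gt0//; lra.
by rewrite /plateau !H ?mulr1//; lra.
Qed.

Lemma plateau0 t : 1 <= `|t| -> plateau t = 0.
Proof.
rewrite /plateau ler_normr => /orP[t1|t1].
  by rewrite [flat1 (-2 * t + 2)]flat1_le0 ?mul0r ?mulr0//; lra.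
by rewrite [flat1 (2 * t + 2)]flat1_le0 ?mul0r//; lra.
Qed.

Lemma plateau_derivs : exists F : nat -> R -> R, [/\ F 0%N = plateau,
  forall k x, is_derive x (1 : R) (F k) (F k.+1 x),
  forall k t, 1 < `|t| -> F k t = 0 &
  forall k, exists M, forall t, `|F k t| <= M].
Proof.
have [F [F0 dF]] := sm_derivs sm_plateau.
have F1 k t : 1 < `|t| -> F k t = 0.
  elim: k t => [|k IH] t t1; first by rewrite F0 plateau0// ltW.
  have h0 : 0 < `|t| - 1 by rewrite subr_gt0.
  have nearF : \forall y \near t, F k y = (cst 0) y.
    apply/nbhs_ballP; exists (`|t| - 1) => //= y; rewrite /ball /= => ty.
    by apply: IH; have := lerB_normD t (y - t); rewrite subrKC distrC; move: ty; lra.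
  have H : is_derive t (1 : R) (F k) 0 by apply: (is_derive_near nearF).
  by have [_ <-] := dF k t; have [_ ->] := H.
exists F; split => // k.
have cF : continuous (F k).
  by move=> t; apply/differentiable_continuous/derivable1_diffP; have [] := dF k t.
have cN : continuous (fun t => `|F k t|).
  by move=> t; apply: (@continuous_comp _ _ _ (F k) Num.norm); [exact: cF|exact: norm_continuous].
have [|c _ hc] := @EVT_max R (fun t => `|F k t|) (-1) 1 _ (continuous_subspaceT cN); first by lra.
exists `|F k c| => t; have [t1|t1] := ltP 1 `|t|; first by rewrite F1// normr0.
by apply: hc; rewrite in_itv /= -ler_norml.
Qed.

End Bump.

(** * Rescaled cutoffs and the derivatives of their products *)

Section Cutoff.
Variables (R : realType) (d : nat) (F : nat -> R -> R).
Local Notation Rd := 'rV[R]_d.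
Local Notation nc := (@ComplexField.Normc.normc R).
Local Notation e i := (delta_mx (ord0 : 'I_1) i : 'rV[R]_d).
Hypothesis dF : forall k x, is_derive x (1 : R) (F k) (F k.+1 x).
Hypothesis F_out : forall k t, 1 < `|t| -> F k t = 0.
Variables (c : Rd) (r : R).
Hypothesis r0 : 0 < r.
Implicit Types (k : {ffun 'I_d -> nat}) (x : Rd).

(** All mixed derivatives of the rescaled plateau in one family: the powers of [1 / r] come from the
    chain rule, and differentiation along [i] merely increments [k i]. *)
Definition cutoff k x : R := \prod_i (r^-1 ^+ k i * F (k i) ((x ord0 i - c ord0 i) / r)).

Definition incr k i : {ffun 'I_d -> nat} := [ffun j => (k j + (j == i))%N].

Lemma is_derive_of_line (g : Rd -> R) x (v : Rd) dg :
  is_derive (0 : R) (1 : R) (fun s : R => g (x + s *: v)) dg -> is_derive x v g dg.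
Proof.
move=> H.
have E : (fun h : R => h^-1 *: (g (x + (h *: (1 : R) + 0) *: v) - g (x + 0 *: v)))
   = (fun h : R => h^-1 *: (g (h *: v + x) - g x)).
  apply/funext => h; congr (_ *: (g _ - g _)); last by rewrite scale0r addr0.
  by rewrite addr0 [h *: 1]mulr1 addrC.
have [D1 D2] := H; split.
  by move: D1; rewrite /derivable /= E.
by move: D2; rewrite /derive /= E.
Qed.

Lemma is_derive_cutoff k x i : is_derive x (e i) (cutoff k) (cutoff (incr k i) x).
Proof.
apply: is_derive_of_line.
pose G j := r^-1 ^+ k j * F (k j) ((x ord0 j - c ord0 j) / r).
have -> : (fun s : R => cutoff k (x + s *: e i)) = (fun s : R =>
    (\prod_(j | j != i) G j * r^-1 ^+ k i) *: F (k i) (r^-1 * s + (x ord0 i - c ord0 i) / r)).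
  apply/funext => s; rewrite /cutoff (bigD1 i)//= shiftE eqxx mulr1 [RHS]mulrAC [RHS]mulrC mulrA.
  have -> : (x ord0 i + s - c ord0 i) / r = r^-1 * s + (x ord0 i - c ord0 i) / r by ring.
  rewrite [RHS]mulrAC; congr (_ * _); apply: eq_bigr => j ji.
  by rewrite shiftE (negbTE ji) mulr0 addr0.
have -> : cutoff (incr k i) x = (\prod_(j | j != i) G j * r^-1 ^+ k i) *:
    (r^-1 * F (k i).+1 ((x ord0 i - c ord0 i) / r)).
  rewrite /cutoff (bigD1 i)//= /incr ffunE eqxx addn1 exprSr /GRing.scale /=.
  rewrite (eq_bigr G); first by ring.
  by move=> j ji; rewrite ffunE (negbTE ji) addn0.
apply: is_deriveZ; apply: is_derive_affine.
by rewrite mulr0 add0r; exact: dF.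
Qed.

Lemma cutoff_out k x i : r < `|x ord0 i - c ord0 i| -> cutoff k x = 0.
Proof.
move=> h; rewrite /cutoff (bigD1 i)//= F_out ?mulr0 ?mul0r//.
by rewrite normrM normfV (gtr0_norm r0) ltr_pdivlMr// mul1r.
Qed.

Lemma cutoff_bound k x M n : r <= 1 -> 1 <= M -> (\sum_i k i <= n)%N ->
  (forall j t, (j <= n)%N -> `|F j t| <= M) -> `|cutoff k x| <= r^-1 ^+ n * M ^+ d.
Proof.
move=> r1 M1 kn FM; have ri1 : 1 <= r^-1 by rewrite invf_ge1.
have ri0 : 0 <= r^-1 by rewrite invr_ge0 ltW.
have ki i : (k i <= n)%N by apply: leq_trans kn; rewrite (bigD1 i)//= leq_addr.
rewrite normr_prod; apply: (@le_trans _ _ (\prod_i (r^-1 ^+ k i * M))).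
  apply: ler_prod => i _; rewrite normr_ge0 normrM normrX (ger0_norm ri0).
  by rewrite ler_wpM2l ?exprn_ge0// FM.
rewrite big_split /= prodr_const card_ord -expr_sum ler_wpM2r ?exprn_ge0 ?(le_trans ler01)//.
exact: ler_weXn2l.
Qed.

Lemma continuous_cutoff k : continuous (cutoff k).
Proof.
have cFk j : continuous (F j).
  by move=> t; apply/differentiable_continuous/derivable1_diffP; have [] := dF j t.
pose G j x := r^-1 ^+ k j * F (k j) ((x ord0 j - c ord0 j) / r).
have cG j : continuous (G j).
  have ch : continuous (fun y : Rd => (y ord0 j - c ord0 j) / r).
    move=> x; apply: (@continuousM _ _ (fun y : Rd => y ord0 j - c ord0 j) (fun=> r^-1)).
      apply: (@continuousB _ _ _ (fun y : Rd => y ord0 j) (fun=> c ord0 j)).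
        exact: coord_continuous.
      exact: cst_continuous.
    exact: cst_continuous.
  have cFh : continuous (fun y : Rd => F (k j) ((y ord0 j - c ord0 j) / r)).
    by move=> x; apply: (@continuous_comp _ _ _ (fun y : Rd => (y ord0 j - c ord0 j) / r) (F (k j)));
      [exact: ch|exact: cFk].
  move=> x; apply: (@continuousM _ _ (fun=> r^-1 ^+ k j) (fun y : Rd => F (k j) ((y ord0 j - c ord0 j) / r))).
    exact: cst_continuous.
  exact: cFh.
suff H (l : seq 'I_d) : continuous (fun x => \prod_(j <- l) G j x) by exact: (H (index_enum 'I_d)).
elim: l => [|j l IH].
  have -> : (fun x => \prod_(j <- [::]) G j x) = (fun=> 1) by apply/funext => x; rewrite big_nil.
  exact: cst_continuous.
have -> : (fun x => \prod_(j <- j :: l) G j x) = (fun x => G j x * \prod_(j <- l) G j x).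
  by apply/funext => x; rewrite big_cons.
by move=> x; apply: (@continuousM _ _ (G j) (fun x => \prod_(j <- l) G j x)); [exact: cG|exact: IH].
Qed.

Variable u : Rd -> R[i].
Hypothesis cu : Cinfty u.

(* [leibniz s] lists the pairs of multi-index and sequence that index the terms
   of the derivative [partials s] of the product of the cutoff and [u]. *)
Definition term (p : {ffun 'I_d -> nat} * seq 'I_d) x : R[i] :=
  (cutoff p.1 x)%:C%C * partials p.2 u x.
Definition terms l x := \sum_(p <- l) term p x.
Definition leibniz1 i (l : seq ({ffun 'I_d -> nat} * seq 'I_d)) :=
  [seq (incr p.1 i, p.2) | p <- l] ++ [seq (p.1, i :: p.2) | p <- l].
Definition leibniz (s : seq 'I_d) := foldr leibniz1 [:: ([ffun=> 0%N], [::])] s.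

Lemma is_derive_seq (I : Type) (l : seq I) (g dg : I -> Rd -> R) x v :
  (forall p, is_derive x v (g p) (dg p x)) ->
  is_derive x v (fun y => \sum_(p <- l) g p y) (\sum_(p <- l) dg p x).
Proof.
move=> H; elim: l => [|p l IH].
  rewrite big_nil; have -> : (fun y => \sum_(p <- [::]) g p y) = cst 0.
    by apply/funext => y; rewrite big_nil.
  exact: is_derive_cst.
rewrite big_cons; have -> : (fun y => \sum_(q <- p :: l) g q y) = g p + (fun y => \sum_(q <- l) g q y).
  by apply/funext => y; rewrite big_cons.
exact: is_deriveD.
Qed.

Lemma is_derive_terms l i x :
  is_derive x (e i) (fun y => complex.Re (terms l y)) (complex.Re (terms (leibniz1 i l) x)) /\
  is_derive x (e i) (fun y => complex.Im (terms l y)) (complex.Im (terms (leibniz1 i l) x)).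
Proof.
rewrite /terms /leibniz1 big_cat !big_map ReD ImD /=.
have dterm (p : {ffun 'I_d -> nat} * seq 'I_d) :
  is_derive x (e i) (fun y => complex.Re (term p y))
    (complex.Re (term (incr p.1 i, p.2) x) + complex.Re (term (p.1, i :: p.2) x)) /\
  is_derive x (e i) (fun y => complex.Im (term p y))
    (complex.Im (term (incr p.1 i, p.2) x) + complex.Im (term (p.1, i :: p.2) x)).
  have dc := is_derive_cutoff p.1 x i; have [_ _ /(_ i x)[dR dI]] := cu p.2.
  split.
  - have -> : (fun y => complex.Re (term p y)) = (cutoff p.1 * (fun y => complex.Re (partials p.2 u y))).
      by apply/funext => y; rewrite /term ReM /= mul0r subr0.
    have H := @is_deriveM _ _ (cutoff p.1) (fun y => complex.Re (partials p.2 u y)) x (e i) _ _ dc (derivableP dR).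
    apply: (is_derive_eq H); rewrite /term !ReM /= !mul0r !subr0 addrC.
    by congr (_ + _); rewrite mulrC.
  - have -> : (fun y => complex.Im (term p y)) = (cutoff p.1 * (fun y => complex.Im (partials p.2 u y))).
      by apply/funext => y; rewrite /term ImM /= mul0r addr0.
    have H := @is_deriveM _ _ (cutoff p.1) (fun y => complex.Im (partials p.2 u y)) x (e i) _ _ dc (derivableP dI).
    apply: (is_derive_eq H); rewrite /term !ImM /= !mul0r !addr0 addrC.
    by congr (_ + _); rewrite mulrC.
split.
- have -> : (fun y => complex.Re (\sum_(p <- l) term p y)) = (fun y => \sum_(p <- l) complex.Re (term p y)).
    by apply/funext => y; rewrite Re_sum.
  rewrite !Re_sum -big_split /=.
  apply: (@is_derive_seq _ _ (fun p y => complex.Re (term p y))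
    (fun p y => complex.Re (term (incr p.1 i, p.2) y) + complex.Re (term (p.1, i :: p.2) y))) => p.
  exact: (dterm p).1.
- have -> : (fun y => complex.Im (\sum_(p <- l) term p y)) = (fun y => \sum_(p <- l) complex.Im (term p y)).
    by apply/funext => y; rewrite Im_sum.
  rewrite !Im_sum -big_split /=.
  apply: (@is_derive_seq _ _ (fun p y => complex.Im (term p y))
    (fun p y => complex.Im (term (incr p.1 i, p.2) y) + complex.Im (term (p.1, i :: p.2) y))) => p.
  exact: (dterm p).2.
Qed.

Lemma partial_terms i l : partial i (terms l) = terms (leibniz1 i l).
Proof.
apply/funext => x; have [[_ dR] [_ dI]] := is_derive_terms l i x.
by apply: complex_eq; rewrite /= ?dR ?dI.
Qed.

Definition cut_product x : R[i] := (cutoff [ffun=> 0%N] x)%:C%C * u x.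

Lemma partials_cut_product s : partials s cut_product = terms (leibniz s).
Proof.
elim: s => [|i s IH]; last by rewrite /= IH partial_terms.
by apply/funext => x; rewrite /terms big_cons big_nil addr0.
Qed.

Lemma continuous_terms l : continuous (fun x => complex.Re (terms l x)) /\
  continuous (fun x => complex.Im (terms l x)).
Proof.
elim: l => [|p l [IHr IHi]].
  split; (rewrite (_ : (fun x => _) = fun=> 0); first exact: cst_continuous);
    by apply/funext => x; rewrite /terms big_nil.
have [cr ci _] := cu p.2; have cc := @continuous_cutoff p.1.
split.
- have -> : (fun x => complex.Re (terms (p :: l) x)) =
     (fun x => cutoff p.1 x * complex.Re (partials p.2 u x) + complex.Re (terms l x)).
    by apply/funext => x; rewrite /terms big_cons ReD /term ReM /= mul0r subr0.
  move=> x; apply: (@continuousD _ _ _ (fun x => cutoff p.1 x * complex.Re (partials p.2 u x))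
    (fun x => complex.Re (terms l x))); last exact: IHr.
  by apply: (@continuousM _ _ (cutoff p.1) (fun x => complex.Re (partials p.2 u x))); [exact: cc|exact: cr].
- have -> : (fun x => complex.Im (terms (p :: l) x)) =
     (fun x => cutoff p.1 x * complex.Im (partials p.2 u x) + complex.Im (terms l x)).
    by apply/funext => x; rewrite /terms big_cons ImD /term ImM /= mul0r addr0.
  move=> x; apply: (@continuousD _ _ _ (fun x => cutoff p.1 x * complex.Im (partials p.2 u x))
    (fun x => complex.Im (terms l x))); last exact: IHi.
  by apply: (@continuousM _ _ (cutoff p.1) (fun x => complex.Im (partials p.2 u x))); [exact: cc|exact: ci].
Qed.

Lemma Cinfty_cut_product : Cinfty cut_product.
Proof.
move=> s; rewrite partials_cut_product; have [cr ci] := continuous_terms (leibniz s).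
split => // i x; have [[dR _] [dI _]] := is_derive_terms (leibniz s) i x.
by split.
Qed.

Lemma leibniz_order s p : p \in leibniz s -> (\sum_i p.1 i <= size s)%N.
Proof.
elim: s p => [p|i s IH p] /=.
  by rewrite inE => /eqP -> /=; rewrite big1// => i _; rewrite ffunE.
rewrite mem_cat => /orP[] /mapP[q /IH qs ->] /=; last exact: leqW.
rewrite (eq_bigr (fun j => q.1 j + (j == i))%N) => [|j _]; last by rewrite ffunE.
rewrite big_split /= -(addn1 (size s)) leq_add//.
by rewrite (bigD1 i)//= eqxx big1 ?addn0// => j /negbTE ->.
Qed.

Lemma nc_partials_cut_product s x M B : r <= 1 -> 1 <= M -> 0 <= B ->
  (forall j t, (j <= size s)%N -> `|F j t| <= M) ->
  (forall p, p \in leibniz s -> (forall i, `|x ord0 i - c ord0 i| <= r) -> nc (partials p.2 u x) <= B) ->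
  nc (partials s cut_product x) <= (size (leibniz s))%:R * (r^-1 ^+ size s * M ^+ d * B).
Proof.
move=> r1 M1 B0 FM HB.
have rM : 0 <= r^-1 ^+ size s * M ^+ d.
  by rewrite mulr_ge0// exprn_ge0// ?invr_ge0 ?(ltW r0)// (le_trans ler01).
rewrite partials_cut_product; apply: le_trans (nc_sum _ _) _.
rewrite big_seq; apply: (@le_trans _ _ (\sum_(p <- leibniz s | p \in leibniz s) (r^-1 ^+ size s * M ^+ d * B))).
  apply: ler_sum => p pl; rewrite /term ComplexField.Normc.normcM nc_real.
  have [h|/existsNP[i /negP]] := pselect (forall i, `|x ord0 i - c ord0 i| <= r).
    by rewrite ler_pM ?nc_ge0//; [apply: cutoff_bound => //; exact: leibniz_order|exact: HB].
  by rewrite -ltNge => /cutoff_out ->; rewrite normr0 mul0r mulr_ge0.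
by rewrite -big_seq big_const_seq count_predT iter_addr_0 mulr_natl.
Qed.

End Cutoff.

(** * From slow scale regularity to microlocal regularity *)

Section Sufficiency.
Variables (R : realType) (d : nat) (hd : (0 < d)%N).
Local Notation Rd := 'rV[R]_d.
Local Notation nc := (@ComplexField.Normc.normc R).

Lemma compact_open_margin (K Omega : set Rd) : compact K -> open Omega -> K `<=` Omega ->
  exists2 dl : R, 0 < dl & forall x y : Rd, K x -> (forall i, `|y ord0 i - x ord0 i| <= dl) -> Omega y.
Proof.
move=> cK oO KO.
have /compact_near_coveringP nK := cK.
have [dl /= dl0 H] : \forall dl \near (0 : R)^'+, K `<=` (fun x => forall y : Rd,
    (forall i, `|y ord0 i - x ord0 i| <= dl) -> Omega y).
  apply: (nK R (0 : R)^'+ (fun dl x => forall y : Rd,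
    (forall i, `|y ord0 i - x ord0 i| <= dl) -> Omega y)) => x Kx.
  have /nbhs_ballP[p /= p0 B] : nbhs x Omega by apply: open_nbhs_nbhs; split => //; exact: KO.
  have p20 : 0 < p / 2 by rewrite divr_gt0.
  exists ([set z | ball x (p / 2) z], [set dl : R | dl < p / 2]) => /=.
    by split; [exact: nbhsx_ballx|exact: nbhs_right_lt].
  move=> [z dl] /= [[_ xz] dlp] y hy; apply: B; split => // a b; rewrite (ord1 a).
  have := xz ord0 b; rewrite /ball /= => h1; have h2 := hy b.
  have -> : x ord0 b - y ord0 b = (x ord0 b - z ord0 b) + - (y ord0 b - z ord0 b) by ring.
  apply: le_lt_trans (ler_normD _ _) _; rewrite normrN.
  by rewrite [p]splitr; apply: ltr_leD => //; apply: le_trans h2 (ltW dlp).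
exists (dl / 2); first by rewrite divr_gt0.
move=> x y Kx; apply: (H (dl / 2)) => //=; last by rewrite divr_gt0.
by rewrite sub0r normrN gtr0_norm ?divr_gt0// ltr_pdivrMr// ltr_pMr// ltr1n.
Qed.

Lemma compact_cube (c : Rd) (r : R) : compact [set y : Rd | forall i, `|y ord0 i - c ord0 i| <= r].
Proof.
have -> : [set y : Rd | forall i, `|y ord0 i - c ord0 i| <= r] =
   [set y : Rd | forall i, [set` `[c ord0 i - r, c ord0 i + r]] (y ord0 i)].
  apply/seteqP; split => y /= H i; have := H i; rewrite /= in_itv /= ler_distl //.
by apply: (@rV_compact _ _ (fun i => [set` `[c ord0 i - r, c ord0 i + r]])) => i; exact: segment_compact.
Qed.

(** A standard compact neighbourhood of [K] inside [Omega], the sum of [K] and a small cube,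
    contains every point infinitely close to [x0]. *)
Lemma compact_points_cube (Omega : set Rd) (x0 y : star R Rd) (r : eps R -> R) :
  open Omega -> compact_points Omega x0 ->
  (forall a : R, 0 < a -> \forall e \near small R, r e <= a) ->
  (\forall e \near small R, forall i, `|rep y e ord0 i - rep x0 e ord0 i| <= r e) ->
  compact_points Omega y.
Proof.
move=> oO [K [cK [k0 Kk0] KO xK]] hr hy.
have [dl dl0 H] := compact_open_margin cK oO KO.
pose D : set Rd := [set z | forall i, `|z ord0 i - (0 : Rd) ord0 i| <= dl].
have cD : compact D by exact: compact_cube.
exists ((fun p : Rd * Rd => p.1 + p.2) @` (K `*` D)); split.
- apply: continuous_compact; last exact: compact_setX.
  by apply: continuous_subspaceT; exact: add_continuous.
- exists (k0 + 0); exists (k0, 0) => //; split => //= i.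
  by rewrite subrr normr0 ltW.
- move=> _ [[a b] /= [Ka Db] <-]; apply: (H a) => // i.
  by have := Db i; rewrite !mxE subr0 addrAC subrr add0r.
- near=> e; exists (rep x0 e, rep y e - rep x0 e); last by rewrite /= addrC subrK.
  split => /=; first by near: e; exact: xK.
  move=> i; rewrite !mxE subr0.
  have h1 : forall i, `|rep y e ord0 i - rep x0 e ord0 i| <= r e by near: e; exact: hy.
  by apply: le_trans (h1 i) _; near: e; exact: hr.
Unshelve. all: by end_near. Qed.

Lemma near_all_seq (T : eqType) (l : seq T) (P : T -> eps R -> Prop) :
  (forall p, \forall e \near small R, P p e) ->
  \forall e \near small R, forall p, p \in l -> P p e.
Proof.
move=> H; elim: l => [|p l IH]; first exact: nearW.
by apply: filterS2 (H p) IH => e h1 h2 q; rewrite inE => /orP[/eqP ->|/h2].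
Qed.

(* Saturation: if every [N] failed for some [alpha N], a single point would
   violate all these bounds. *)
Lemma ModInfty_uniform (x0 : star R Rd) (r : star R R) (V : set (star R Rd)) (u : star R (Rd -> R[i])) :
  (\forall e \near small R, 0 < rep r e) ->
  [set x | sle (sdist x x0) r] `<=` V -> ModInfty V u ->
  exists N : nat, forall al, \forall e \near small R, forall y : Rd,
    enorm (y - rep x0 e) <= rep r e -> nc (deriv_mi al (rep u e) y) <= pw e (- N%:R).
Proof.
move=> r0 rV [_ uV]; apply: contrapT => /forallNP H.
have H' N : exists al, ~ \forall e \near small R, forall y : Rd,
    enorm (y - rep x0 e) <= rep r e -> nc (deriv_mi al (rep u e) y) <= pw e (- N%:R).
  by apply/existsNP; exact: H.
have [al hal] := choice H'.
have [||N hN] := @diagonal_net R Rd (fun e y => enorm (y - rep x0 e) <= rep r e)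
    (fun N e y => nc (deriv_mi (al N) (rep u e) y) <= pw e (- N%:R)).
- apply: filterS r0 => e re; exists (rep x0 e).
  apply: le_trans (enorm_le_n1 _) _; rewrite subrr /n1 big1 ?ltW// => i _.
  by rewrite mxE normr0.
- move=> x hx; have xV : V (cls x).
    apply: rV; apply/sle_sdist; apply: filterS2 hx (rep_cls x) => e h E; by rewrite E.
  have [N hN] := uV _ xV; exists N; have := hN (al N); exact: (sle_map_pow_cls _ _ _ _).1.
exact: hal hN.
Qed.

(** The product of [u] with the slow scale cutoff serves for all [xi0] at once, since its transform
    is negligible at every fast scale frequency, whatever the direction. *)
Lemma ModInfty_microregular (Omega : set Rd) (x0 : star R Rd) (u : star R (Rd -> R[i]))
    (V : set (star R Rd)) : open Omega -> compact_points Omega x0 ->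
  slow_scale_nbhd x0 V -> ModInfty V u ->
  forall xi0, microregular Omega u x0 xi0.
Proof.
move=> oO hx0 [r [rpos rslow rV]] uV xi0.
have d0 : 0 < d%:R :> R by rewrite ltr0n.
have rsl a : 0 < a -> \forall e \near small R, pw e a <= rep r e <= a.
  by move=> a0; exact: slow_nonneg.
have r0 : \forall e \near small R, 0 < rep r e.
  by apply: filterS (rsl 1 ltr01) => e /andP[h _]; apply: lt_le_trans h; exact: pw_gt0.
have [N hN] := ModInfty_uniform r0 rV uV.
have cu : \forall e \near small R, Cinfty (rep u e) by exact: uV.1.
have [F [F0 dF Fout Fbd]] := plateau_derivs R.
(* The cube of half side [rr] lies in the Euclidean ball of radius [r]. *)
pose rr e := rep r e / d%:R.
have rr0 : \forall e \near small R, 0 < rr e.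
  by apply: filterS r0 => e h; rewrite divr_gt0.
have rrle a : 0 < a -> \forall e \near small R, rr e <= a.
  move=> a0; apply: filterS2 r0 (rsl a a0) => e h /andP[_ h2].
  rewrite ler_pdivrMr//; apply: le_trans h2 _; rewrite ler_peMr ?(ltW a0)// ler1n//.
have rrge a : 0 < a -> \forall e \near small R, pw e a <= rr e.
  move=> a0; have a20 : 0 < a / 2 by rewrite divr_gt0.
  have h : \forall e \near small R, d%:R * pw e a <= pw e (a / 2) by apply: near_pw_mul; lra.
  apply: filterS2 h (rsl _ a20) => e h1 /andP[h2 _].
  by rewrite ler_pdivlMr// mulrC (le_trans h1).
pose w e := cut_product F (rep x0 e) (rr e) (rep u e).
pose v : star R (Rd -> R[i]) := cls w.
have vE := rep_cls w.
have cw : \forall e \near small R, Cinfty (w e).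
  by apply: filterS cu => e c; exact: (Cinfty_cut_product dF).
have cube_ball e (y : Rd) : (forall i, `|y ord0 i - rep x0 e ord0 i| <= rr e) ->
    enorm (y - rep x0 e) <= rep r e.
  move=> h; apply: le_trans (enorm_le_n1 _) _.
  apply: (@le_trans _ _ (\sum_(i < d) rr e)).
    by apply: ler_sum => i _; rewrite !mxE.
  by rewrite sumr_const card_ord -[leLHS]mulr_natr /rr divfK// gt_eqF.
have [M HM] := choice Fbd.
(* [N] comes from [u]. One more power covers [rr^(- size s)], as [rr >= rho^(1 / (size s + 1))], and
   another the constants. The exponent is the same for all [s]. *)
have wbd s : \forall e \near small R, forall x, nc (partials s (w e) x) <= pw e (- (N.+2)%:R).
  pose Mx : R := 1 + \sum_(j < (size s).+1) `|M j|.
  have Mx1 : 1 <= Mx by rewrite lerDl sumr_ge0.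
  have FM j t : (j <= size s)%N -> `|F j t| <= Mx.
    move=> js; apply: le_trans (HM j t) _; apply: le_trans (ler_norm _) _.
    rewrite /Mx (bigD1 (Ordinal (js : (j < (size s).+1)%N)))//=.
    by rewrite addrCA lerDl addr_ge0// sumr_ge0.
  have s0 : 0 < ((size s).+1%:R)^-1 :> R by rewrite invr_gt0 ltr0n.
  have ubd : \forall e \near small R, forall p, p \in leibniz s -> forall y : Rd,
      enorm (y - rep x0 e) <= rep r e -> nc (partials p.2 (rep u e) y) <= pw e (- N%:R).
    apply: (@near_all_seq _ _ (fun p e => forall y : Rd, enorm (y - rep x0 e) <= rep r e ->
      nc (partials p.2 (rep u e) y) <= pw e (- N%:R))) => p.
    apply: filterS2 (hN (fun i => count_mem i p.2)) cu => e h c y /h.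
    by rewrite -(partialsE p.2 c).
  near=> e => x.
  have h1 : 0 < rr e by near: e; exact: rr0.
  have h2 : rr e <= 1 by near: e; exact: rrle.
  have h3 : forall p, p \in leibniz s -> forall y : Rd,
      enorm (y - rep x0 e) <= rep r e -> nc (partials p.2 (rep u e) y) <= pw e (- N%:R).
    by near: e; exact: ubd.
  have h4 : pw e ((size s).+1%:R)^-1 <= rr e by near: e; exact: rrge.
  have h5 : Cinfty (rep u e) by near: e; exact: cu.
  have := @nc_partials_cut_product R d F dF Fout (rep x0 e) (rr e) h1 (rep u e) h5 s x Mx (pw e (- N%:R))
     h2 Mx1 (pw_ge0 _ _) FM (fun p pl xb => h3 p pl x (cube_ball e x xb)).
  move=> h6; apply: le_trans h6 _.
  have h7 : (rr e)^-1 ^+ size s <= pw e (- 1).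
    apply: (@le_trans _ _ (pw e (- ((size s).+1%:R)^-1) ^+ size s)).
      rewrite lerXn2r ?nnegrE ?pw_ge0 ?invr_ge0 ?(ltW h1)// pwN lef_pV2 ?posrE ?pw_gt0//.
    rewrite pwX; apply: pw_le; rewrite mulrN lerN2 ler_pdivrMr ?ltr0n// mul1r ler_nat //.
  have h8 : (size (leibniz s))%:R * Mx ^+ d * pw e (- N.+1%:R) <= pw e (- N.+2%:R).
    by near: e; apply: near_pw_mul; rewrite ltrN2 ltr_nat.
  apply: le_trans h8; rewrite -[leRHS]mulrA; apply: ler_wpM2l => //.
  rewrite [_ * Mx ^+ d]mulrC -mulrA; apply: ler_wpM2l; first by rewrite exprn_ge0// (le_trans ler01).
  have -> : - N.+1%:R = - 1 + - N%:R :> R by rewrite -natr1; ring.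
  by rewrite pwD; apply: ler_wpM2r; first exact: pw_ge0.
have vbd s : \forall e \near small R, forall x, nc (partials s (rep v e) x) <= pw e (- (N.+2)%:R).
  by apply: filterS2 (wbd s) vE => e h ->.
have cv : \forall e \near small R, Cinfty (rep v e) by apply: filterS2 cw vE => e h ->.
have [L0 hL0] := compact_points_bounded hx0.
pose L : R := `|L0| + 1.
have L0' : 0 <= L by rewrite addr_ge0.
have wout : \forall e \near small R, forall (x : Rd) i, rr e < `|x ord0 i - rep x0 e ord0 i| -> w e x = 0.
  apply: filterS rr0 => e h x i xi.
  by rewrite /w /cut_product (cutoff_out Fout h _ xi) mul0r.
have bv : \forall e \near small R, boxed L (rep v e).
  near=> e => x i xi.
  have -> : rep v e = w e by near: e; exact: vE.
  have h1 : forall (x : Rd) i, rr e < `|x ord0 i - rep x0 e ord0 i| -> w e x = 0 by near: e; exact: wout.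
  apply: (h1 x i).
  have h2 : rr e <= 1 by near: e; exact: rrle.
  have h3 : n1 (rep x0 e) <= L0 by near: e; exact: hL0.
  have h4 := coord_le_n1 (rep x0 e) i.
  have h5 := lerB_dist (x ord0 i) (rep x0 e ord0 i); have h6 := ler_norm L0.
  by move: xi; rewrite /L; lra.
exists v; split.
- split; [split => //|].
    move=> al x _; exists N.+2; apply/sle_map_pow.
    by apply: filterS (vbd (flatten [seq nseq (al i) i | i <- enum 'I_d])) => e; exact.
  exists (star_set (fun e => [set y : Rd | forall i, `|y ord0 i - rep x0 e ord0 i| <= rr e])).
  split.
  + exists (fun e => [set y : Rd | forall i, `|y ord0 i - rep x0 e ord0 i| <= rr e]) => //.
    apply: filterS rr0 => e h; split; first exact: compact_cube.
    by exists (rep x0 e) => i /=; rewrite subrr normr0 ltW.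
  + by move=> y hy; exact: (compact_points_cube oO hx0 rrle hy).
  + move=> x hx.
    (* The test point is [x] itself wherever [x] lies in the cube and the centre elsewhere. It
       belongs to the internal cube, so a positive distance from it forces [x] outside the cube for
       small [e]. *)
    pose inside e := forall i, `|rep x e ord0 i - rep x0 e ord0 i| <= rr e.
    have ch e : exists z : Rd, (inside e -> z = rep x e) /\ (~ inside e -> z = rep x0 e).
      have [ins|nins] := pselect (inside e); first by exists (rep x e).
      by exists (rep x0 e).
    have [a aP] := choice ch.
    have Sa : star_set (fun e => [set y : Rd | forall i, `|y ord0 i - rep x0 e ord0 i| <= rr e]) (cls a).
      apply: filterS2 (rep_cls a) rr0 => e E h /=; rewrite E.
      have [ins|nins] := pselect (inside e); first by rewrite (aP e).1.
      by move=> i; rewrite (aP e).2// subrr normr0 ltW.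
    have /slt0_sdist hxa := hx _ Sa.
    apply/clsP; near=> e.
    have -> : rep v e = w e by near: e; exact: vE.
    have h1 : forall (x : Rd) i, rr e < `|x ord0 i - rep x0 e ord0 i| -> w e x = 0 by near: e; exact: wout.
    have h2 : 0 < enorm (rep x e - rep (cls a) e) by near: e; exact: hxa.
    have h3 : rep (cls a) e = a e by near: e; exact: rep_cls.
    have nin : ~ inside e.
      move=> ins; move: h2; rewrite h3 (aP e).1//.
      have := enorm_le_n1 (rep x e - rep x e); rewrite subrr /n1 big1 => [|i _]; last by rewrite mxE normr0.
      by move=> h; rewrite ltNge h.
    by move/existsNP: nin => [i /negP]; rewrite -ltNge; exact: h1.
(* Fast close points lie where the plateau equals [1]: [2 * rho^a <= rho^(a / 2) <= rr]. *)
- move=> x [a a0 /sdist_pow xa]; apply/sapp_eq; near=> e.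
  have -> : rep v e = w e by near: e; exact: vE.
  have h1 : enorm (rep x e - rep x0 e) <= pw e a by near: e; exact: xa.
  have h2 : pw e (a / 2) <= rr e by near: e; apply: rrge; rewrite divr_gt0.
  have h3 : 2 * pw e a <= pw e (a / 2) by near: e; apply: near_pw_mul; lra.
  have h4 : 0 < rr e by near: e; exact: rr0.
  rewrite /w /cut_product /cutoff big1 ?mul1r// => i _; rewrite ffunE expr0 mul1r F0.
  apply: plateau1; rewrite normrM normfV (gtr0_norm h4) ler_pdivrMr//.
  have := coord_le_enorm (rep x e - rep x0 e) i; rewrite !mxE.
  by move: h1 h2 h3; lra.
- move=> xi [a a0 /snorm_pow hxi] _ k; apply/sle_map_pow.
  (* Differentiating [m] times gains [rho^(m a)], which must beat [k], the loss [N.+2] and the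
     constants. *)
  pose m := Num.Def.archi_bound ((k%:R + N%:R + 4) / a).
  have ma : k%:R + N%:R + 4 < m%:R * a.
    rewrite -ltr_pdivrMr//; apply: Num.Theory.archi_boundP.
    by rewrite divr_ge0 ?(ltW a0)// !addr_ge0.
  (* The bound is needed for all [i] at once, because the axis of a large coordinate of [xi] may
     change with [e]. *)
  have vbd' : \forall e \near small R, forall (i : 'I_d) x, nc (partials (nseq m i) (rep v e) x) <= pw e (- (N.+2)%:R).
    by apply: filter_forall => i; exact: vbd.
  near=> e.
  have h1 : pw e (- a) <= enorm (rep xi e) by near: e; exact: hxi.
  have h2 : forall (i : 'I_d) x, nc (partials (nseq m i) (rep v e) x) <= pw e (- (N.+2)%:R).
    by near: e; exact: vbd'.
  have h3 : Cinfty (rep v e) by near: e; exact: cv.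
  have h4 : boxed L (rep v e) by near: e; exact: bv.
  have [i hi] : exists i, pw e (- a) / d%:R <= `|rep xi e ord0 i|.
    apply: contrapT => nh; have : n1 (rep xi e) < pw e (- a).
      apply: (@lt_le_trans _ _ (\sum_(i < d) pw e (- a) / d%:R)); last first.
        by rewrite sumr_const card_ord -[leLHS]mulr_natr divfK// gt_eqF.
      have lt i : `|rep xi e ord0 i| < pw e (- a) / d%:R.
        by rewrite ltNge; apply/negP => h; apply: nh; exists i.
      rewrite /n1 (bigD1 (Ordinal hd))//= [ltRHS](bigD1 (Ordinal hd))//=.
      by apply: ltr_leD => //; apply: ler_sum => j _; exact/ltW.
    by rewrite ltNge (le_trans h1)// enorm_le_n1.
  have h5 := fourier_bound (rep xi e) (smooth_cnice (nseq m i) h3 h4) L0' (boxed_partials (nseq m i) h4) (h2 i).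
  rewrite (nc_fourier_partials _ _ h3 h4) big_nseq iter_mulr_1 in h5.
  have h6 : 2 * (2 * L) ^+ d * d%:R ^+ m * pw e (m%:R * a - N.+2%:R) <= pw e k%:R.
    near: e; apply: near_pw_mul; move: ma; rewrite -[N.+2]addn2 natrD; lra.
  apply: le_trans h6.
  have g0 : 0 < (pw e (- a) / d%:R) ^+ m by rewrite exprn_gt0// divr_gt0// pw_gt0.
  rewrite -(ler_pM2l g0).
  apply: (@le_trans _ _ (`|rep xi e ord0 i| ^+ m * nc (fourier (rep v e) (rep xi e)))).
    by rewrite ler_wpM2r ?nc_ge0// lerXn2r ?nnegrE ?divr_ge0 ?pw_ge0.
  apply: le_trans h5 _; rewrite [(pw _ _ / _) ^+ _]exprMn exprVn pwX pwD.
  have -> : pw e (m%:R * - a) / d%:R ^+ m * (2 * (2 * L) ^+ d * d%:R ^+ m * (pw e (m%:R * a) * pw e (- N.+2%:R))) =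
    2 * ((2 * L) ^+ d * pw e (- N.+2%:R)) * (pw e (m%:R * - a) * pw e (m%:R * a)).
    by field; rewrite expf_neq0// gt_eqF.
  by rewrite -pwD mulrN addNr pw0 mulr1.
Unshelve. all: by end_near. Qed.

End Sufficiency.

Unset Implicit Arguments.

Theorem theorem7p4 (R : realType) (d : nat) (hd : (0 < d)%N)
    (Omega : set 'rV[R]_d) (hOmega : open Omega)
    (x0 : star R 'rV[R]_d) (hx0 : compact_points Omega x0)
    (u : star R ('rV[R]_d -> R[i])) (hu : Mod (compact_points Omega) u) :
  (forall xi0 : star R 'rV[R]_d, ssphere xi0 -> microregular Omega u x0 xi0)
  <->
  (exists2 V : set (star R 'rV[R]_d), slow_scale_nbhd x0 V & ModInfty V u).
Proof.
split; first exact: (microregular_ModInfty hd hx0 hu).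
by move=> [V hV uV] xi0 _; exact: (ModInfty_microregular hd hOmega hx0 hV uV xi0).
Qed.
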